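(* Assume that $$\forall K>0,\quad r(K):=\int_{[K,+\infty)}\int_{[K,+\infty)}\frac1{\rho_1+\rho_2}\,\lambda(d\rho_1)\lambda(d\rho_2)<\infty .$$ Let $T>0$ and, for any $K>0$, let $\hat G^K_1,\hat G^K_2:[0,T]\to\mathcal{M}_d(\mathbb{R})$ be measurable kernels such that, with $\hat\Delta^K_j(t)=\hat G^K_j(t)-G^K_j(t)$, there exists $\bar\Delta:[0,T]\to\mathbb{R}_+$ with $\int_0^T\bar\Delta^2(t)dt<\infty$ and $$\forall K>0,\ \forall t\in[0,T],\ \forall j\in\{1,2\},\quad \|\hat\Delta^K_j(t)\|\le\bar\Delta(t).$$ Let $X$ and $\hat X^K$ be the solutions on $[0,T]$ of $$X_t=x_0+\int_0^tG_1(t-s)b(X_s)ds+\int_0^tG_2(t-s)\sigma(X_s)dW_s,$$ $$\hat X^K_t=x_0+\int_0^t\hat G^K_1(t-s)b(\hat X^K_s)ds+\int_0^t\hat G^K_2(t-s)\sigma(\hat X^K_s)dW_s .$$ Then there exists a constant $C>0$ (not depending on $K$) such that for all $K>0$ $$\forall t\in[0,T],\quad \mathbb{E}[|X_t-\hat X^K_t|^2]\le C\Big(r(K)+\int_0^t\Big[\|\hat\Delta^K_1(s)\|^2+\|\hat\Delta^K_2(s)\|^2\Big]ds\Big).$$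
   Context: Fix $d\ge1$, a deterministic $x_0\in\mathbb{R}^d$ and a standard $d$-dimensional Brownian motion $W$ on a filtered probability space. $\mathcal{M}_d(\mathbb{R})$ is the space of real $d\times d$ matrices, $|\cdot|$ is the Euclidean norm on $\mathbb{R}^d$ and $\|\cdot\|$ the Frobenius norm on $\mathcal{M}_d(\mathbb{R})$; $\mathbb{R}_+=[0,\infty)$. The coefficients $b:\mathbb{R}^d\to\mathbb{R}^d$ and $\sigma:\mathbb{R}^d\to\mathcal{M}_d(\mathbb{R})$ satisfy, for some $L>0$, $|b(x)-b(y)|+\|\sigma(x)-\sigma(y)\|\le L|x-y|$ for all $x,y$. $\lambda$ is a (nonnegative) measure on $\mathbb{R}_+$ such that $\bar G(t):=\int_{\mathbb{R}_+}e^{-\rho t}\lambda(d\rho)<\infty$ for all $t>0$ and $\int_0^{S}\bar G(t)^2dt<\infty$ for all $S>0$. $M_1,M_2:\mathbb{R}_+\to\mathcal{M}_d(\mathbb{R})$ are bounded measurable, $G_j(t)=\int_{\mathbb{R}_+}e^{-\rho t}M_j(\rho)\lambda(d\rho)$ for $t>0$, and the truncated kernels are $G^K_j(t)=\int_{[0,K)}e^{-\rho t}M_j(\rho)\lambda(d\rho)$ for $K>0$, $t\ge0$, $j\in\{1,2\}$. A solution of a stochastic Volterra equation is an adapted measurable process with second moments bounded on $[0,T]$ satisfying the equation almost surely for each $t$; existence and uniqueness of strong solutions under these assumptions is known (X. Zhang). *)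

(* Defs.v *)
From HB Require Import structures.
From mathcomp Require Import all_boot all_order all_algebra.
From mathcomp Require Import all_classical all_reals all_analysis.

Set Implicit Arguments.
Unset Strict Implicit.
Unset Printing Implicit Defensive.

Import Order.TTheory GRing.Theory Num.Theory.
Import numFieldNormedType.Exports.

Local Open Scope classical_set_scope.
Local Open Scope ring_scope.

(* Frobenius norm; on column vectors ('cV[R]_d = 'M[R]_(d, 1)) it is the
   Euclidean norm. The library norm `|A| on matrices is the sup norm. *)
Definition fnorm (R : realType) (m n : nat) (A : 'M[R]_(m, n)) : R :=
  Num.sqrt (\sum_i \sum_j A i j ^+ 2).

Definition mx_measurable (R : realType) (disp : measure_display)
    (S : measurableType disp) (m n : nat) (D : set S) (f : S -> 'M[R]_(m, n)) :
    Prop :=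
  forall i j, measurable_fun D (fun x => f x i j).

(* Sub-sigma-algebras are plain sets of events, so measurability with respect
   to them is spelled out through preimages. *)
Definition sub_measurable (R : realType) (Omega : Type) (m n : nat)
    (G : set (set Omega)) (Y : Omega -> 'M[R]_(m, n)) : Prop :=
  forall i j (B : set R), measurable B -> G ((fun w => Y w i j) @^-1` B).

Definition generated_sigma (R : realType) (Omega : Type) (m n : nat)
    (Y : Omega -> 'M[R]_(m, n)) : set (set Omega) :=
  <<s [set A | exists i j (B : set R),
         measurable B /\ A = (fun w => Y w i j) @^-1` B] >>.

(* Only times t >= 0 are relevant; no usual conditions are required. *)
Definition is_filtration (R : realType) (disp : measure_display)
    (Omega : measurableType disp) (F : R -> set (set Omega)) : Prop :=
  [/\ forall t, 0 <= t -> sigma_algebra setT (F t),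
      forall t, 0 <= t -> F t `<=` measurable
    & forall s t, 0 <= s -> s <= t -> F s `<=` F t].

Definition independent_sets (R : realType) (disp : measure_display)
    (Omega : measurableType disp) (P : probability Omega R)
    (G H : set (set Omega)) : Prop :=
  forall A B, G A -> H B -> P (A `&` B) = (P A * P B)%E.

(* Mutual independence of the coordinates. Taking some of the B i equal to setT
   gives the product rule over every subfamily. *)
Definition independent_coords (R : realType) (disp : measure_display)
    (Omega : measurableType disp) (P : probability Omega R) (d : nat)
    (Y : Omega -> 'cV[R]_d) : Prop :=
  forall B : 'I_d -> set R, (forall i, measurable (B i)) ->
    P (\bigcap_(i in [set: 'I_d]) ((fun w => Y w i ord0) @^-1` B i)) =
    (\prod_(i < d) P ((fun w => Y w i ord0) @^-1` B i))%E.

(* The second parameter of normal_prob is the standard deviation. *)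
Definition is_brownian_motion (R : realType) (disp : measure_display)
    (Omega : measurableType disp) (P : probability Omega R)
    (F : R -> set (set Omega)) (d : nat) (W : R -> Omega -> 'cV[R]_d) : Prop :=
  [/\ {ae P, forall w, W 0 w = 0},
      {ae P, forall w, {within `[0, +oo[, continuous (fun t => W t w)}},
      forall t, 0 <= t -> sub_measurable (F t) (W t)
    & forall s t, 0 <= s -> s < t ->
        let dW := fun w => W t w - W s w in
        [/\ independent_sets P (F s) (generated_sigma dW),
            independent_coords P dW
          & forall i (B : set R), measurable B ->
              P ((fun w => dW w i ord0) @^-1` B) =
              normal_prob 0 (Num.sqrt (t - s)) B]].

(* The matrix-valued process equal to sp_coef i on ]sp_time i, sp_time i.+1]
   for i < sp_size, and to 0 elsewhere. *)
Record simple_process (R : realType) (Omega : Type) (d : nat) := SimpleProcess {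
  sp_size : nat ;
  sp_time : nat -> R ;
  sp_coef : nat -> Omega -> 'M[R]_d }.

Definition sp_eval (R : realType) (Omega : Type) (d : nat)
    (S : simple_process R Omega d) (s : R) (w : Omega) : 'M[R]_d :=
  \sum_(i < sp_size S)
    (\1_(`]sp_time S i, sp_time S i.+1] : set R) s) *: sp_coef S i w.

Definition sp_integral (R : realType) (Omega : Type) (d : nat)
    (W : R -> Omega -> 'cV[R]_d) (S : simple_process R Omega d) (w : Omega) :
    'cV[R]_d :=
  \sum_(i < sp_size S)
    sp_coef S i w *m (W (sp_time S i.+1) w - W (sp_time S i) w).

Definition is_simple_process (R : realType) (Omega : Type)
    (F : R -> set (set Omega)) (t : R) (d : nat)
    (S : simple_process R Omega d) : Prop :=
  forall i, (i < sp_size S)%N ->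
    [/\ 0 <= sp_time S i, sp_time S i <= sp_time S i.+1,
        sp_time S i.+1 <= t,
        sub_measurable (F (sp_time S i)) (sp_coef S i)
      & exists c : R, forall w, fnorm (sp_coef S i w) <= c].

(* I is (a version of) the Ito integral of H dW over [0, t]: the L^2(P) limit
   of the integrals of simple processes converging to H in
   L^2(Omega x [0, t]). *)
Definition is_ito_integral (R : realType) (disp : measure_display)
    (Omega : measurableType disp) (P : probability Omega R)
    (F : R -> set (set Omega)) (d : nat) (W : R -> Omega -> 'cV[R]_d) (t : R)
    (H : R -> Omega -> 'M[R]_d) (I : Omega -> 'cV[R]_d) : Prop :=
  [/\ mx_measurable (`[0, t] `*` [set: Omega]) (fun p : R * Omega => H p.1 p.2),
      mx_measurable [set: Omega] I
    & exists S : nat -> simple_process R Omega d,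
        [/\ forall n, is_simple_process F t (S n),
            (\int[P]_w \int[lebesgue_measure]_(s in `[0%R, t])
               (fnorm (sp_eval (S n) s w - H s w) ^+ 2)%:E)%E
              @[n --> \oo] --> 0%E
          & ('E_P[fun w => (fnorm (sp_integral W (S n) w - I w) ^+ 2)%R])%E
              @[n --> \oo] --> 0%E]].

Definition is_volterra_solution (R : realType) (disp : measure_display)
    (Omega : measurableType disp) (P : probability Omega R)
    (F : R -> set (set Omega)) (d : nat) (W : R -> Omega -> 'cV[R]_d) (T : R)
    (x0 : 'cV[R]_d) (b : 'cV[R]_d -> 'cV[R]_d) (sigma : 'cV[R]_d -> 'M[R]_d)
    (G1 G2 : R -> 'M[R]_d) (X : R -> Omega -> 'cV[R]_d) : Prop :=
  [/\ forall t, 0 <= t <= T -> sub_measurable (F t) (X t),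
      mx_measurable (`[0, T] `*` [set: Omega]) (fun p : R * Omega => X p.1 p.2),
      exists c : R, forall t, 0 <= t <= T ->
        ('E_P[fun w => (fnorm (X t w) ^+ 2)%R] <= c%:E)%E
    & forall t, 0 <= t <= T ->
        exists2 I : Omega -> 'cV[R]_d,
          is_ito_integral P F W t (fun s w => G2 (t - s) *m sigma (X s w)) I
        & {ae P, forall w, X t w =
            x0
            + \col_i \int[lebesgue_measure]_(s in `[0, t])
                        (G1 (t - s) *m b (X s w)) i ord0
            + I w}].

Definition Gbar (R : realType)
    (lam : {measure set (measurableTypeR R) -> \bar R}) (t : R) : \bar R :=
  (\int[lam]_(rho in `[0%R, +oo[) (expR (- (rho * t)))%:E)%E.

(* Only meaningful for t > 0, the integral possibly diverging at t = 0. *)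
Definition kernel_of (R : realType)
    (lam : {measure set (measurableTypeR R) -> \bar R}) (d : nat)
    (M : R -> 'M[R]_d) (t : R) : 'M[R]_d :=
  \matrix_(i, j) \int[lam]_(rho in `[0, +oo[) (expR (- (rho * t)) * M rho i j).

Definition truncated_kernel (R : realType)
    (lam : {measure set (measurableTypeR R) -> \bar R}) (d : nat)
    (M : R -> 'M[R]_d) (K t : R) : 'M[R]_d :=
  \matrix_(i, j) \int[lam]_(rho in `[0, K[) (expR (- (rho * t)) * M rho i j).

Definition tail_r (R : realType)
    (lam : {measure set (measurableTypeR R) -> \bar R}) (K : R) : \bar R :=
  (\int[lam]_(rho1 in `[K, +oo[) \int[lam]_(rho2 in `[K, +oo[)
     ((rho1 + rho2)^-1)%:E)%E.

(* Main.v *)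
(* Both coefficient maps are globally Lipschitz and the drift and the Ito
   integral are controlled in L^2, so E|X_t - Xhat_t|^2 is bounded by a multiple
   of the integrals over [0, t] of |G_j - Ghat_j|^2 plus the convolution of
   E|X_s - Xhat_s|^2 with a function g dominating |G_j|^2 and |Ghat_j|^2 for all
   K at once (g = C (Gbar^2 + Dbar^2), integrable by assumption). A
   Gronwall-type inequality for such convolutions removes the second term. For
   the first one, G_j - Ghat_j = (G_j - G_j^K) - Delta_j, where G_j - G_j^K is at
   most a multiple of the Laplace transform of lambda restricted to [K, +oo[, and
   the integral of the square of the latter is, by Tonelli,
     int int (1 - e^{-(rho1 + rho2) t}) / (rho1 + rho2) <= r(K).

   The Ito integral being defined as an L^2 limit of integrals of simple
   processes, all that is used of it is that it is L^2-Lipschitz, which follows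
   from the isometry for simple processes. The second moment of the standard
   Gaussian enters only through its finiteness. *)
Require Import Defs.
From HB Require Import structures.
From mathcomp Require Import all_boot all_order all_algebra.
From mathcomp Require Import all_classical all_reals all_analysis.
From mathcomp Require Import measurable_realfun ring lra.

Set Implicit Arguments.
Unset Strict Implicit.
Unset Printing Implicit Defensive.

Import Order.TTheory GRing.Theory Num.Theory.
Import numFieldNormedType.Exports.

Local Open Scope classical_set_scope.
Local Open Scope ring_scope.

(** * Integration *)

(** The constant must not depend on K, whereas the moment bound that comes with each solution Xhat^K
    may. The integrands are therefore compared through (G - Ghat) b(X) + Ghat (b(X) - b(Xhat)), and
    likewise for sigma: only moments of the fixed process X multiply the kernel error, and the bound
    on Xhat^K serves merely to make the supremum in the Gronwall argument finite. Two approximating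
    simple processes live on unrelated time grids. The isometry is proved for finite families of
    intervals that may overlap, so that a difference of simple processes is just the union of two
    families and no common refinement is formed. Gbar(0) is the total mass of lambda and may be
    infinite. Kernel bounds thus hold at positive times only, and the dominating function g is
    integrable but possibly unbounded. Gronwall with a bounded kernel does not apply; an
    exponentially weighted supremum norm takes its place. *)

Section tonelli_on.
Context d1 d2 (T1 : measurableType d1) (T2 : measurableType d2) (R : realType).
Variables (m1 : {sigma_finite_measure set T1 -> \bar R})
          (m2 : {sigma_finite_measure set T2 -> \bar R}).
Variables (A : set T1) (B : set T2) (mA : measurable A) (mB : measurable B).
Variable f : T1 * T2 -> \bar R.
Hypothesis mf : measurable_fun (A `*` B) f.
Hypothesis f0 : forall z, (A `*` B) z -> (0 <= f z)%E.

(** Extension by zero off the rectangle: Tonelli on the whole space applies to [g], while [f] has to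
    be measurable and nonnegative on the rectangle only, as for processes controlled on [[0, t]]. *)
Let g := f \_ (A `*` B).

Let mg : measurable_fun setT g.
Proof. by apply/(measurable_restrictT f (measurableX mA mB)). Qed.

Let g0 z : (0 <= g z)%E.
Proof. by rewrite /g patchE; case: ifPn => // /set_mem; exact: f0. Qed.

Let gF x : (fun x => \int[m2]_(y in B) f (x, y))%E \_ A x =
  (\int[m2]_y g (x, y))%E.
Proof.
rewrite patchE; case: ifPn => [xA|xA].
  rewrite integral_mkcond; apply: eq_integral => y _; rewrite /g !patchE.
  by rewrite in_setX/= xA.
by rewrite integral0_eq// => y _; rewrite /g patchE in_setX/= (negbTE xA).
Qed.

Let gG y : (fun y => \int[m1]_(x in A) f (x, y))%E \_ B y =
  (\int[m1]_x g (x, y))%E.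
Proof.
rewrite patchE; case: ifPn => [yB|yB].
  rewrite integral_mkcond; apply: eq_integral => x _; rewrite /g !patchE.
  by rewrite in_setX/= yB andbT.
by rewrite integral0_eq// => x _; rewrite /g patchE in_setX/= (negbTE yB) andbF.
Qed.

Lemma measurable_tonelli1_on :
  measurable_fun A (fun x => \int[m2]_(y in B) f (x, y))%E.
Proof.
apply/(measurable_restrictT _ mA); rewrite (funext gF).
exact: (measurable_fun_fubini_tonelli_F (m2 := m2)).
Qed.

Lemma measurable_tonelli2_on :
  measurable_fun B (fun y => \int[m1]_(x in A) f (x, y))%E.
Proof.
apply/(measurable_restrictT _ mB); rewrite (funext gG).
exact: (measurable_fun_fubini_tonelli_G (m1 := m1)).
Qed.

Lemma tonelli_on :
  (\int[m1]_(x in A) \int[m2]_(y in B) f (x, y) =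
   \int[m2]_(y in B) \int[m1]_(x in A) f (x, y))%E.
Proof.
rewrite integral_mkcond (funext gF) [RHS]integral_mkcond (funext gG).
exact: fubini_tonelli.
Qed.

End tonelli_on.

(** By uniqueness of Lebesgue measure it is enough to treat []a, b]], whose preimage [[t - b, t -
    a[] has the same length. *)
Lemma lebesgue_measure_reflect (R : realType) (t : R) (A : set R) :
  measurable A ->
  pushforward lebesgue_measure
    ((fun s => t - s) : _ -> measurableTypeR R) A = lebesgue_measure A.
Proof.
have mr : measurable_fun setT ((fun s : R => t - s) : _ -> measurableTypeR R).
  exact: measurable_funB.
move=> mA; apply/esym/lebesgue_measure_unique => //= _ [[a b]] _ <-.
rewrite /pushforward/=.
have -> : (fun s : R => t - s) @^-1` `]a, b] = `[t - b, t - a[%classic.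
  by apply/seteqP; split => s /=; rewrite !in_itv/= => /andP[? ?]; apply/andP; split; lra.
rewrite !lebesgue_measure_itv/= !lte_fin; case: ifPn => [ab|ab].
  by rewrite ifT; [congr EFin; lra|lra].
by rewrite ifF//; lra.
Qed.

Lemma ge0_integral_reflect (R : realType) (t : R) (f : R -> \bar R) :
  measurable_fun (`[0, t] : set R) f -> (forall s : R, 0 <= s <= t -> (0 <= f s)%E) ->
  (\int[lebesgue_measure]_(s in `[0%R, t]) f (t - s)%R =
   \int[lebesgue_measure]_(s in `[0%R, t]) f s)%E.
Proof.
move=> mf f0.
have mr : measurable_fun setT ((fun s : R => t - s) : measurableTypeR R -> measurableTypeR R).
  exact: measurable_funB.
rewrite [RHS](_ : _ = \int[pushforward lebesgue_measure
    ((fun s => t - s)%R : measurableTypeR R -> measurableTypeR R)]_(s in `[0%R, t])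
    f s)%E; last first.
  by apply: eq_measure_integral => A mA _; exact/esym/(lebesgue_measure_reflect t mA).
rewrite ge0_integral_pushforward//; last by move=> s; rewrite inE/= in_itv/=; exact: f0.
congr (integral _ _ _); apply/seteqP; split => s /=;
  by rewrite !in_itv/= => /andP[? ?]; apply/andP; split; lra.
Qed.

(** Cauchy-Schwarz against the constant 1, obtained by integrating [(v - a) ^+ 2 >= 0]. *)
Lemma sqr_Rintegral_le (R : realType) (t : R) (v : R -> R) : 0 <= t ->
  lebesgue_measure.-integrable `[0, t] (EFin \o v) ->
  (((\int[lebesgue_measure]_(s in `[0, t]) v s) ^+ 2)%:E <=
   t%:E * \int[lebesgue_measure]_(s in `[0%R, t]) (v s ^+ 2)%:E)%E.
Proof.
move=> t0 iv; have [te|te] := eqVneq t 0.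
  by rewrite te set_itv1 Rintegral_set1 expr0n/= mul0e.
have {te}t0' : 0 < t by rewrite lt_neqAle eq_sym te.
have mv : measurable_fun (`[0, t] : set R) v.
  by apply/measurable_EFinP; exact: measurable_int iv.
have [fin|inf] := ltP (\int[lebesgue_measure]_(s in `[0%R, t]) (v s ^+ 2)%:E)%E +oo%E; last first.
  move: inf; rewrite leye_eq => /eqP ->; by rewrite gt0_muley ?lte_fin ?leey.
have iv2 : lebesgue_measure.-integrable (`[0, t] : set R) (EFin \o (fun s => v s ^+ 2)).
  apply/integrableP; split; first exact/measurable_EFinP/measurable_funX.
  by under eq_integral do rewrite /= ger0_norm ?sqr_ge0//.
set m := Rintegral _ _ _.
have key a : 2 * a * m <= \int[lebesgue_measure]_(s in `[0, t]) (v s ^+ 2) + a ^+ 2 * t.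
  have ic : lebesgue_measure.-integrable (`[0, t] : set R) (EFin \o cst (a ^+ 2)).
    apply: measurable_bounded_integrable => //; last first.
      exists `|a ^+ 2|; split => //= M /ltW aM x _; exact: le_trans aM.
    by rewrite /= lebesgue_measure_itv/=; case: ifP; rewrite -?EFinD ltry.
  have -> : a ^+ 2 * t = \int[lebesgue_measure]_(s in `[0, t]) (cst (a ^+ 2) s).
    rewrite Rintegral_cst//= lebesgue_measure_itv/= lte_fin; case: ifPn => [_|].
      by rewrite oppr0 addr0.
    by rewrite t0'.
  rewrite -RintegralD// /m -RintegralZl//; apply: le_Rintegral => //.
  - exact: (integrableZl _ _ iv).
  - exact: (integrableD _ iv2 ic).
  - move=> x _; rewrite /cst; have := sqr_ge0 (v x - a); rewrite sqrrB; lra.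
have E : (\int[lebesgue_measure]_(s in `[0%R, t]) (v s ^+ 2)%:E)%E =
    (\int[lebesgue_measure]_(s in `[0, t]) (v s ^+ 2))%:E.
  by rewrite /Rintegral fineK//; exact: integrable_fin_num iv2.
rewrite E -EFinM lee_fin.
(* The mean [m / t] maximises [2 * a * m - a ^+ 2 * t] over [a], with value [m ^+ 2 / t]. *)
have := key (m / t); move: (\int[_]_(_ in _) _) => I H.
have tm : t * (m / t) = m by rewrite mulrC divfK// gt_eqF.
have : 0 <= t * (I + (m / t) ^+ 2 * t - 2 * (m / t) * m) by rewrite mulr_ge0// subr_ge0.
set q := m / t in tm H *; nra.
Qed.

Section density.
Import HBNNSimple.
Context d (T : measurableType d) (R : realType).
Variables (nu mu : {measure set T -> \bar R}) (g : T -> R).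
Hypothesis mg : measurable_fun setT g.
Hypothesis g0 : forall x, 0 <= g x.
Hypothesis nuE : forall A, measurable A -> nu A = (\int[mu]_(x in A) (g x)%:E)%E.

(** Holds for indicators by [nuE], for simple functions by linearity, and in general by monotone
    convergence. It turns integrals against [normal_prob] into Lebesgue integrals. *)
Lemma ge0_integral_density (f : T -> R) :
  measurable_fun setT f -> (forall x, 0 <= f x) ->
  (\int[nu]_x (f x)%:E = \int[mu]_x (f x * g x)%:E)%E.
Proof.
move=> mf f0.
have mEf : measurable_fun setT (EFin \o f) by exact/measurable_EFinP.
have f0E x : setT x -> (0 <= (EFin \o f) x)%E by rewrite lee_fin.
pose h := nnsfun_approx measurableT mEf.
have nuh n : (\int[nu]_x (h n x)%:E = \int[mu]_x (h n x * g x)%:E)%E.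
  under eq_integral do rewrite fimfunE -fsumEFin//.
  rewrite ge0_integral_fsum//; last 2 first.
  - by move=> r; exact/measurable_EFinP/measurable_funM.
  - by move=> r x _; rewrite nnfun_muleindic_ge0.
  have hg r : measurable_fun setT
      (fun x => (r * \1_(h n @^-1` [set r]) x * g x)%:E).
    by apply/measurable_EFinP/measurable_funM => //; exact: measurable_funM.
  transitivity (\sum_(r \in range (h n))
      \int[mu]_x (r * \1_(h n @^-1` [set r]) x * g x)%:E)%E; last first.
    rewrite -ge0_integral_fsum//; last first.
      move=> r x _; rewrite 2!EFinM; apply: mule_ge0; last by rewrite lee_fin.
      exact: nnfun_muleindic_ge0.
    apply: eq_integral => x _; rewrite [in RHS](fimfunE (h n)) mulrC.
    rewrite fsumEFin//; congr EFin.
    rewrite mulrC !fsbig_finite//=.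
    by rewrite big_distrl/=.
  apply: eq_fsbigr => r /set_mem[x0 _ hr].
  have r0 : 0 <= r by rewrite -hr.
  rewrite integralZl_indic_nnsfun// integral_indic//= setIT nuE//.
  rewrite integral_mkcond/= -ge0_integralZl//.
  - apply: eq_integral => x _; rewrite patchE indicE; case: ifPn => _.
      by rewrite mulr1 EFinM.
    by rewrite mulr0 mul0r mule0.
  - have mD : measurable (h n @^-1` [set r]) by [].
    apply/(measurable_restrictT _ mD)/measurable_EFinP; exact: measurable_funTS.
  - by move=> x _; rewrite patchE; case: ifPn => // _; rewrite lee_fin.
rewrite [LHS](_ : _ = limn (fun n => \int[nu]_x (h n x)%:E)%E); last first.
  rewrite -monotone_convergence//.
  - by apply: eq_integral => x _; apply/esym/cvg_lim => //; exact: cvg_nnsfun_approx.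
  - by move=> n; exact/measurable_EFinP.
  - by move=> n x _; rewrite lee_fin.
  - by move=> x _ a b ab; rewrite lee_fin; exact/lefP/nd_nnsfun_approx.
rewrite (funext nuh) -monotone_convergence//.
- apply: eq_integral => x _; apply/cvg_lim => //.
  under eq_fun do rewrite EFinM; rewrite EFinM.
  by apply: cvgeZr => //; exact: cvg_nnsfun_approx.
- by move=> n; apply/measurable_EFinP/measurable_funM.
- by move=> n x _; rewrite lee_fin mulr_ge0.
- by move=> x _ a b ab; rewrite lee_fin ler_wpM2r//; exact/lefP/nd_nnsfun_approx.
Qed.

End density.

(** * Symmetry and second moment of centred Gaussian laws *)

Section gaussian_moments.
Variable R : realType.
Local Notation mu := (@lebesgue_measure R).

(** Gives the zero mean of Brownian increments in [Rintegral_inc] without evaluating an integral. *)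
Lemma normal_prob_sym (s : R) (A : set R) : s != 0 -> measurable A ->
  normal_prob 0 s (-%R @^-1` A) = normal_prob 0 s A.
Proof.
move=> s0 mA; rewrite /normal_prob.
have mN : measurable_fun setT (-%R : measurableTypeR R -> measurableTypeR R).
  exact: oppr_measurable.
transitivity (\int[pushforward mu (-%R : measurableTypeR R -> measurableTypeR R)]_(x in A)
    (normal_pdf 0 s x)%:E)%E; last first.
  by apply: eq_measure_integral => B mB _; exact: (lebesgue_measureN mB).
rewrite ge0_integral_pushforward//.
- apply: eq_integral => x _ /=; rewrite !normal_pdfE// /normal_fun.
  by rewrite !subr0 sqrrN.
- by apply/measurable_EFinP/measurable_funTS; exact: measurable_normal_pdf.
- by move=> x _; rewrite lee_fin normal_pdf_ge0.
Qed.

(** The witness is the second moment of the standard Gaussian, left unevaluated; the factor [s ^+ 2]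
    comes from the substitution [x = s * y]. *)
Lemma normal_second_moment : exists2 c : R, 0 <= c &
  forall s : R, 0 < s ->
    (\int[normal_prob 0 s]_x (x ^+ 2)%:E = (c * s ^+ 2)%:E)%E.
Proof.
have dens (s : R) : 0 < s -> (\int[normal_prob 0 s]_x (x ^+ 2)%:E =
    \int[mu]_x (x ^+ 2 * normal_pdf 0 s x)%:E)%E.
  move=> s0; apply: ge0_integral_density => //.
  - exact: measurable_normal_pdf.
  - by move=> x; exact: normal_pdf_ge0.
  - by move=> x; exact: (@sqr_ge0 R).
have fin1 : (\int[mu]_x (x ^+ 2 * normal_pdf 0 1 x)%:E < +oo)%E.
  (* Since [x ^+ 2 / 4 <= expR (x ^+ 2 / 4)], the integrand is at most
     [4 * normal_peak 1 * expR (- x ^+ 2 / 4)], which is [k] times the Gaussian density of standard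
     deviation [r2]. *)
  pose r2 : R := Num.sqrt 2.
  have r20 : r2 != 0 by rewrite gt_eqF// sqrtr_gt0.
  have r2E : r2 ^+ 2 = 2 by rewrite sqr_sqrtr.
  pose k := 4 * normal_peak (1 : R) / normal_peak r2.
  apply: (@le_lt_trans _ _ (\int[mu]_x (k%:E * (normal_pdf 0 r2 x)%:E))%E).
    apply: ge0_le_integral => //.
    - by move=> x _; rewrite lee_fin mulr_ge0 ?sqr_ge0 ?normal_pdf_ge0.
    - apply/measurable_EFinP/measurable_funM; first exact: exprn_measurable.
      exact: measurable_normal_pdf.
    - apply/measurable_funeM/measurable_EFinP; exact: measurable_normal_pdf.
    move=> x _; rewrite lee_fin !normal_pdfE ?oner_neq0// /normal_fun subr0 r2E expr1n.
    rewrite /k [leRHS]mulrA divfK ?gt_eqF ?normal_peak_gt0//.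
    rewrite [leRHS]mulrAC mulrCA mulrC ler_pM2r ?normal_peak_gt0 ?oner_neq0//.
    have -> : - x ^+ 2 / (1 *+ 2) = - x ^+ 2 / (2 *+ 2) + - x ^+ 2 / (2 *+ 2) :> R by field.
    rewrite expRD mulrA ler_pM2r ?expR_gt0// -ler_pdivlMr ?expR_gt0//.
    rewrite -expRN mulNr opprK.
    have := expR_ge1Dx (x ^+ 2 / (2 *+ 2)); lra.
  rewrite integralZl//; last exact: integrable_normal_pdf.
  by rewrite integral_normal_pdf mule1 ltry.
have ge1 : (0 <= \int[mu]_x (x ^+ 2 * normal_pdf 0 1 x)%:E)%E.
  by apply: integral_ge0 => x _; rewrite lee_fin mulr_ge0 ?sqr_ge0 ?normal_pdf_ge0.
exists (fine (\int[mu]_x (x ^+ 2 * normal_pdf 0 1 x)%:E)%E); first exact: fine_ge0.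
move=> s s0; rewrite dens// EFinM fineK; last by rewrite ge0_fin_numE.
have sn0 : s != 0 by rewrite gt_eqF.
pose F (x : R^o) : R^o := s * x.
have dF : F^`()%classic = cst s.
  apply/funext => x; rewrite /F derive1E deriveM// derive_cst derive_id scaler0 addr0.
  by rewrite /GRing.scale/= mulr1.
rewrite (@increasing_ge0_integration_by_substitutionT _ F).
- rewrite dF muleC -ge0_integralZl//.
  + apply: eq_integral => x _; rewrite -EFinM !fctE; congr EFin.
    rewrite /F !normal_pdfE ?gt_eqF ?oner_neq0// /normal_fun/normal_peak !subr0.
    have -> : - (s * x) ^+ 2 / (s ^+ 2 *+ 2) = - x ^+ 2 / (1 ^+ 2 *+ 2).
      by field.
    have -> : Num.sqrt (s ^+ 2 * pi *+ 2) = s * Num.sqrt (1 ^+ 2 * pi *+ 2) :> R.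
      rewrite -{2}(gtr0_norm s0) -sqrtr_sqr -sqrtrM ?sqr_ge0//.
      by rewrite expr1n mul1r -mulrnAr.
    rewrite invfM; move: (Num.sqrt _)^-1 (expR _) => a e.
    by field.
  + apply/measurable_EFinP/measurable_funM; first exact: exprn_measurable.
    exact: measurable_normal_pdf.
  + by move=> x _; rewrite lee_fin mulr_ge0 ?sqr_ge0 ?normal_pdf_ge0.
  + by rewrite lee_fin sqr_ge0.
- by move=> x y xy; rewrite /F ltr_pM2l.
- by rewrite dF => x; exact: cvg_cst.
- by rewrite dF; exact: is_cvg_cst.
- by rewrite dF; exact: is_cvg_cst.
- by move=> x; exact: derivableM.
- rewrite /F; under eq_fun do rewrite mulrC; exact/gt0_cvgMlNy.
- rewrite /F; under eq_fun do rewrite mulrC; exact/gt0_cvgMly.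
- move=> x; apply: cvgM; first exact: exprn_continuous.
  by apply: continuous_normal_pdf; rewrite gt_eqF.
- by move=> x; rewrite mulr_ge0 ?sqr_ge0 ?normal_pdf_ge0.
Qed.

End gaussian_moments.

(** * Independence: product laws and products of expectations *)

Section independence.
Context d (T : measurableType d) (R : realType) (P : probability T R).
Variables X Y : T -> R.
Hypothesis mX : measurable_fun setT X.
Hypothesis mY : measurable_fun setT Y.
Hypothesis indXY : forall A B : set R, measurable A -> measurable B ->
  P (X @^-1` A `&` Y @^-1` B) = (P (X @^-1` A) * P (Y @^-1` B))%E.

Let XY w : R * R := (X w, Y w).
Let mXY : measurable_fun setT XY.
Proof. exact: measurable_fun_pair. Qed.

Let fX : {mfun T >-> R} := HB.pack X (isMeasurableFun.Build _ _ _ _ X mX).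
Let fY : {mfun T >-> R} := HB.pack Y (isMeasurableFun.Build _ _ _ _ Y mY).
Let fXY : {mfun T >-> (R * R)%type} :=
  HB.pack XY (isMeasurableFun.Build _ _ _ _ XY mXY).

(** Independence is the equality of both measures on rectangles, which determines a product
    measure. *)
Let jointE (A : set (R * R)) : measurable A ->
  (distribution P fX \x distribution P fY)%E A = distribution P fXY A.
Proof.
apply: product_measure_unique => B C mB mC.
by rewrite /distribution/pushforward/= -indXY.
Qed.

Let ge0_joint (h : R * R -> \bar R) : measurable_fun setT h ->
  (forall z, 0 <= h z)%E ->
  (\int[P]_w h (X w, Y w) =
   \int[distribution P fX]_x \int[distribution P fY]_y h (x, y))%E.
Proof.
move=> mh h0.
rewrite -(@fubini_tonelli1 _ _ _ _ _ (distribution P fX) (distribution P fY))//.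
transitivity (\int[distribution P fXY]_z h z)%E.
  by rewrite ge0_integral_distribution.
by apply: eq_measure_integral => A mA _; exact/esym/jointE.
Qed.

Let mM : measurable_fun setT (fun z : R * R => z.1 * z.2).
Proof. exact: measurable_funM. Qed.

Hypothesis iX : P.-integrable setT (EFin \o X).
Hypothesis iY : P.-integrable setT (EFin \o Y).

Let normM : (\int[P]_w `|(X w * Y w)%:E| =
  \int[P]_w `|(X w)%:E| * \int[P]_w `|(Y w)%:E|)%E.
Proof.
rewrite (ge0_joint (h := fun z => (`|(z.1 * z.2)%:E|)%E))//; last first.
  by apply/measurableT_comp => //; exact/measurable_EFinP.
have -> : (\int[P]_w `|(X w)%:E| = \int[distribution P fX]_x `|x%:E|)%E.
  by rewrite ge0_integral_distribution//; exact/measurableT_comp.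
have -> : (\int[P]_w `|(Y w)%:E| = \int[distribution P fY]_x `|x%:E|)%E.
  by rewrite ge0_integral_distribution//; exact/measurableT_comp.
rewrite -ge0_integralZr//; last 2 first.
- exact/measurableT_comp.
- exact: integral_ge0.
apply: eq_integral => x _ /=; rewrite -ge0_integralZl//; last exact/measurableT_comp.
by apply: eq_integral => y _; rewrite normrM EFinM.
Qed.

(** Independence factorises the expectation of [|X Y|], so first moments suffice. This is used with
    [Y] a product of two Brownian increments, whose square is not known to be integrable here. *)
Lemma integrable_indepM : P.-integrable setT (EFin \o (X \* Y)).
Proof.
apply/integrableP; split; first exact/measurable_EFinP/measurable_funM.
rewrite /= normM lte_mul_pinfty//; first exact: integral_ge0.
  move/integrableP : iX => [_ fin]; rewrite ge0_fin_numE//; exact: integral_ge0.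
by move/integrableP : iY => [].
Qed.

Lemma integral_indepM :
  (\int[P]_w (X w * Y w)%:E = \int[P]_w (X w)%:E * \int[P]_w (Y w)%:E)%E.
Proof.
have iM : (distribution P fX \x distribution P fY)%E.-integrable setT
    (fun z : R * R => (z.1 * z.2)%:E).
  apply/integrableP; split; first exact/measurable_EFinP.
  rewrite (@fubini_tonelli1 _ _ _ _ _ (distribution P fX) (distribution P fY))//; last first.
    by apply/measurableT_comp => //; exact/measurable_EFinP.
  rewrite -(ge0_joint (h := fun z => (`|(z.1 * z.2)%:E|)%E))//; last first.
    by apply/measurableT_comp => //; exact/measurable_EFinP.
  by have /integrableP[] := integrable_indepM.
transitivity (\int[distribution P fXY]_z (z.1 * z.2)%:E)%E.
  rewrite (integral_distribution)//; first exact/measurable_EFinP.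
  exact: integrable_indepM.
transitivity (\int[distribution P fX \x distribution P fY]_z (z.1 * z.2)%:E)%E.
  by apply: eq_measure_integral => A mA _; exact/esym/jointE.
rewrite -integral12_prod_meas1//.
have idist (Z : {mfun T >-> R}) : P.-integrable setT (EFin \o Z) ->
    (distribution P Z).-integrable setT EFin.
  move=> /integrableP[_ fin]; apply/integrableP; split; first exact/measurable_EFinP.
  rewrite ge0_integral_distribution//; exact/measurableT_comp.
have EE (Z : {mfun T >-> R}) : P.-integrable setT (EFin \o Z) ->
    (\int[distribution P Z]_z z%:E = \int[P]_w (Z w)%:E)%E.
  by move=> iZ; rewrite integral_distribution//; exact/measurable_EFinP.
transitivity (\int[distribution P fX]_x (x%:E * \int[distribution P fY]_y y%:E))%E.
  apply: eq_integral => x _; rewrite /fubini_F/= -integralZl//.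
  exact: (idist fY).
rewrite (EE fY)// /= -(fineK (integrable_fin_num measurableT iY)).
rewrite integralZr//; last exact: (idist fX).
by rewrite (EE fX).
Qed.

End independence.

(** * Brownian increments *)

Section square_integrable.
Context d (T : measurableType d) (R : realType) (P : probability T R).

Definition sqintegrable (X : T -> R) :=
  measurable_fun setT X /\ P.-integrable setT (EFin \o (fun w => X w ^+ 2)).

Lemma sqintegrableM X Y : sqintegrable X -> sqintegrable Y ->
  P.-integrable setT (EFin \o (fun w => X w * Y w)).
Proof.
move=> [mX iX] [mY iY].
apply: (le_integrable measurableT _ _ (integrableD measurableT iX iY)).
  exact/measurable_EFinP/measurable_funM.
move=> w _; rewrite /= lee_fin normrM [leRHS]ger0_norm ?addr_ge0 ?sqr_ge0//.
rewrite -(real_normK (num_real (X w))) -(real_normK (num_real (Y w))).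
have := sqr_ge0 (`|X w| - `|Y w|); rewrite sqrrB => ?.
have : 0 <= `|X w| * `|Y w| by rewrite mulr_ge0.
lra.
Qed.

Lemma sqintegrable_boundedM (X Y : T -> R) (c : R) : measurable_fun setT X ->
  (forall w, `|X w| <= c) -> sqintegrable Y -> sqintegrable (X \* Y).
Proof.
move=> mX bX [mY iY]; split; first exact: measurable_funM.
have := integrableZl measurableT (c ^+ 2) iY.
apply: le_integrable => //.
  exact/measurable_EFinP/measurable_funX/measurable_funM.
move=> w _; rewrite /= lee_fin (ger0_norm (sqr_ge0 _)).
rewrite [leRHS]ger0_norm; last exact: mulr_ge0 (sqr_ge0 _) (sqr_ge0 _).
rewrite exprMn ler_wpM2r ?sqr_ge0// -(real_normK (num_real (X w))).
have c0 : 0 <= c := le_trans (normr_ge0 _) (bX w).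
by rewrite lerXn2r// nnegrE.
Qed.

Lemma sqintegrable_bounded (X : T -> R) (c : R) : measurable_fun setT X ->
  (forall w, `|X w| <= c) -> sqintegrable X.
Proof.
move=> mX bX; rewrite (_ : X = X \* cst 1); last first.
  by apply/funext => w; rewrite /= mulr1.
apply: sqintegrable_boundedM bX _ => //; split => //.
under eq_fun do rewrite /= expr1n.
exact: finite_measure_integrable_cst.
Qed.

Lemma sqintegrable_integrable X : sqintegrable X -> P.-integrable setT (EFin \o X).
Proof.
move=> sX; have s1 : sqintegrable (cst 1).
  by apply: (@sqintegrable_bounded _ 1) => // w; rewrite normr1.
have := sqintegrableM sX s1.
by under eq_fun do rewrite /= mulr1.
Qed.

End square_integrable.

Section sub_sigma_algebra.
Context (R : realType) (Omega : pointedType) (G : set (set Omega)).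
Hypothesis sG : sigma_algebra setT G.

Definition smeasurable (X : Omega -> R) :=
  forall B, measurable B -> G (X @^-1` B).

(** Reads measurability with respect to [G] on the type [g_sigma_algebraType G], so that the closure
    properties of measurable functions carry over. *)
Lemma smeasurableP X : smeasurable X <->
  measurable_fun (setT : set (g_sigma_algebraType G)) (X : g_sigma_algebraType G -> R).
Proof.
split => [mX _ B mB|mX B mB].
  by rewrite setTI; apply: sub_gen_smallest; exact: mX.
have := mX measurableT B mB; rewrite setTI.
by rewrite /measurable/= (sigma_algebra_id sG).
Qed.

Lemma smeasurableM X Y : smeasurable X -> smeasurable Y -> smeasurable (X \* Y).
Proof. by move=> /smeasurableP mX /smeasurableP mY; apply/smeasurableP; exact: measurable_funM. Qed.

Lemma smeasurableB X Y : smeasurable X -> smeasurable Y -> smeasurable (X \- Y).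
Proof. by move=> /smeasurableP mX /smeasurableP mY; apply/smeasurableP; exact: measurable_funB. Qed.

End sub_sigma_algebra.

Section brownian.
Context (R : realType) (disp : measure_display) (Omega : measurableType disp).
Context (P : probability Omega R) (F : R -> set (set Omega)).
Hypothesis hF : is_filtration F.
Context (d : nat) (W : R -> Omega -> 'cV[R]_d).
Hypothesis hW : is_brownian_motion P F W.
Variable c : R.
Hypothesis hc : forall s : R, 0 < s ->
  (\int[normal_prob 0 s]_x (x ^+ 2)%:E = (c * s ^+ 2)%:E)%E.

Definition inc (s t : R) (i : 'I_d) (w : Omega) : R := W t w i ord0 - W s w i ord0.

Lemma filtration_sigma (s : R) : 0 <= s -> sigma_algebra setT (F s).
Proof. by case: hF => h _ _; exact: h. Qed.

Lemma smeasurable_le (s t : R) (X : Omega -> R) : 0 <= s -> s <= t ->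
  smeasurable (F s) X -> smeasurable (F t) X.
Proof. by case: hF => _ _ h s0 st mX B mB; apply: (h s t) => //; exact: mX. Qed.

Lemma smeasurable_measurable (s : R) (X : Omega -> R) : 0 <= s ->
  smeasurable (F s) X -> measurable_fun setT X.
Proof.
by case: hF => _ h _ s0 mX _ B mB; rewrite setTI; apply: (h s) => //; exact: mX.
Qed.

Lemma smeasurable_inc (s t : R) i : 0 <= s -> s <= t ->
  smeasurable (F t) (inc s t i).
Proof.
case: hW => _ _ h _ s0 st; have t0 := le_trans s0 st.
apply: (smeasurableB (filtration_sigma t0)); first exact: h.
by apply: (@smeasurable_le s) => // B mB; exact: h.
Qed.

Lemma measurable_inc (s t : R) i : 0 <= s -> s <= t ->
  measurable_fun setT (inc s t i).
Proof.
move=> s0 st; apply: (@smeasurable_measurable t); first exact: le_trans st.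
exact: smeasurable_inc.
Qed.

Lemma incxx (s : R) i : inc s s i = cst 0.
Proof. by apply/funext => w; rewrite /inc subrr. Qed.

Let incE (s t : R) (i : 'I_d) :
  inc s t i = fun w => (W t w - W s w) i ord0.
Proof. by apply/funext => w; rewrite /inc !mxE. Qed.

Let inc_law (s t : R) i : 0 <= s -> s < t -> forall B : set R, measurable B ->
  P (inc s t i @^-1` B) = normal_prob 0 (Num.sqrt (t - s)) B.
Proof.
by case: hW => _ _ _ h s0 st B mB; rewrite incE; case: (h _ _ s0 st) => _ _ ->.
Qed.

Let measurable_incR (s t : R) i : 0 <= s -> s < t ->
  measurable_fun setT (inc s t i : Omega -> measurableTypeR R).
Proof. by move=> s0 st; exact: measurable_inc i s0 (ltW st). Qed.

(* [normal_prob] lives on [measurableTypeR R], whose display differs from that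
   of [R]. *)
Let incm (s t : R) i (s0 : 0 <= s) (st : s < t) :
    {mfun Omega >-> measurableTypeR R} :=
  HB.pack (inc s t i : Omega -> measurableTypeR R)
    (isMeasurableFun.Build _ _ _ _ _ (measurable_incR i s0 st)).

Let int_inc_sqr (s t : R) i : 0 <= s -> s <= t ->
  (\int[P]_w (inc s t i w ^+ 2)%:E = (c * (t - s))%:E)%E.
Proof.
move=> s0; rewrite le_eqVlt => /predU1P[<-|st].
  by rewrite incxx subrr mulr0 integral0_eq// => w _; rewrite expr0n.
have st0 : 0 < t - s by rewrite subr_gt0.
rewrite -[t - s]sqr_sqrtr ?(ltW st0)// -hc ?sqrtr_gt0//.
transitivity (\int[distribution P (incm i s0 st)]_x (x ^+ 2)%:E)%E.
  rewrite ge0_integral_distribution//.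
    by apply/measurable_EFinP; exact: exprn_measurable.
  by move=> y; rewrite lee_fin sqr_ge0.
by apply: eq_measure_integral => A mA _; exact: inc_law.
Qed.

Lemma sqintegrable_inc (s t : R) i : 0 <= s -> s <= t ->
  sqintegrable P (inc s t i).
Proof.
move=> s0 st; split; first exact: measurable_inc.
apply/integrableP; split.
  by apply/measurable_EFinP/measurable_funX; exact: measurable_inc.
under eq_integral do rewrite /= ger0_norm ?sqr_ge0//.
by rewrite int_inc_sqr// ltry.
Qed.

Lemma Rintegral_inc_sqr (s t : R) i : 0 <= s -> s <= t ->
  \int[P]_w (inc s t i w * inc s t i w) = c * (t - s).
Proof.
move=> s0 st; rewrite /Rintegral; under eq_integral do rewrite -expr2.
by rewrite int_inc_sqr.
Qed.

Lemma Rintegral_inc (s t : R) i : 0 <= s -> s <= t ->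
  \int[P]_w inc s t i w = 0.
Proof.
move=> s0; rewrite le_eqVlt => /predU1P[<-|st].
  by rewrite incxx Rintegral_cst// mul0r.
have st0 : 0 < Num.sqrt (t - s) by rewrite sqrtr_gt0 subr_gt0.
have iinc := sqintegrable_integrable (sqintegrable_inc i s0 (ltW st)).
pose N := normal_prob 0 (Num.sqrt (t - s)).
have lawE A : measurable A -> distribution P (incm i s0 st) A = N A.
  by move=> mA; exact: inc_law.
have E : (\int[P]_w (inc s t i w)%:E = \int[N]_x x%:E)%E.
  transitivity (\int[distribution P (incm i s0 st)]_x x%:E)%E.
    by rewrite integral_distribution//; exact/measurable_EFinP.
  by apply: eq_measure_integral => A mA _; exact: lawE.
have iN : N.-integrable setT (fun x : R => x%:E).
  apply/integrableP; split; first exact/measurable_EFinP.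
  have -> : (\int[N]_x `|x%:E| = \int[P]_w `|(inc s t i w)%:E|)%E.
    transitivity (\int[distribution P (incm i s0 st)]_x `|x%:E|)%E.
      by apply: eq_measure_integral => A mA _; exact/esym/lawE.
    rewrite ge0_integral_distribution//; exact/measurableT_comp.
  by case/integrableP : iinc.
(* By symmetry of the law the mean is its own opposite; being finite, it is 0. *)
have E2 : (\int[N]_x x%:E = - \int[N]_x x%:E)%E.
  transitivity (\int[pushforward N (-%R : measurableTypeR R -> measurableTypeR R)]_x x%:E)%E.
    apply: eq_measure_integral => A mA _; apply/esym/normal_prob_sym => //.
    by rewrite gt_eqF.
  have iNN : N.-integrable setT (fun x : R => (- x)%:E) by exact: integrableN iN.
  rewrite integral_pushforward//=; under eq_integral do rewrite EFinN.
  by rewrite preimage_setT integralN//; exact: integrable_add_def iN.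
rewrite /Rintegral E; move: E2.
have := integrable_fin_num measurableT iN.
by case: (integral _ _ _) => //= r _ [] H; lra.
Qed.

Lemma smeasurable_generated_inc (s t : R) i :
  smeasurable (generated_sigma (fun w => W t w - W s w)) (inc s t i).
Proof.
move=> B mB; apply: sub_gen_smallest; exists i, ord0, B; split => //.
by rewrite incE.
Qed.

Lemma generated_sigma_algebra (s t : R) :
  sigma_algebra setT (generated_sigma (fun w => W t w - W s w)).
Proof. exact: smallest_sigma_algebra. Qed.

Lemma Rintegral_indep_inc (s t : R) (X Y : Omega -> R) : 0 <= s -> s < t ->
  smeasurable (F s) X -> P.-integrable setT (EFin \o X) ->
  smeasurable (generated_sigma (fun w => W t w - W s w)) Y ->
  P.-integrable setT (EFin \o Y) ->
  \int[P]_w (X w * Y w) = \int[P]_w X w * \int[P]_w Y w.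
Proof.
move=> s0 st mX iX mY iY.
have ind A B : measurable A -> measurable B ->
    P (X @^-1` A `&` Y @^-1` B) = (P (X @^-1` A) * P (Y @^-1` B))%E.
  move=> mA mB; case: hW => _ _ _ h; case: (h _ _ s0 st) => + _ _; apply.
    exact: mX.
  exact: mY.
rewrite /Rintegral (integral_indepM _ _ ind)//; last 2 first.
- exact: smeasurable_measurable mX.
- by apply/measurable_EFinP; exact: measurable_int iY.
by rewrite fineM//; exact: integrable_fin_num.
Qed.

(** The increment is independent of [F s] and centred, so the expectation factorises with a zero
    factor. *)
Lemma Rintegral_martingale (s t : R) (X : Omega -> R) i : 0 <= s -> s <= t ->
  smeasurable (F s) X -> P.-integrable setT (EFin \o X) ->
  \int[P]_w (X w * inc s t i w) = 0.
Proof.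
move=> s0; rewrite le_eqVlt => /predU1P[<-|st] mX iX.
  rewrite incxx (_ : (fun w => X w * cst 0 w) = cst 0).
    by rewrite Rintegral_cst// mul0r.
  by apply/funext => w; rewrite mulr0.
rewrite (@Rintegral_indep_inc s t)//; last 2 first.
- exact: smeasurable_generated_inc.
- by apply: sqintegrable_integrable; apply: sqintegrable_inc => //; exact: ltW.
by rewrite Rintegral_inc ?mulr0// ltW.
Qed.

Lemma Rintegral_inc_cross (s t : R) i j : 0 <= s -> s < t -> i != j ->
  \int[P]_w (inc s t i w * inc s t j w) = 0.
Proof.
move=> s0 st ij.
have sq k : sqintegrable P (inc s t k) by apply: sqintegrable_inc; rewrite // ltW.
have ind A B : measurable A -> measurable B ->
    P (inc s t i @^-1` A `&` inc s t j @^-1` B) =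
    (P (inc s t i @^-1` A) * P (inc s t j @^-1` B))%E.
  move=> mA mB; case: hW => _ _ _ h; case: (h _ _ s0 st) => _ + _.
  (* Mutual independence is applied to a family that is trivial outside [i] and [j]; the remaining
     factors have probability 1. *)
  pose C k : set R := if k == i then A else if k == j then B else setT.
  have mC k : measurable (C k) by rewrite /C; do 2?case: ifP => // _.
  move=> /(_ C mC) indC.
  have {indC} : P (\bigcap_(k in [set: 'I_d]) (inc s t k @^-1` C k)) =
      (\prod_(k < d) P (inc s t k @^-1` C k))%E.
    under eq_bigr do rewrite incE; under eq_bigcapr do rewrite incE.
    exact: indC.
  rewrite (_ : \bigcap_(k in _) _ = inc s t i @^-1` A `&` inc s t j @^-1` B); last first.
    apply/seteqP; split => [w h'|w [hA hB] k _].
      split; [have := h' i I|have := h' j I]; rewrite /C/= eqxx//.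
      by rewrite eq_sym (negbTE ij).
    rewrite /C/=; case: eqVneq => [->|_]; first exact: hA.
    by case: eqVneq => [->|_].
  move=> ->; rewrite (bigD1 i)//= (bigD1 j) 1?eq_sym//= big1 ?mule1; last first.
    move=> k /andP[ki kj]; rewrite /C (negbTE ki) (negbTE kj) preimage_setT.
    exact: probability_setT.
  by rewrite /C eqxx eq_sym (negbTE ij) eqxx.
have iinc k := sqintegrable_integrable (sq k).
rewrite /Rintegral (integral_indepM _ _ ind)//; [|by case: (sq i)|by case: (sq j)].
rewrite fineM ?(integrable_fin_num _ (iinc _))//.
by have := Rintegral_inc i s0 (ltW st); rewrite /Rintegral => ->; rewrite mul0r.
Qed.

(** The product of two coordinates of the increment is generated by the increment, hence independent
    of [X]; it is merely integrable, which is what [Rintegral_indep_inc] asks for. *)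
Lemma Rintegral_bracket (s t : R) (X : Omega -> R) i j : 0 <= s -> s <= t ->
  smeasurable (F s) X -> P.-integrable setT (EFin \o X) ->
  \int[P]_w (X w * (inc s t i w * inc s t j w)) =
  (i == j)%:R * (c * (t - s)) * \int[P]_w X w.
Proof.
move=> s0; rewrite le_eqVlt => /predU1P[<-|st] mX iX.
  rewrite subrr !mulr0 mul0r !incxx (_ : (fun w => _) = cst 0).
    by rewrite Rintegral_cst// mul0r.
  by apply/funext => w; rewrite /cst !mulr0.
have sq k : sqintegrable P (inc s t k) by apply: sqintegrable_inc; rewrite // ltW.
rewrite (@Rintegral_indep_inc s t X (inc s t i \* inc s t j))//; last 2 first.
- apply: smeasurableM; first exact: generated_sigma_algebra.
    exact: smeasurable_generated_inc.
  exact: smeasurable_generated_inc.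
- exact: sqintegrableM.
rewrite mulrC; congr *%R; have [<-|ij] := eqVneq i j.
  by rewrite mul1r Rintegral_inc_sqr// ltW.
by rewrite mul0r Rintegral_inc_cross.
Qed.

(** The longer of the two increments starting at [s] is cut at the end of the shorter one; the
    remainder is a martingale increment and contributes 0. *)
Lemma Rintegral_zip (s t u : R) (X : Omega -> R) (M : R) i j :
  0 <= s -> s <= t -> s <= u ->
  smeasurable (F s) X -> (forall w, `|X w| <= M) ->
  \int[P]_w (X w * (inc s t i w * inc s u j w)) =
  (i == j)%:R * (c * (Num.min t u - s)) * \int[P]_w X w.
Proof.
wlog tu : t u i j / t <= u => [hwlog s0 st su mX bX|].
  have [tu|/ltW ut] := leP t u; first by rewrite -[in RHS](min_idPl tu); exact: hwlog.
  under eq_Rintegral do rewrite [inc _ _ i _ * _]mulrC.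
  by rewrite (hwlog u t)// minC eq_sym (min_idPr ut).
move=> s0 st su mX bX; have t0 := le_trans s0 st.
have mX' : measurable_fun setT X := smeasurable_measurable s0 mX.
have sX := sqintegrable_bounded P mX' bX.
have sit := sqintegrable_inc i s0 st.
have sjt := sqintegrable_inc j s0 st.
have sju := sqintegrable_inc j t0 tu.
have sXi := sqintegrable_boundedM mX' bX sit.
transitivity (\int[P]_w (X w * (inc s t i w * inc s t j w) +
    (X \* inc s t i) w * inc t u j w)).
  by apply: eq_Rintegral => w _ /=; rewrite /inc; ring.
rewrite RintegralD//; last 2 first.
- under eq_fun do rewrite mulrA; exact: (sqintegrableM sXi sjt).
- exact: (sqintegrableM sXi sju).
rewrite (min_idPl tu) Rintegral_bracket//; last exact: sqintegrable_integrable.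
rewrite Rintegral_martingale ?addr0//; last exact: sqintegrable_integrable.
apply: smeasurableM; first exact: filtration_sigma.
  exact: smeasurable_le mX.
exact: smeasurable_inc.
Qed.

(** Only the common part of the two time intervals contributes. For [s <= u] with an overlap, the
    first increment is cut at [u]: what precedes [u] is [F u]-measurable and pairs to 0 with the
    second increment, and the rest is [Rintegral_zip]. The intervals are in arbitrary position
    because the grids of two simple processes may interleave. *)
Lemma Rintegral_overlap (s t u v : R) (X Y : Omega -> R) (M N : R) i j :
  0 <= s -> s <= t -> 0 <= u -> u <= v ->
  smeasurable (F s) X -> (forall w, `|X w| <= M) ->
  smeasurable (F u) Y -> (forall w, `|Y w| <= N) ->
  \int[P]_w ((X w * inc s t i w) * (Y w * inc u v j w)) =
  (i == j)%:R * (c * Num.max 0 (Num.min t v - Num.max s u)) *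
  \int[P]_w (X w * Y w).
Proof.
wlog su : s t u v i j X Y M N / s <= u => [hwlog s0 st u0 uv mX bX mY bY|].
  have [su|/ltW us] := leP s u.
    by rewrite (hwlog _ _ _ _ _ _ _ _ M N)// (max_idPr su).
  under eq_Rintegral do rewrite mulrC.
  rewrite (hwlog u v s t j i Y X N M)// eq_sym minC (max_idPr us).
  by congr (_ * _); apply: eq_Rintegral => w _; rewrite mulrC.
move=> s0 st u0 uv mX bX mY bY; rewrite (max_idPr su).
have mX' : measurable_fun setT X := smeasurable_measurable s0 mX.
have mY' : measurable_fun setT Y := smeasurable_measurable u0 mY.
have sit := sqintegrable_inc i s0 st.
have sju := sqintegrable_inc j u0 uv.
have smX : smeasurable (F u) X := smeasurable_le s0 su mX.
have sY := sqintegrable_bounded P mY' bY.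
have bXY w : `|X w * Y w| <= M * N by rewrite normrM ler_pM.
have [tu|/ltW ut] := leP t u.
  (* Disjoint intervals: everything except the later increment is [F u]-measurable. *)
  rewrite max_l; last by rewrite subr_le0 ge_min tu.
  rewrite !mulr0 mul0r.
  under eq_Rintegral do rewrite mulrA.
  have mZ : smeasurable (F u) ((X \* inc s t i) \* Y).
    apply: smeasurableM => //; first exact: filtration_sigma.
    apply: smeasurableM => //; first exact: filtration_sigma.
    by apply: smeasurable_le (smeasurable_inc _ _ _) => //; exact: le_trans st.
  apply: (Rintegral_martingale (X := (X \* inc s t i) \* Y)) => //.
  exact: sqintegrableM (sqintegrable_boundedM mX' bX sit) sY.
rewrite max_r; last by rewrite subr_ge0 le_min ut.
have mXY : smeasurable (F u) (X \* Y).
  by apply: smeasurableM => //; exact: filtration_sigma.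
transitivity (\int[P]_w ((X w * Y w) * (inc u t i w * inc u v j w) +
    (X \* inc s u i \* Y) w * inc u v j w)).
  by apply: eq_Rintegral => w _ /=; rewrite /inc; ring.
have siu := sqintegrable_inc i s0 su.
have siut := sqintegrable_inc i u0 ut.
have sZ : sqintegrable P (X \* inc s u i) := sqintegrable_boundedM mX' bX siu.
rewrite RintegralD//; last 2 first.
- under eq_fun do rewrite mulrA.
  apply: (sqintegrableM _ sju); apply: (sqintegrable_boundedM _ bXY siut).
  exact: measurable_funM.
- apply: (sqintegrableM _ sju); rewrite (_ : X \* _ \* Y = Y \* (X \* inc s u i)).
    exact: sqintegrable_boundedM mY' bY sZ.
  by apply/funext => w /=; rewrite mulrC.
rewrite (Rintegral_zip (M := M * N))// [X in _ + X]Rintegral_martingale ?addr0//.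
- do 2 (apply: smeasurableM => //; first exact: filtration_sigma).
  exact: smeasurable_inc.
- exact: sqintegrableM sZ sY.
Qed.

End brownian.

(** * Isometry and L2 contraction of the Ito integral *)

Section fnorm.
Context (R : realType) (m n : nat).
Implicit Types A B : 'M[R]_(m, n).

Lemma fnorm_sqr A : fnorm A ^+ 2 = \sum_i \sum_j A i j ^+ 2.
Proof.
rewrite sqr_sqrtr//; apply: sumr_ge0 => i _; apply: sumr_ge0 => j _.
exact: sqr_ge0.
Qed.

Lemma fnorm_ge0 A : 0 <= fnorm A.
Proof. exact: sqrtr_ge0. Qed.

Lemma fnormN A : fnorm (- A) = fnorm A.
Proof. by congr Num.sqrt; do 2!apply: eq_bigr => ? _; rewrite mxE sqrrN. Qed.

Lemma fnormB A B : fnorm (A - B) = fnorm (B - A).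
Proof. by rewrite -fnormN opprB. Qed.

Lemma fnorm_entry A i j : `|A i j| <= fnorm A.
Proof.
rewrite -sqrtr_sqr ler_wsqrtr// (bigD1 i)//= (bigD1 j)//= -addrA lerDl.
by rewrite addr_ge0//; do ?[apply: sumr_ge0 => ? _]; exact: sqr_ge0.
Qed.

Lemma fnorm_sqrD A B :
  fnorm (A + B) ^+ 2 <= 2 * fnorm A ^+ 2 + 2 * fnorm B ^+ 2.
Proof.
rewrite !fnorm_sqr !mulr_sumr -big_split/=; apply: ler_sum => i _.
rewrite !mulr_sumr -big_split/=; apply: ler_sum => j _; rewrite mxE.
by have := sqr_ge0 (A i j - B i j); rewrite sqrrB sqrrD; lra.
Qed.

Lemma fnorm_sqrD3 A B C :
  fnorm (A + B + C) ^+ 2 <= 3 * fnorm A ^+ 2 + 3 * fnorm B ^+ 2 + 3 * fnorm C ^+ 2.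
Proof.
rewrite !fnorm_sqr !mulr_sumr -!big_split/=; apply: ler_sum => i _.
rewrite !mulr_sumr -!big_split/=; apply: ler_sum => j _; rewrite !mxE.
move: (A i j) (B i j) (C i j) => a b c.
have := sqr_ge0 (a - b); have := sqr_ge0 (a - c); have := sqr_ge0 (b - c); nra.
Qed.

Lemma measurable_fnorm_sqr d (T : measurableType d) (D : set T) (f : T -> 'M[R]_(m, n)) :
  mx_measurable D f -> measurable_fun D (fun x => fnorm (f x) ^+ 2).
Proof.
move=> mf; under eq_fun do rewrite fnorm_sqr.
by apply: measurable_sum => i; apply: measurable_sum => j; exact: measurable_funX.
Qed.

Lemma mx_measurableB d (T : measurableType d) (D : set T) (f g : T -> 'M[R]_(m, n)) :
  mx_measurable D f -> mx_measurable D g -> mx_measurable D (fun x => f x - g x).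
Proof.
move=> mf mg i j; under eq_fun do rewrite !mxE.
exact: measurable_funB.
Qed.

End fnorm.

Lemma fnormM_sqr (R : realType) (m n p : nat) (A : 'M[R]_(m, n)) (B : 'M[R]_(n, p)) :
  fnorm (A *m B) ^+ 2 <= fnorm A ^+ 2 * fnorm B ^+ 2.
Proof.
have CS (u v : 'I_n -> R) :
    (\sum_k u k * v k) ^+ 2 <= (\sum_k u k ^+ 2) * (\sum_k v k ^+ 2).
  rewrite -subr_ge0 -(pmulr_rge0 _ (ltr0n _ 2)).
  (* Lagrange's identity: twice the Cauchy-Schwarz deficit is a sum of squares. *)
  suff -> : 2 * ((\sum_k u k ^+ 2) * (\sum_k v k ^+ 2) - (\sum_k u k * v k) ^+ 2) =
      \sum_k \sum_l (u k * v l - u l * v k) ^+ 2.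
    by apply: sumr_ge0 => k _; apply: sumr_ge0 => l _; exact: sqr_ge0.
  rewrite mulrBr -[2%:R]/(1 + 1) 2!mulrDl !mul1r expr2.
  rewrite [X in _ + X - _]mulrC 3!big_distrlr/= -!big_split/=.
  rewrite -sumrB; apply: eq_bigr => k _; rewrite -!big_split/= -sumrB.
  by apply: eq_bigr => l _; ring.
rewrite !fnorm_sqr [leRHS]mulr_suml; apply: ler_sum => i _.
rewrite exchange_big/= mulr_sumr; apply: ler_sum => j _.
by rewrite mxE; exact: CS.
Qed.

Lemma mx_measurableM (R : realType) (m n p : nat) d (T : measurableType d) (D : set T)
    (f : T -> 'M[R]_(m, n)) (g : T -> 'M[R]_(n, p)) :
  mx_measurable D f -> mx_measurable D g -> mx_measurable D (fun x => f x *m g x).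
Proof.
move=> mf mg i j; under eq_fun do rewrite !mxE.
by apply: measurable_sum => k; exact: measurable_funM.
Qed.

Section Rintegral_sum.
Context d (T : measurableType d) (R : realType).
Variables (mu : {measure set T -> \bar R}) (D : set T) (mD : measurable D).
Variables (I : finType) (f : I -> T -> R).
Hypothesis int_f : forall k, mu.-integrable D (EFin \o f k).

Lemma integrable_fin_sum : mu.-integrable D (EFin \o (fun x => \sum_k f k x)).
Proof.
rewrite (_ : EFin \o _ = fun x => (\sum_k (f k x)%:E)%E).
  by apply: integrable_sum => // k _; exact: int_f.
by apply/funext => x; rewrite /= sumEFin.
Qed.

Lemma Rintegral_fin_sum :
  \int[mu]_(x in D) (\sum_k f k x) = \sum_k \int[mu]_(x in D) f k x.
Proof.
rewrite /Rintegral (_ : (fun x => _) = (fun x => \sum_k (f k x)%:E)%E).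
  rewrite integral_sum//.
  by rewrite sum_fine// => k _; exact: integrable_fin_num (int_f k).
by apply/funext => x; rewrite sumEFin.
Qed.

End Rintegral_sum.

Lemma EFin_Rintegral d (T : measurableType d) (R : realType)
    (mu : {measure set T -> \bar R}) (D : set T) (f : T -> R) :
  measurable D -> mu.-integrable D (EFin \o f) ->
  (\int[mu]_(x in D) (f x)%:E)%E = (\int[mu]_(x in D) f x)%:E.
Proof. by move=> mD intf; rewrite fineK//; exact: integrable_fin_num intf. Qed.

Lemma integrableZ_EFin d (T : measurableType d) (R : realType)
    (mu : {measure set T -> \bar R}) (D : set T) (f : T -> R) (r : R) :
  measurable D -> mu.-integrable D (EFin \o f) ->
  mu.-integrable D (EFin \o (fun x => r * f x)).
Proof. by move=> mD intf; exact: (integrableZl mD r intf). Qed.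

Section indic_overlap.
Context (R : realType) (t a b a' b' : R).
Hypotheses (a0 : 0 <= a) (bt : b <= t).
Local Notation ov := (Num.max 0 (Num.min b b' - Num.max a a')).
Local Notation f :=
  (fun s => \1_(`]a, b] : set R) s * \1_(`]a', b'] : set R) s : R).

Let fE : f = \1_(`]Num.max a a', Num.min b b'] : set R).
Proof.
apply/funext => x; rewrite !indicE -natrM mulnb -in_setI.
congr ((x \in _)%:R); apply/seteqP; split => s /=.
  by rewrite !in_itv/= gt_max le_min => -[/andP[-> ->] /andP[-> ->]].
by rewrite !in_itv/= gt_max le_min => /andP[/andP[-> ->] /andP[-> ->]].
Qed.

Lemma integrable_overlap :
  lebesgue_measure.-integrable (`[0, t] : set R) (EFin \o f).
Proof.
rewrite fE; apply: (integrableS measurableT) => //; exact: integrable_indic_itv.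
Qed.

(** The product of the indicators is that of the intersection, which lies in [[0, t]] since [0 <= a]
    and [b <= t]. The same quantity [ov] occurs in [Rintegral_overlap]; this coincidence is the
    isometry. *)
Lemma Rintegral_indic_overlap :
  \int[lebesgue_measure]_(s in `[0, t]) f s = ov.
Proof.
rewrite fE /Rintegral integral_indic// setIidl; last first.
  move=> s /=; rewrite !in_itv/= gt_max le_min => /andP[/andP[as_ _] /andP[sb _]].
  by rewrite (ltW (le_lt_trans a0 as_)) (le_trans sb bt).
rewrite /= lebesgue_measure_itv/= lte_fin; case: ltP => h.
  by rewrite (@max_r _ _ 0)// subr_ge0 ltW.
by rewrite (@max_l _ _ 0)// subr_le0.
Qed.

End indic_overlap.

Section ito_isometry.
Context (R : realType) (disp : measure_display) (Omega : measurableType disp).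
Context (P : probability Omega R) (F : R -> set (set Omega)).
Hypothesis hF : is_filtration F.
Context (d : nat) (W : R -> Omega -> 'cV[R]_d).
Hypothesis hW : is_brownian_motion P F W.
Variable c : R.
Hypothesis hc : forall s : R, 0 < s ->
  (\int[normal_prob 0 s]_x (x ^+ 2)%:E = (c * s ^+ 2)%:E)%E.
Variables (I : finType) (a b : I -> R) (xi : I -> Omega -> 'M[R]_d) (t : R).
Hypothesis hI : forall k, [/\ 0 <= a k, a k <= b k, b k <= t,
  sub_measurable (F (a k)) (xi k) & exists M : R, forall w, fnorm (xi k w) <= M].

Let ov k l := Num.max 0 (Num.min (b k) (b l) - Num.max (a k) (a l)).

Let a0 k : 0 <= a k. Proof. by case: (hI k). Qed.
Let ab k : a k <= b k. Proof. by case: (hI k). Qed.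
Let bt k : b k <= t. Proof. by case: (hI k). Qed.
Let sxi k i j : smeasurable (F (a k)) (fun w => xi k w i j).
Proof. by case: (hI k) => _ _ _ h _ B mB; exact: h. Qed.
Let mxi k i j : measurable_fun setT (fun w => xi k w i j).
Proof. exact: smeasurable_measurable (sxi k i j). Qed.
Let bxi k : exists M : R, forall w i j, `|xi k w i j| <= M.
Proof.
case: (hI k) => _ _ _ _ [M h]; exists M => w i j.
exact: le_trans (fnorm_entry _ _ _) (h w).
Qed.

Let sqxi k i j : sqintegrable P (fun w => xi k w i j).
Proof. by have [M h] := bxi k; apply: (@sqintegrable_bounded _ _ _ _ _ M). Qed.

Let sqY k i j :
  sqintegrable P (fun w => xi k w i j * inc W (a k) (b k) j w).
Proof.
have [M h] := bxi k; apply: (sqintegrable_boundedM (c := M)) => //.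
exact: (sqintegrable_inc hF hW hc).
Qed.

(** Common value of the two sides of the isometry, up to the factor [c]: moments of products of
    coefficients weighted by overlap lengths. *)
Let V : R := \sum_i \sum_(p : I * 'I_d) \sum_l
  ov p.1 l * \int[P]_w (xi p.1 w i p.2 * xi l w i p.2).

(** The nested sums are flattened into a single sum over a product index, so that integral and sum
    are exchanged only once; [evE] does the same. *)
Let lhsE w : fnorm (\sum_k xi k w *m (W (b k) w - W (a k) w)) ^+ 2 =
  \sum_(z : 'I_d * ((I * 'I_d) * (I * 'I_d)))
    (xi z.2.1.1 w z.1 z.2.1.2 * inc W (a z.2.1.1) (b z.2.1.1) z.2.1.2 w) *
    (xi z.2.2.1 w z.1 z.2.2.2 * inc W (a z.2.2.1) (b z.2.2.1) z.2.2.2 w).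
Proof.
rewrite fnorm_sqr -(pair_bigA _ (fun i z =>
    (xi z.1.1 w i z.1.2 * inc W (a z.1.1) (b z.1.1) z.1.2 w) *
    (xi z.2.1 w i z.2.2 * inc W (a z.2.1) (b z.2.1) z.2.2 w)))/=.
apply: eq_bigr => i _; rewrite big_ord1 summxE.
rewrite (eq_bigr (fun k => \sum_j xi k w i j * (W (b k) w - W (a k) w) j ord0)); last first.
  by move=> k _; rewrite mxE.
rewrite pair_bigA/= expr2 big_distrlr/= pair_bigA/=.
by apply: eq_bigr => -[[k j] [l j']] _ /=; rewrite /inc !mxE.
Qed.

Let lhs_isometry :
  (\int[P]_w (fnorm (\sum_k xi k w *m (W (b k) w - W (a k) w)) ^+ 2)%:E =
   (c * V)%:E)%E.
Proof.
under eq_integral do rewrite lhsE.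
rewrite EFin_Rintegral//; last first.
  by apply: integrable_fin_sum => // z; exact: sqintegrableM.
rewrite Rintegral_fin_sum//; last by move=> z; exact: sqintegrableM.
congr EFin; rewrite /V mulr_sumr -(pair_bigA _ (fun i z => \int[P]_w (
    (xi z.1.1 w i z.1.2 * inc W (a z.1.1) (b z.1.1) z.1.2 w) *
    (xi z.2.1 w i z.2.2 * inc W (a z.2.1) (b z.2.1) z.2.2 w))))/=.
apply: eq_bigr => i _.
rewrite -(pair_bigA _ (fun p q => \int[P]_w (
    (xi p.1 w i p.2 * inc W (a p.1) (b p.1) p.2 w) *
    (xi q.1 w i q.2 * inc W (a q.1) (b q.1) q.2 w))))/= mulr_sumr.
apply: eq_bigr => -[k j] _ /=.
rewrite -(pair_bigA _ (fun l j' => \int[P]_w (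
    (xi k w i j * inc W (a k) (b k) j w) *
    (xi l w i j' * inc W (a l) (b l) j' w))))/= mulr_sumr.
apply: eq_bigr => l _.
have [M hM] := bxi k; have [N hN] := bxi l.
have ovE j' := Rintegral_overlap hF hW hc j j' (a0 k) (ab k) (a0 l) (ab l)
  (sxi k i j) (fun w => hM w i j) (sxi l i j') (fun w => hN w i j').
(* Distinct coordinates of [W] are uncorrelated, so only [j' = j] survives; this is why [V] carries
   a single column index. *)
rewrite (bigD1 j)//= ovE eqxx mul1r big1 ?addr0 ?mulrA// => j' jj'.
by rewrite ovE eq_sym (negbTE jj') !mul0r.
Qed.

Let ev s w := \sum_k (\1_(`]a k, b k] : set R) s : R) *: xi k w.

Let evE s w : fnorm (ev s w) ^+ 2 = \sum_(z : 'I_d * ((I * 'I_d) * I))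
   (xi z.2.1.1 w z.1 z.2.1.2 * xi z.2.2 w z.1 z.2.1.2) *
   (\1_(`]a z.2.1.1, b z.2.1.1] : set R) s * \1_(`]a z.2.2, b z.2.2] : set R) s).
Proof.
rewrite fnorm_sqr -(pair_bigA _ (fun i z =>
   (xi z.1.1 w i z.1.2 * xi z.2 w i z.1.2) *
   (\1_(`]a z.1.1, b z.1.1] : set R) s * \1_(`]a z.2, b z.2] : set R) s)))/=.
apply: eq_bigr => i _.
rewrite -(pair_bigA _ (fun p l =>
   (xi p.1 w i p.2 * xi l w i p.2) *
   (\1_(`]a p.1, b p.1] : set R) s * \1_(`]a l, b l] : set R) s)))/=.
rewrite -(pair_bigA _ (fun k j => \sum_l
   (xi k w i j * xi l w i j) *
   (\1_(`]a k, b k] : set R) s * \1_(`]a l, b l] : set R) s)))/=.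
rewrite exchange_big/=; apply: eq_bigr => j _; rewrite summxE.
rewrite (eq_bigr (fun k => (\1_(`]a k, b k] : set R) s : R) * xi k w i j)); last first.
  by move=> k _; rewrite mxE.
rewrite expr2 big_distrlr/=; apply: eq_bigr => k _; apply: eq_bigr => l _.
by ring.
Qed.

Let rhs_isometry :
  (\int[P]_w \int[lebesgue_measure]_(s in `[0%R, t]) (fnorm (ev s w) ^+ 2)%:E =
   V%:E)%E.
Proof.
have inner w : (\int[lebesgue_measure]_(s in `[0%R, t]) (fnorm (ev s w) ^+ 2)%:E =
  (\sum_(z : 'I_d * ((I * 'I_d) * I))
    ov z.2.1.1 z.2.2 * (xi z.2.1.1 w z.1 z.2.1.2 * xi z.2.2 w z.1 z.2.1.2))%:E)%E.
  under eq_integral do rewrite evE.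
  have iz k l r : lebesgue_measure.-integrable (`[0, t] : set R) (EFin \o (fun s => r *
      (\1_(`]a k, b k] : set R) s * \1_(`]a l, b l] : set R) s))).
    by apply: integrableZ_EFin => //; exact: integrable_overlap.
  rewrite EFin_Rintegral//; last by apply: integrable_fin_sum.
  rewrite Rintegral_fin_sum//; congr EFin; apply: eq_bigr => z _.
  rewrite RintegralZl//; last exact: integrable_overlap.
  by rewrite Rintegral_indic_overlap// mulrC.
under eq_integral do rewrite inner.
have iz (k l : I) (i j : 'I_d) r : P.-integrable setT
    (EFin \o (fun w => r * (xi k w i j * xi l w i j))).
  by apply: integrableZ_EFin => //; exact: sqintegrableM.
rewrite EFin_Rintegral//; last by apply: integrable_fin_sum.
rewrite Rintegral_fin_sum//; congr EFin; rewrite /V.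
rewrite -(pair_bigA _ (fun i q => \int[P]_w (ov q.1.1 q.2 *
  (xi q.1.1 w i q.1.2 * xi q.2 w i q.1.2))))/=; apply: eq_bigr => i _.
rewrite -(pair_bigA _ (fun p l => \int[P]_w (ov p.1 l *
  (xi p.1 w i p.2 * xi l w i p.2))))/=; apply: eq_bigr => p _.
by apply: eq_bigr => l _; rewrite RintegralZl//; exact: sqintegrableM.
Qed.

Lemma ito_isometry :
  (\int[P]_w (fnorm (\sum_k xi k w *m (W (b k) w - W (a k) w)) ^+ 2)%:E =
   c%:E * \int[P]_w \int[lebesgue_measure]_(s in `[0%R, t])
     (fnorm (\sum_k (\1_(`]a k, b k] : set R) s : R) *: xi k w) ^+ 2)%:E)%E.
Proof. by rewrite lhs_isometry EFinM -rhs_isometry. Qed.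

End ito_isometry.

Lemma measurable_fun_section1 d1 d2 d3 (T1 : measurableType d1)
    (T2 : measurableType d2) (T3 : measurableType d3) (A : set T1) (B : set T2)
    (f : T1 * T2 -> T3) (y : T2) : measurable A -> measurable B -> B y ->
  measurable_fun (A `*` B) f -> measurable_fun A (fun x => f (x, y)).
Proof.
move=> mA mB By mf; apply/(measurable_restrictT _ mA).
rewrite (_ : _ \_ A = (f \_ (A `*` B)) \o (fun x => (x, y))).
  apply: measurableT_comp; first exact/(measurable_restrictT f (measurableX mA mB)).
  exact: measurable_fun_pair.
apply/funext => x; rewrite /= !patchE in_setX/= (mem_set By) andbT.
by case: ifP.
Qed.

(** Carries a pointwise three-term bound through an integral; it is applied both in time and over
    [Omega]. *)
Lemma ge0_le_integral3 d (T : measurableType d) (R : realType)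
    (mu : {measure set T -> \bar R}) (D : set T) (f f1 f2 f3 : T -> \bar R) (k : R) :
  measurable D -> 0 <= k ->
  measurable_fun D f -> measurable_fun D f1 -> measurable_fun D f2 ->
  measurable_fun D f3 -> (forall x, D x -> 0 <= f x)%E ->
  (forall x, D x -> 0 <= f1 x)%E -> (forall x, D x -> 0 <= f2 x)%E ->
  (forall x, D x -> 0 <= f3 x)%E ->
  (forall x, D x -> f x <= k%:E * f1 x + k%:E * f2 x + k%:E * f3 x)%E ->
  (\int[mu]_(x in D) f x <= k%:E * \int[mu]_(x in D) f1 x
    + k%:E * \int[mu]_(x in D) f2 x + k%:E * \int[mu]_(x in D) f3 x)%E.
Proof.
move=> mD k0 mf mf1 mf2 mf3 f0 f10 f20 f30 le.
have kf0 (g : T -> \bar R) : (forall x, D x -> 0 <= g x)%E ->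
    forall x, D x -> (0 <= k%:E * g x)%E.
  by move=> g0 x Dx; rewrite mule_ge0 ?lee_fin ?g0.
have mk (g : T -> \bar R) : measurable_fun D g -> measurable_fun D (fun x => k%:E * g x)%E.
  exact: measurable_funeM.
rewrite -!ge0_integralZl//.
have h12 x : D x -> (0 <= k%:E * f1 x + k%:E * f2 x)%E.
  by move=> Dx; rewrite adde_ge0 ?kf0.
rewrite -ge0_integralD//; [|exact: kf0|exact: mk|exact: kf0|exact: mk].
rewrite -ge0_integralD//; [|by apply: emeasurable_funD; exact: mk|exact: kf0|exact: mk].
apply: ge0_le_integral => //.
apply: emeasurable_funD; last exact: mk.
by apply: emeasurable_funD; exact: mk.
Qed.

Section ito_contraction.
Context (R : realType) (disp : measure_display) (Omega : measurableType disp).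
Context (P : probability Omega R) (F : R -> set (set Omega)).
Hypothesis hF : is_filtration F.
Context (d : nat) (W : R -> Omega -> 'cV[R]_d).
Hypothesis hW : is_brownian_motion P F W.
Variable c : R.
Hypothesis c0 : 0 <= c.
Hypothesis hc : forall s : R, 0 < s ->
  (\int[normal_prob 0 s]_x (x ^+ 2)%:E = (c * s ^+ 2)%:E)%E.
Variable t : R.
Notation Qt := (`[0, t] `*` [set: Omega]).

Section joint.
Context (p q : nat).
Implicit Types f g h : R -> Omega -> 'M[R]_(p, q).

(** The square of the distance in L^2(Omega x [0, t]), possibly infinite; hence the factors 3 in
    [L2dist_triangle]. *)
Definition L2dist f g : \bar R :=
  (\int[P]_w \int[lebesgue_measure]_(s in `[0%R, t])
     (fnorm (f s w - g s w) ^+ 2)%:E)%E.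

Lemma measurable_fnorm_sqrB f g :
  mx_measurable Qt (fun z : R * Omega => f z.1 z.2) ->
  mx_measurable Qt (fun z : R * Omega => g z.1 z.2) ->
  measurable_fun Qt (fun z : R * Omega => (fnorm (f z.1 z.2 - g z.1 z.2) ^+ 2)%:E).
Proof.
move=> mf mg; apply/measurable_EFinP.
exact: (measurable_fnorm_sqr (mx_measurableB mf mg)).
Qed.

Lemma measurable_L2dist_inner f g :
  mx_measurable Qt (fun z : R * Omega => f z.1 z.2) ->
  mx_measurable Qt (fun z : R * Omega => g z.1 z.2) ->
  measurable_fun setT (fun w => \int[lebesgue_measure]_(s in `[0%R, t])
     (fnorm (f s w - g s w) ^+ 2)%:E)%E.
Proof.
move=> mf mg; apply: (@measurable_tonelli2_on _ _ _ _ _ lebesgue_measure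
  `[0, t] setT _ _ (fun z => (fnorm (f z.1 z.2 - g z.1 z.2) ^+ 2)%:E)) => //.
- exact: measurable_fnorm_sqrB.
- by move=> z _; rewrite lee_fin sqr_ge0.
Qed.

Lemma L2dist_triangle f f1 f2 f3 :
  mx_measurable Qt (fun z : R * Omega => f z.1 z.2) ->
  mx_measurable Qt (fun z : R * Omega => f1 z.1 z.2) ->
  mx_measurable Qt (fun z : R * Omega => f2 z.1 z.2) ->
  mx_measurable Qt (fun z : R * Omega => f3 z.1 z.2) ->
  (L2dist f f3 <= 3%:E * L2dist f f1 + 3%:E * L2dist f1 f2 + 3%:E * L2dist f2 f3)%E.
Proof.
move=> mf mf1 mf2 mf3.
have ge0 g h w : (0 <= \int[lebesgue_measure]_(s in `[0%R, t])
     (fnorm (g s w - h s w) ^+ 2)%:E)%E.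
  by apply: integral_ge0 => s _; rewrite lee_fin sqr_ge0.
have msec g h w : mx_measurable Qt (fun z : R * Omega => g z.1 z.2) ->
    mx_measurable Qt (fun z : R * Omega => h z.1 z.2) ->
    measurable_fun (`[0, t] : set (measurableTypeR R))
      (fun s => (fnorm (g s w - h s w) ^+ 2)%:E).
  move=> mg mh; apply: (measurable_fun_section1 (B := setT)
    (f := fun z => (fnorm (g z.1 z.2 - h z.1 z.2) ^+ 2)%:E)) => //.
  exact: measurable_fnorm_sqrB.
apply: ge0_le_integral3 => //; do ?exact: measurable_L2dist_inner.
move=> w _; apply: ge0_le_integral3 => //; do ?exact: msec.
- by move=> s _; rewrite lee_fin sqr_ge0.
- by move=> s _; rewrite lee_fin sqr_ge0.
- by move=> s _; rewrite lee_fin sqr_ge0.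
- by move=> s _; rewrite lee_fin sqr_ge0.
move=> s _; rewrite -!EFinM -!EFinD lee_fin.
rewrite (_ : f s w - f3 s w =
  (f s w - f1 s w) + (f1 s w - f2 s w) + (f2 s w - f3 s w)); first exact: fnorm_sqrD3.
by rewrite !subrKA.
Qed.

End joint.

Implicit Types S : simple_process R Omega d.

Lemma simple_isometryB S S' :
  is_simple_process F t S -> is_simple_process F t S' ->
  (\int[P]_w (fnorm (sp_integral W S w - sp_integral W S' w) ^+ 2)%:E =
   c%:E * \int[P]_w \int[lebesgue_measure]_(s in `[0%R, t])
     (fnorm (sp_eval S s w - sp_eval S' s w) ^+ 2)%:E)%E.
Proof.
move=> hS hS'.
pose n := sp_size S; pose n' := sp_size S'.
(* The difference of the two processes is one family indexed by the disjoint union of the grids,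
   with the coefficients of [S'] negated. *)
pose a (k : 'I_n + 'I_n') :=
  match k with inl i => sp_time S i | inr i => sp_time S' i end.
pose b (k : 'I_n + 'I_n') :=
  match k with inl i => sp_time S i.+1 | inr i => sp_time S' i.+1 end.
pose xi (k : 'I_n + 'I_n') w :=
  match k with inl i => sp_coef S i w | inr i => - sp_coef S' i w end.
have := @ito_isometry R disp Omega P F hF d W hW c hc _ a b xi t.
have hI k : [/\ 0 <= a k, a k <= b k, b k <= t,
    sub_measurable (F (a k)) (xi k) & exists M : R, forall w, fnorm (xi k w) <= M].
  case: k => i; first exact: hS.
  have [s0 ss st sm [M hM]] := hS' i (ltn_ord i); split => //.
    move=> p q; rewrite /xi.
    have mN : smeasurable (F (sp_time S' i)) (fun w => cst 0 w - sp_coef S' i w p q).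
      apply: smeasurableB; first exact: filtration_sigma hF _ s0.
        apply/smeasurableP; first exact: filtration_sigma hF _ s0.
        exact: measurable_cst.
      exact: sm.
    move=> B mB; have := mN B mB; congr (F _ _).
    by congr (_ @^-1` B); apply/funext => w; rewrite !mxE /cst sub0r.
  by exists M => w; rewrite /xi fnormN.
move=> /(_ hI).
have -> : (fun w => (fnorm (\sum_k xi k w *m (W (b k) w - W (a k) w)) ^+ 2)%:E) =
    (fun w => (fnorm (sp_integral W S w - sp_integral W S' w) ^+ 2)%:E).
  apply/funext => w; rewrite big_sumType/= /sp_integral -sumrN.
  congr ((fnorm (_ + _) ^+ 2)%:E).
  by apply: eq_bigr => i _; rewrite mulNmx.
move=> ->; apply: (congr1 (mule c%:E)); apply: eq_integral => w _.
apply: eq_integral => s _; rewrite big_sumType/= /sp_eval -sumrN.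
congr ((fnorm (_ + _) ^+ 2)%:E).
by apply: eq_bigr => i _; rewrite scalerN.
Qed.

Lemma mx_measurable_sp_coef S i : is_simple_process F t S ->
  (i < sp_size S)%N -> mx_measurable setT (sp_coef S i).
Proof.
move=> hS /hS[s0 _ _ sm _] p q.
exact: (smeasurable_measurable hF s0 (sm p q)).
Qed.

Lemma mx_measurable_sp_integral S : is_simple_process F t S ->
  mx_measurable setT (sp_integral W S).
Proof.
move=> hS p q; rewrite /sp_integral; under eq_fun do rewrite summxE.
apply: measurable_sum => i.
have [s0 ss _ _ _] := hS i (ltn_ord i).
apply: mx_measurableM; first exact: mx_measurable_sp_coef.
move=> u v; under eq_fun do rewrite !mxE.
rewrite [v]ord1.
exact: (measurable_inc hF hW u s0 ss).
Qed.

Lemma mx_measurable_sp_eval S : is_simple_process F t S ->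
  mx_measurable (`[0, t] `*` [set: Omega]) (fun z : R * Omega => sp_eval S z.1 z.2).
Proof.
move=> hS p q.
rewrite [X in measurable_fun _ X](_ : _ = fun z : R * Omega => \sum_(i < sp_size S)
    (\1_(`]sp_time S i, sp_time S i.+1] : set R) z.1 * sp_coef S i z.2 p q)); last first.
  by apply/funext => z; rewrite /sp_eval summxE; apply: eq_bigr => i _; rewrite mxE.
apply: measurable_sum => i.
apply: measurable_funTS; apply: measurable_funM.
  apply: (measurableT_comp (f := (\1_(`]sp_time S i, sp_time S i.+1] : set R) : R -> R))) => //.
apply: (measurableT_comp (f := fun w => sp_coef S i w p q)) => //.
exact: mx_measurable_sp_coef.
Qed.

(* The factor 9 comes from two applications of |x + y + z|^2 <= 3 (|x|^2 + |y|^2 + |z|^2),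
   with the approximating simple processes in the middle. *)
Lemma ito_contraction (H H' : R -> Omega -> 'M[R]_d) (J J' : Omega -> 'cV[R]_d) :
  is_ito_integral P F W t H J -> is_ito_integral P F W t H' J' ->
  (\int[P]_w (fnorm (J w - J' w) ^+ 2)%:E <= (9 * c)%:E * L2dist H H')%E.
Proof.
move=> [mH mJ [S [hS cvS cvJ]]] [mH' mJ' [S' [hS' cvS' cvJ']]].
pose e n := (\int[P]_w (fnorm (sp_integral W (S n) w - J w) ^+ 2)%:E)%E.
pose e' n := (\int[P]_w (fnorm (sp_integral W (S' n) w - J' w) ^+ 2)%:E)%E.
rewrite unlock in cvJ cvJ'.
have cvL : L2dist (sp_eval (S n)) H @[n --> \oo] --> 0%E := cvS.
have cvL' : L2dist (sp_eval (S' n)) H' @[n --> \oo] --> 0%E := cvS'.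
have mS n := mx_measurable_sp_eval (hS n).
have mS' n := mx_measurable_sp_eval (hS' n).
have mI n := mx_measurable_sp_integral (hS n).
have mI' n := mx_measurable_sp_integral (hS' n).
have L2C (f g : R -> Omega -> 'M[R]_d) : L2dist f g = L2dist g f.
  by apply: eq_integral => w _; apply: eq_integral => s _; rewrite fnormB.
have mN (f g : Omega -> 'cV[R]_d) : mx_measurable setT f -> mx_measurable setT g ->
    measurable_fun setT (fun w => (fnorm (f w - g w) ^+ 2)%:E).
  move=> mf mg; apply/measurable_EFinP.
  exact: (measurable_fnorm_sqr (mx_measurableB mf mg)).
have bound n : (\int[P]_w (fnorm (J w - J' w) ^+ 2)%:E <=
    3%:E * e n + 3%:E * (c%:E * (3%:E * L2dist (sp_eval (S n)) H
      + 3%:E * L2dist H H' + 3%:E * L2dist (sp_eval (S' n)) H')) + 3%:E * e' n)%E.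
  apply: (@le_trans _ _ (3%:E * e n + 3%:E * (c%:E *
      L2dist (sp_eval (S n)) (sp_eval (S' n))) + 3%:E * e' n)%E); last first.
    apply: leeD => //; apply: leeD => //; rewrite lee_pmul2l//.
    rewrite lee_wpmul2l ?lee_fin// [L2dist (sp_eval (S' n)) H']L2C.
    exact: L2dist_triangle.
  rewrite -(simple_isometryB (hS n) (hS' n)).
  apply: ge0_le_integral3 => //; try exact: mN;
    try by move=> w _; rewrite lee_fin sqr_ge0.
  move=> w _; rewrite -!EFinM -!EFinD lee_fin (fnormB (sp_integral W (S n) w) (J w)).
  rewrite (_ : J w - J' w = (J w - sp_integral W (S n) w) +
    (sp_integral W (S n) w - sp_integral W (S' n) w) + (sp_integral W (S' n) w - J' w)).
    exact: fnorm_sqrD3.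
  by rewrite !subrKA.
(* [L2dist H H'] may be infinite; the sums of limits are still defined, because all other terms tend
   to 0. *)
have lim : ((3%:E * e n + 3%:E * (c%:E * (3%:E * L2dist (sp_eval (S n)) H
      + 3%:E * L2dist H H' + 3%:E * L2dist (sp_eval (S' n)) H')) + 3%:E * e' n)
    @[n --> \oo] --> 3%:E * 0 + 3%:E * (c%:E * (3%:E * 0 + 3%:E * L2dist H H' + 3%:E * 0))
      + 3%:E * 0)%E.
  have fin3 : (3%:E : \bar R) \is a fin_num by [].
  have cv1 := cvgeZl fin3 cvL; have cv1' := cvgeZl fin3 cvL'.
  have cv2 := cvgeZl fin3 cvJ; have cv2' := cvgeZl fin3 cvJ'.
  apply: cvgeD cv2'; first by rewrite fin_num_adde_defl// mule0.
  apply: cvgeD cv2 _; first by rewrite fin_num_adde_defr// mule0.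
  do 2 (apply: cvgeZl; first by []).
  apply: cvgeD cv1'; first by rewrite fin_num_adde_defl// mule0.
  apply: cvgeD cv1 _; first by rewrite fin_num_adde_defr// mule0.
  exact: cvg_cst.
have limE (D : \bar R) : ((9 * c)%:E * D =
    3%:E * 0 + 3%:E * (c%:E * (3%:E * 0 + 3%:E * D + 3%:E * 0)) + 3%:E * 0)%E.
  rewrite !mule0 !add0e !adde0 2!muleA -!EFinM.
  by congr (_%:E * _)%E; ring.
by rewrite limE; apply: cvge_ge lim; apply: nearW => n; exact: bound.
Qed.

End ito_contraction.

(** * Laplace kernels *)

Section kernels.
Variable R : realType.
Notation mR := (measurableTypeR R).

Lemma measurable_expRM (A : set (mR * mR)) :
  measurable_fun A (fun z : mR * mR => (expR (- (z.1 * z.2)))%:E).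
Proof.
apply: measurable_funTS; apply/measurable_EFinP; apply: measurableT_comp => //.
exact/measurable_funN/measurable_funM.
Qed.

Lemma measurable_expRMr (A : set mR) (t : R) :
  measurable_fun A (fun x : mR => (expR (- (x * t)))%:E).
Proof.
apply: measurable_funTS; apply/measurable_EFinP; apply: measurableT_comp => //.
exact/measurable_funN/measurable_funM.
Qed.

(* Tonelli's theorem needs a sigma-finite measure, while [lam] is arbitrary on
   negative numbers; finiteness of Gbar makes its restriction sigma-finite. *)
Lemma sigma_finite_on_halfline (lam : {measure set mR -> \bar R}) :
  (Gbar lam 1 < +oo)%E ->
  exists lam0 : {sigma_finite_measure set mR -> \bar R},
    forall A : set mR, measurable A -> A `<=` `[0, +oo[ -> lam0 A = lam A.
Proof.
move=> G1; have mD : measurable (`[0, +oo[ : set mR) by [].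
have sf : sigma_finite setT (mrestr lam mD).
  exists (fun n => `]-oo, n%:R]%classic : set mR).
    apply/seteqP; split => // x _; exists (Num.bound `|x : R|) => //=.
    rewrite in_itv/=.
    exact: le_trans (ler_norm (x : R)) (ltW (archi_boundP (normr_ge0 _))).
  move=> n; split => //; rewrite /mrestr.
  set A := (X in lam X).
  have mA : measurable A by exact: measurableI.
  (* On [[0, n]] the integrand of [Gbar lam 1] is at least [expR (- n)]. *)
  have : ((expR (- n%:R))%:E * lam A <= Gbar lam 1)%E.
    rewrite -integral_cst// /Gbar.
    apply: (@le_trans _ _ (\int[lam]_(x in A) (expR (- (x * 1)))%:E)%E).
      apply: ge0_le_integral => //.
      - by move=> x _; rewrite lee_fin expR_ge0.
      - exact: measurable_expRMr.
      - move=> x [/=]; rewrite !in_itv/= andbT mulr1 => xn x0.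
        by rewrite /cst lee_fin ler_expR lerN2.
    apply: ge0_subset_integral => //.
    - exact: measurable_expRMr.
    - by move=> x [].
  move=> le; rewrite ltNge leye_eq; apply/negP => /eqP AE.
  move: le; rewrite AE gt0_muley ?lte_fin ?expR_gt0// leye_eq => /eqP GE.
  by rewrite GE in G1.
pose lam0 : {sigma_finite_measure set mR -> \bar R} :=
  HB.pack (mrestr lam mD) (Measure_isSigmaFinite.Build _ _ _ (mrestr lam mD) sf).
exists lam0 => A mA AD; rewrite /lam0/= /mrestr; congr (lam _).
exact: setIidl.
Qed.

(** Tonelli applies to the positive and negative parts, and [fine] is measurable. No integrability
    is asked for, so kernels are measurable up to and including time 0, where their integrals may
    diverge. *)
Lemma measurable_Rintegral_param d1 d2 (T1 : measurableType d1)
    (T2 : measurableType d2)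
    (m2 : {sigma_finite_measure set T2 -> \bar R})
    (A : set T1) (B : set T2) (f : T1 * T2 -> R) :
  measurable A -> measurable B -> measurable_fun (A `*` B) f ->
  measurable_fun A (fun x => \int[m2]_(y in B) f (x, y)).
Proof.
move=> mA mB mf; rewrite /Rintegral.
apply: (measurableT_comp (f := @fine R)); first exact: fine_measurable.
under eq_fun do rewrite integralE.
have mE : measurable_fun (A `*` B) (EFin \o f) by exact/measurable_EFinP.
apply: emeasurable_funB.
  rewrite (_ : (fun x => _) =
      (fun x => \int[m2]_(y in B) (EFin \o f)^\+ (x, y))%E); last first.
    by apply/funext => x; apply: eq_integral => y _; rewrite !funeposE.
  apply: measurable_tonelli1_on => //; first exact: measurable_funepos.
rewrite (_ : (fun x => _) =
    (fun x => \int[m2]_(y in B) (EFin \o f)^\- (x, y))%E); last first.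
  by apply/funext => x; apply: eq_integral => y _; rewrite !funenegE.
by apply: measurable_tonelli1_on => //; exact: measurable_funeneg.
Qed.

Lemma measurable_fun_section2 d1 d2 d3 (T1 : measurableType d1)
    (T2 : measurableType d2) (T3 : measurableType d3) (A : set T1) (B : set T2)
    (f : T1 * T2 -> T3) (x : T1) : measurable A -> measurable B -> A x ->
  measurable_fun (A `*` B) f -> measurable_fun B (fun y => f (x, y)).
Proof.
move=> mA mB Ax mf; apply/(measurable_restrictT _ mB).
rewrite (_ : _ \_ B = (f \_ (A `*` B)) \o (fun y => (x, y))).
  apply: measurableT_comp; first exact/(measurable_restrictT f (measurableX mA mB)).
  exact: measurable_fun_pair.
apply/funext => y; rewrite /= !patchE in_setX/= (mem_set Ax).
by case: ifP.
Qed.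

(** On [[0, t]] the integrand is [a^-1] times the exponential density of rate [a], whose total mass
    is 1. *)
Lemma integral_expR_le (a t : R) : 0 < a ->
  (\int[lebesgue_measure]_(s in `[0%R, t]) (expR (- (a * s)))%:E <= (a^-1)%:E)%E.
Proof.
move=> a0.
have mpdf : measurable_fun setT (fun s : mR => (a^-1 * exponential_pdf a s)%:E).
  by apply/measurable_EFinP/measurable_funM => //; exact: measurable_exponential_pdf.
have pdf0 s : (0 <= (a^-1 * exponential_pdf a s)%:E)%E.
  by rewrite lee_fin mulr_ge0 ?invr_ge0 ?(ltW a0)// exponential_pdf_ge0// ltW.
rewrite (_ : integral _ _ _ =
    \int[lebesgue_measure]_(s in `[0%R, t]) (a^-1 * exponential_pdf a s)%:E)%E; last first.
  apply: eq_integral => s; rewrite inE/= in_itv/= => /andP[s0 _].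
  by rewrite exponential_pdfE//= mulKf ?gt_eqF// mulNr.
apply: (@le_trans _ _ (\int[lebesgue_measure]_s (a^-1 * exponential_pdf a s)%:E)%E).
  exact: ge0_subset_integral.
under eq_integral do rewrite EFinM.
rewrite ge0_integralZl//.
- by rewrite integral_exponential_pdf// mule1.
- by apply/measurable_EFinP; exact: measurable_exponential_pdf.
- by move=> s _; rewrite lee_fin exponential_pdf_ge0// ltW.
- by rewrite lee_fin invr_ge0 ltW.
Qed.

(** On [D] the sum is positive, so its inverse is [expR (- ln _)], a composition of measurable
    maps. *)
Lemma measurable_addV (D : set (mR * mR)) (K : R) : 0 < K -> measurable D ->
  (forall z, D z -> K <= z.1 /\ K <= z.2) ->
  measurable_fun D (fun z : mR * mR => ((z.1 + z.2)^-1)%:E).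
Proof.
move=> K0 mD hD; apply/measurable_EFinP.
apply: (eq_measurable_fun (fun z : mR * mR => expR (- ln (z.1 + z.2)))).
  move=> z /set_mem /hD[z1 z2].
  by rewrite expRN lnK// posrE; apply: addr_gt0; exact: lt_le_trans K0 _.
apply: measurable_funTS; apply: measurableT_comp => //; apply: measurable_funN.
apply: measurableT_comp; first exact: measurable_ln.
exact: measurable_funD.
Qed.

Section laplace.
Variable lam : {sigma_finite_measure set mR -> \bar R}.

Definition laplace (D : set mR) (t : R) : \bar R :=
  (\int[lam]_(rho in D) (expR (- (rho * t)))%:E)%E.

Lemma laplace_ge0 D t : (0 <= laplace D t)%E.
Proof. by apply: integral_ge0 => x _; rewrite lee_fin expR_ge0. Qed.

Lemma measurable_laplace (D E : set mR) : measurable D ->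
  measurable_fun E (laplace D : mR -> \bar R).
Proof.
move=> mD; apply: measurable_funTS.
apply: (measurable_tonelli2_on lam mD measurableT
  (f := fun z : mR * mR => (expR (- (z.1 * z.2)))%:E)).
  exact: measurable_expRM.
by move=> z _; rewrite lee_fin expR_ge0.
Qed.

Lemma integral_laplace_sqr (K t : R) : 0 < K ->
  (\int[lebesgue_measure]_(s in `[0%R, t])
     (laplace `[K, +oo[ s * laplace `[K, +oo[ s) <= tail_r lam K)%E.
Proof.
move=> K0; set D : set mR := `[K, +oo[%classic; set I : set mR := `[0, t]%classic.
have mD : measurable D by exact: measurable_itv.
have mI : measurable I by exact: measurable_itv.
have inD (x : R) : D x <-> K <= x by rewrite /D/= in_itv/= andbT.
have e0 (x : R) : (0 <= (expR x)%:E)%E by rewrite lee_fin expR_ge0.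
have mf1 : measurable_fun (I `*` D)
    (fun z : mR * mR => (expR (- (z.2 * z.1)))%:E * laplace D z.1)%E.
  apply: measurable_funTS; apply: emeasurable_funM.
    under eq_fun do rewrite mulrC; exact: measurable_expRM.
  apply: (measurableT_comp (f := laplace D : mR -> \bar R)) => //.
  exact: measurable_laplace.
have f10 z : (I `*` D) z -> (0 <= (expR (- (z.2 * z.1)))%:E * laplace D z.1)%E.
  by move=> _; rewrite mule_ge0// laplace_ge0.
rewrite (_ : integral _ _ _ = \int[lebesgue_measure]_(s in I) \int[lam]_(x in D)
    ((expR (- (x * s)))%:E * laplace D s))%E; last first.
  apply: eq_integral => s _; rewrite ge0_integralZr//; first exact: measurable_expRMr.
  exact: laplace_ge0.
(* The time integral moves inside one variable at a time: here past [x], the other factor being kept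
   as [laplace D s], and below past [y] for fixed [x]. *)
rewrite (tonelli_on lebesgue_measure lam mI mD mf1 f10)/=.
have mg x : measurable_fun (I `*` D)
    (fun z : mR * mR => (expR (- (x * z.1)))%:E * (expR (- (z.2 * z.1)))%:E)%E.
  apply: measurable_funTS; apply: emeasurable_funM.
    apply/measurable_EFinP/measurableT_comp => //.
    exact/measurable_funN/measurable_funM.
  under eq_fun do rewrite mulrC; exact: measurable_expRM.
have g0 x z : (I `*` D) z ->
    (0 <= (expR (- (x * z.1)))%:E * (expR (- (z.2 * z.1)))%:E)%E.
  by move=> _; exact: mule_ge0.
have mV : measurable_fun (D `*` D) (fun z : mR * mR => ((z.1 + z.2)^-1)%:E).
  apply: (measurable_addV K0); first exact: measurableX.
  by move=> z [/inD z1 /inD z2].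
have V0 z : (D `*` D) z -> (0 <= ((z.1 + z.2)^-1)%:E)%E.
  move=> [/inD z1 /inD z2].
  by rewrite lee_fin invr_ge0; apply: addr_ge0; apply: le_trans (ltW K0) _.
apply: ge0_le_integral => //.
- move=> x _; apply: integral_ge0 => s _.
  by rewrite mule_ge0// laplace_ge0.
- exact: (measurable_tonelli2_on lebesgue_measure mI mD mf1 f10).
- exact: (measurable_tonelli1_on lam mD mD mV V0).
move=> x /inD Kx.
rewrite (_ : integral _ _ _ = \int[lebesgue_measure]_(s in I) \int[lam]_(y in D)
    ((expR (- (x * s)))%:E * (expR (- (y * s)))%:E))%E; last first.
  by apply: eq_integral => s _; rewrite ge0_integralZl//; exact: measurable_expRMr.
rewrite (tonelli_on lebesgue_measure lam mI mD (mg x) (g0 x))/=.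
apply: ge0_le_integral => //.
- by move=> y _; apply: integral_ge0 => s _; exact: mule_ge0.
- exact: (measurable_tonelli2_on lebesgue_measure mI mD (mg x) (g0 x)).
- by apply: (measurable_fun_section2 mD mD _ mV); exact/inD.
- move=> y /inD Ky.
  under eq_integral do rewrite -EFinM -expRD -opprD -mulrDl.
  by apply: integral_expR_le; apply: addr_gt0; exact: lt_le_trans K0 _.
Qed.

Section matrix_laplace.
Variables (d : nat) (M : R -> 'M[R]_d).
Hypothesis mM : mx_measurable (`[0, +oo[ : set R) M.
Variable c : R.
Hypothesis Mc : forall rho : R, 0 <= rho -> fnorm (M rho) <= c.

(** The choices [[0, +oo[], [[0, K[] and [[K, +oo[] of [D] give the full kernel, the truncated
    kernel and the tail. *)
Definition mxlap (D : set mR) (t : R) : 'M[R]_d :=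
  \matrix_(i, j) \int[lam]_(rho in D) (expR (- (rho * t)) * M rho i j).

Lemma measurable_mxlap (D : set mR) (E : set R) : measurable D ->
  D `<=` `[0, +oo[ -> mx_measurable E (mxlap D).
Proof.
move=> mD D0 i j; under eq_fun do rewrite mxE.
apply: measurable_funTS.
apply: (@measurable_Rintegral_param _ _ mR mR lam setT D
  (fun z : mR * mR => expR (- (z.2 * z.1)) * M z.2 i j)) => //.
apply: measurable_funM.
  apply: measurable_funTS; apply: measurableT_comp => //.
  exact/measurable_funN/measurable_funM.
have : measurable_fun D (fun rho => M rho i j : R).
  by apply: measurable_funS D0 (mM i j) => //; exact: measurable_itv.
move/(measurable_restrictT _ mD) => mMD; apply/measurable_restrictT.
  exact: measurableX.
rewrite (_ : _ \_ _ = ((fun rho => M rho i j : R) \_ D) \o snd).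
  exact: (measurableT_comp mMD).
by apply/funext => z; rewrite /= !patchE in_setX/= in_setT.
Qed.

Section bounds.
Variables (D : set mR) (t : R).
Hypotheses (mD : measurable D) (D0 : D `<=` `[0, +oo[).
Hypothesis fin : (laplace D t < +oo)%E.

Let integrable_exp : lam.-integrable D (fun rho : mR => (expR (- (rho * t)))%:E).
Proof.
apply/integrableP; split; first exact: measurable_expRMr.
by under eq_integral do rewrite gee0_abs ?lee_fin ?expR_ge0//.
Qed.

Let Mbound (rho : R) i j : D rho -> `|M rho i j| <= c.
Proof.
move=> /D0; rewrite /= in_itv/= andbT => rho0.
exact: le_trans (fnorm_entry _ _ _) (Mc rho0).
Qed.

Lemma integrable_mxlap i j :
  lam.-integrable D (EFin \o (fun rho : mR => expR (- (rho * t)) * M rho i j)).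
Proof.
have := integrableZl mD c integrable_exp; apply: le_integrable => //.
  apply/measurable_EFinP; apply: measurable_funM.
    by apply/measurable_EFinP; exact: measurable_expRMr.
  by apply: measurable_funS D0 (mM i j) => //; exact: measurable_itv.
move=> rho Drho; have c0 : 0 <= c := le_trans (normr_ge0 _) (Mbound i j Drho).
rewrite /= lee_fin !normrM (ger0_norm c0) ger0_norm ?expR_ge0// mulrC.
by rewrite ler_wpM2r ?expR_ge0// Mbound.
Qed.

(** Each entry is at most [c] times the scalar transform, and there are [d * d] entries. *)
Lemma fnorm_mxlap_sqr : ((fnorm (mxlap D t) ^+ 2)%:E <=
  ((d * d)%:R * c ^+ 2)%:E * (laplace D t * laplace D t))%E.
Proof.
have lapE : laplace D t = (\int[lam]_(rho in D) expR (- (rho * t)))%:E.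
  by rewrite /laplace EFin_Rintegral.
rewrite lapE -!EFinM lee_fin fnorm_sqr.
set l := \int[lam]_(_ in D) _.
have entry i j : mxlap D t i j ^+ 2 <= c ^+ 2 * (l * l).
  rewrite mxE -expr2 -exprMn -[leLHS]real_normK ?num_real//.
  have H : `|\int[lam]_(rho in D) (expR (- (rho * t)) * M rho i j)| <= c * l.
    apply: le_trans (le_normr_Rintegral mD (integrable_mxlap i j)) _.
    rewrite /l -RintegralZl//; apply: le_Rintegral => //.
    - exact: (integrable_norm (integrable_mxlap i j)).
    - exact: integrableZ_EFin.
    move=> rho Drho; rewrite normrM ger0_norm ?expR_ge0// mulrC.
    by rewrite ler_wpM2r ?expR_ge0// Mbound.
  by rewrite lerXn2r// nnegrE// (le_trans _ H).
apply: (@le_trans _ _ (\sum_(i < d) \sum_(j < d) c ^+ 2 * (l * l))).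
  by apply: ler_sum => i _; exact: ler_sum.
move: (c ^+ 2) (l * l) => u v.
by rewrite !sumr_const !card_ord -mulrnA -mulrA mulr_natl.
Qed.

End bounds.

(** Splitting the integral at [K] requires integrability, hence the finiteness condition, which may
    fail at [t = 0]. *)
Lemma mxlap_tail (K t : R) : 0 < K -> (laplace `[0%R, +oo[ t < +oo)%E ->
  mxlap `[0, +oo[ t - mxlap `[0, K[ t = mxlap `[K, +oo[ t.
Proof.
move=> K0 fin; apply/matrixP => i j; rewrite !mxE.
have := integrable_mxlap (measurable_itv _) (@subset_refl _ _) fin i j.
rewrite (_ : `[0, +oo[%classic = `[0, K[ `|` `[K, +oo[ :> set mR); last first.
  by rewrite -itv_bndbnd_setU// bnd_simp ltW.
move=> intf; rewrite Rintegral_setU//; first by rewrite addrC addKr.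
rewrite disj_set2E; apply/eqP/seteqP; split => // x [] /=.
by rewrite !in_itv/= andbT => /andP[_ xK]; rewrite leNgt xK.
Qed.

End matrix_laplace.

End laplace.
End kernels.

(** The comparison is asked for on []0, t]] only: at 0 the kernels may come from divergent
    integrals, and a point is null. *)
Lemma le_integral_oc (R : realType) (t : R) (f g : R -> \bar R) :
  measurable_fun (`[0, t] : set (measurableTypeR R)) f ->
  measurable_fun (`[0, t] : set (measurableTypeR R)) g ->
  (forall s : R, 0 < s <= t -> (0 <= f s)%E) ->
  (forall s : R, 0 < s <= t -> (f s <= g s)%E) ->
  (\int[lebesgue_measure]_(s in `[0%R, t]) f s <=
   \int[lebesgue_measure]_(s in `[0%R, t]) g s)%E.
Proof.
move=> mf mg f0 fg.
have sub : (`]0, t] : set (measurableTypeR R)) `<=` `[0, t].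
  by move=> s /=; rewrite !in_itv/= => /andP[/ltW -> ->].
have mS h : measurable_fun (`[0, t] : set (measurableTypeR R)) h ->
    measurable_fun (`]0, t] : set (measurableTypeR R)) (h : R -> \bar R).
  exact: measurable_funS.
rewrite -integral_itv_obnd_cbnd; last exact: mS.
rewrite -[leRHS]integral_itv_obnd_cbnd; last exact: mS.
by apply: ge0_le_integral => //; exact: mS.
Qed.

(** Mirror image of [le_integral_oc], for kernels evaluated at [t - s], where the exceptional time
    is [s = t]. *)
Lemma le_integral_co (R : realType) (t : R) (f g : R -> \bar R) :
  measurable_fun (`[0, t] : set (measurableTypeR R)) f ->
  measurable_fun (`[0, t] : set (measurableTypeR R)) g ->
  (forall s : R, 0 <= s < t -> (0 <= f s)%E) ->
  (forall s : R, 0 <= s < t -> (f s <= g s)%E) ->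
  (\int[lebesgue_measure]_(s in `[0%R, t]) f s <=
   \int[lebesgue_measure]_(s in `[0%R, t]) g s)%E.
Proof.
move=> mf mg f0 fg.
have sub : (`[0, t[ : set (measurableTypeR R)) `<=` `[0, t].
  by move=> s /=; rewrite !in_itv/= => /andP[-> /ltW ->].
have mS h : measurable_fun (`[0, t] : set (measurableTypeR R)) h ->
    measurable_fun (`[0, t[ : set (measurableTypeR R)) (h : R -> \bar R).
  exact: measurable_funS.
rewrite -integral_itv_bndo_bndc; last exact: mS.
rewrite -[leRHS]integral_itv_bndo_bndc; last exact: mS.
by apply: ge0_le_integral => //; exact: mS.
Qed.

(** * Kernel errors, and kernel bounds uniform in K *)

Section kernel_approximation.
Context (R : realType) (lam : {sigma_finite_measure set (measurableTypeR R) -> \bar R}).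
Hypothesis lamfin : forall t : R, 0 < t -> (laplace lam `[0%R, +oo[ t < +oo)%E.
Context (d : nat) (M : R -> 'M[R]_d).
Hypothesis mM : mx_measurable (`[0, +oo[ : set R) M.
Variable c : R.
Hypothesis Mc : forall rho : R, 0 <= rho -> fnorm (M rho) <= c.
Variables (K : R) (Gh : R -> 'M[R]_d).
Hypothesis K0 : 0 < K.
Local Notation mR := (measurableTypeR R).
Local Notation A := ((d * d)%:R * c ^+ 2).

Let A0 : 0 <= A. Proof. exact: mulr_ge0 (ler0n _ _) (sqr_ge0 c). Qed.

Lemma laplace_sub (D : set mR) (t : R) : measurable D -> D `<=` `[0, +oo[ ->
  (laplace lam D t <= laplace lam `[0%R, +oo[ t)%E.
Proof.
move=> mD D0; apply: ge0_subset_integral => //; exact: measurable_expRMr.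
Qed.

Let subK : (`[K, +oo[ : set mR) `<=` `[0, +oo[.
Proof. by move=> x /=; rewrite !in_itv/= !andbT; apply: le_trans; exact: ltW. Qed.

Let sub0K : (`[0, K[ : set mR) `<=` `[0, +oo[.
Proof. by move=> x /=; rewrite !in_itv/= => /andP[->]. Qed.

Lemma integral_kernel_error (t : R) :
  mx_measurable (`[0, t] : set R) Gh ->
  (\int[lebesgue_measure]_(s in `[0%R, t])
     (fnorm (mxlap lam M `[0%R, +oo[ s - Gh s) ^+ 2)%:E <=
   (2 * A)%:E * tail_r lam K + 2%:E * \int[lebesgue_measure]_(s in `[0%R, t])
     (fnorm (Gh s - mxlap lam M `[0%R, K[ s) ^+ 2)%:E)%E.
Proof.
move=> mGh.
have mI : measurable (`[0, t] : set mR) by exact: measurable_itv.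
have mlap (D : set mR) : measurable D -> D `<=` `[0, +oo[ ->
    mx_measurable (`[0, t] : set R) (mxlap lam M D).
  exact: measurable_mxlap.
have mG := mlap _ (measurable_itv _) (@subset_refl _ _).
have mT := mlap _ (measurable_itv _) sub0K.
have mlapK := measurable_laplace lam (E := `[0, t]%classic) (measurable_itv `[K, +oo[).
have m1 : measurable_fun (`[0, t] : set mR)
    (fun s => (laplace lam `[K, +oo[ s * laplace lam `[K, +oo[ s)%E).
  exact: emeasurable_funM.
have m2 : measurable_fun (`[0, t] : set mR)
    (fun s => (fnorm (Gh s - mxlap lam M `[0, K[ s) ^+ 2)%:E).
  by apply/measurable_EFinP; apply: measurable_fnorm_sqr; exact: mx_measurableB.
have A20 : 0 <= 2 * A := mulr_ge0 (ler0n _ 2) A0.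
have n0 s : `[0, t]%classic s -> (0 <= (fnorm (Gh s - mxlap lam M `[0, K[ s) ^+ 2)%:E)%E.
  by move=> _; rewrite lee_fin sqr_ge0.
have l0 s : `[0, t]%classic s -> (0 <= laplace lam `[K, +oo[ s * laplace lam `[K, +oo[ s)%E.
  by move=> _; rewrite mule_ge0// laplace_ge0.
apply: (@le_trans _ _ (\int[lebesgue_measure]_(s in `[0%R, t])
    ((2 * A)%:E * (laplace lam `[K, +oo[ s * laplace lam `[K, +oo[ s) +
     2%:E * (fnorm (Gh s - mxlap lam M `[0%R, K[ s) ^+ 2)%:E))%E).
  apply: le_integral_oc.
  - by apply/measurable_EFinP; apply: measurable_fnorm_sqr; exact: mx_measurableB.
  - by apply: emeasurable_funD; exact: measurable_funeM.
  - by move=> s _; rewrite lee_fin sqr_ge0.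
  move=> s /andP[s0 st].
  have fin0 := lamfin s0.
  have finK : (laplace lam `[K, +oo[ s < +oo)%E.
    by apply: le_lt_trans fin0; exact: laplace_sub.
  have h1 := fnorm_mxlap_sqr mM Mc (measurable_itv _) subK finK.
  apply: (@le_trans _ _ (2%:E * (fnorm (mxlap lam M `[K, +oo[ s) ^+ 2)%:E +
     2%:E * (fnorm (Gh s - mxlap lam M `[0%R, K[ s) ^+ 2)%:E)%E).
    rewrite -!EFinM -EFinD lee_fin (fnormB (Gh s)).
    rewrite (_ : _ - Gh s = mxlap lam M `[K, +oo[ s + (mxlap lam M `[0, K[ s - Gh s)).
      exact: fnorm_sqrD.
    by rewrite -(mxlap_tail mM Mc K0 fin0) addrA subrK.
  by apply: leeD; [rewrite [(2 * A)%:E]EFinM -muleA lee_pmul2l|exact: lexx].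
rewrite ge0_integralD//; first last.
- exact: measurable_funeM.
- by move=> s /n0 ?; rewrite mule_ge0.
- exact: measurable_funeM.
- by move=> s /l0 ?; rewrite mule_ge0 ?lee_fin.
rewrite (ge0_integralZl _ mI m1 l0); last by rewrite lee_fin.
rewrite (ge0_integralZl _ mI m2 n0)//.
by apply: leeD; [rewrite lee_wpmul2l ?lee_fin//; exact: integral_laplace_sqr|exact: lexx].
Qed.

(** The truncated scalar transform is at most the full one, so [K] does not appear in the bound. *)
Lemma kernel_approximation_le (s D : R) : 0 < s ->
  fnorm (Gh s - mxlap lam M `[0, K[ s) <= D ->
  fnorm (Gh s) ^+ 2 <= 2 * A * fine (laplace lam `[0%R, +oo[ s) ^+ 2 + 2 * D ^+ 2.
Proof.
move=> s0 hD; have fin0 := lamfin s0.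
have lap0 := laplace_ge0 lam `[0%R, +oo[ s.
have finK : (laplace lam `[0%R, K[ s < +oo)%E.
  by apply: le_lt_trans fin0; exact: laplace_sub.
have lapK0 := laplace_ge0 lam `[0%R, K[ s.
have h1 := fnorm_mxlap_sqr mM Mc (measurable_itv _) sub0K finK.
have h2 : fine (laplace lam `[0%R, K[ s) <= fine (laplace lam `[0%R, +oo[ s).
  by apply: fine_le; rewrite ?ge0_fin_numE//; exact: laplace_sub.
have D0 : 0 <= D := le_trans (fnorm_ge0 _) hD.
have h3 : fnorm (mxlap lam M `[0, K[ s) ^+ 2 <= A * fine (laplace lam `[0%R, +oo[ s) ^+ 2.
  move: h1; rewrite -(@fineK _ (laplace lam `[0%R, K[ s)) ?ge0_fin_numE//.
  rewrite -!EFinM lee_fin -expr2 => /le_trans; apply.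
  by rewrite ler_wpM2l// lerXn2r// nnegrE fine_ge0.
have h4 : fnorm (Gh s - mxlap lam M `[0, K[ s) ^+ 2 <= D ^+ 2.
  by rewrite lerXn2r// nnegrE fnorm_ge0.
have := fnorm_sqrD (mxlap lam M `[0, K[ s) (Gh s - mxlap lam M `[0, K[ s).
by rewrite [X in fnorm X ^+ 2 <= _]addrC subrK => h5; lra.
Qed.

Lemma mxlap_le (s : R) : 0 < s ->
  fnorm (mxlap lam M `[0%R, +oo[ s) ^+ 2 <= A * fine (laplace lam `[0%R, +oo[ s) ^+ 2.
Proof.
move=> s0; have fin0 := lamfin s0.
have lap0 := laplace_ge0 lam `[0%R, +oo[ s.
have := fnorm_mxlap_sqr mM Mc (measurable_itv _) (@subset_refl _ _) fin0.
rewrite -(@fineK _ (laplace lam `[0%R, +oo[ s)) ?ge0_fin_numE//.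
Qed.

End kernel_approximation.

(** * Measurability of compositions with Lipschitz maps *)

Lemma fnorm_le_sum (R : realType) (d : nat) (x : 'cV[R]_d) :
  fnorm x <= \sum_i `|x i ord0|.
Proof.
have s0 : 0 <= \sum_i `|x i ord0| by exact: sumr_ge0.
rewrite -(@ler_pXn2r _ 2)// ?nnegrE ?fnorm_ge0//.
rewrite fnorm_sqr expr2 mulr_suml; apply: ler_sum => i _; rewrite big_ord1.
rewrite -(real_normK (num_real (x i ord0))) expr2 ler_wpM2l//.
by rewrite (bigD1 i)//= lerDl sumr_ge0.
Qed.

(* A Lipschitz function is the supremum over rational q of the functions
   f q - L * |x - q|, each of which is measurable. *)
Lemma measurable_lipschitz_comp (R : realType) (d : nat) (L : R)
    (f : 'cV[R]_d -> R) d' (T : measurableType d') (D : set T) (Y : T -> 'cV[R]_d) :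
  0 <= L -> (forall x y, `|f x - f y| <= L * fnorm (x - y)) ->
  mx_measurable D Y -> measurable_fun D (fun w => f (Y w)).
Proof.
move=> L0 Lf mY mD; apply: (measurability _ (RGenOInfty.measurableE R)) => //.
move=> /= _ [_ [a ->] <-].
pose r (q : 'cV[rat]_d) : 'cV[R]_d := map_mx ratr q.
pose g q w := f (r q) - L * \sum_i `|Y w i ord0 - r q i ord0|.
have mg q : measurable_fun D (g q).
  apply: measurable_funB => //; apply: measurable_funM => //.
  apply: measurable_sum => i; apply: measurableT_comp => //.
  by apply: measurable_funB => //; exact: mY.
rewrite (_ : _ `&` _ = \bigcup_q (D `&` (g q @^-1` `]a, +oo[))).
  apply: countable_bigcupT_measurable; first exact: countableP.
  by move=> q; exact: mg.
have subE w q i : (Y w - r q) i ord0 = Y w i ord0 - r q i ord0 by rewrite !mxE.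
have sumE w q : \sum_i `|(Y w - r q) i ord0| = \sum_i `|Y w i ord0 - r q i ord0|.
  by apply: eq_bigr => i _; rewrite subE.
apply/seteqP; split => w /=; last first.
  move=> [q _ [Dw]]; rewrite /= !in_itv/= !andbT => agq; split => //.
  apply: (lt_le_trans agq); rewrite lerBlDr.
  have := ler_norm (f (r q) - f (Y w)); have := Lf (Y w) (r q).
  rewrite distrC; have := ler_wpM2l L0 (fnorm_le_sum (Y w - r q)).
  by rewrite sumE; lra.
rewrite in_itv/= andbT => -[Dw aY].
(* If all coordinates of [q] are within [e] of those of [Y w], then [g q w] is at least
   [f (Y w) - 2 * L * d * e], which exceeds [a]. The [+ 1] keeps the denominator positive when [L]
   or [d] is 0. *)
pose e := (f (Y w) - a) / (2 * L * d%:R + 1).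
have k0 : 0 < 2 * L * d%:R + 1 by rewrite ltr_wpDl// !mulr_ge0.
have e0 : 0 < e by rewrite divr_gt0// subr_gt0.
have /choice[q hq] : forall i : 'I_d, exists q : rat, `|Y w i ord0 - ratr q| <= e.
  move=> i; have : Y w i ord0 - e < Y w i ord0 + e by lra.
  move=> /rat_in_itvoo[q]; rewrite in_itv/= => /andP[h1 h2]; exists q.
  by rewrite ler_norml; apply/andP; split; lra.
exists (\col_i q i) => //; split => //; rewrite /= in_itv/= andbT /g.
set s := \sum_i _.
have se : s <= d%:R * e.
  rewrite /s -[X in X%:R * _]card_ord mulr_natl -sumr_const; apply: ler_sum => i _.
  by rewrite !mxE; exact: hq.
have := ler_norm (f (Y w) - f (r (\col_i q i))).
have := Lf (Y w) (r (\col_i q i)).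
have := ler_wpM2l L0 (fnorm_le_sum (Y w - r (\col_i q i))); rewrite sumE -/s.
have := ler_wpM2l L0 se.
have : e * (2 * L * d%:R + 1) = f (Y w) - a by rewrite divfK// gt_eqF.
by nra.
Qed.

(** * Gronwall inequality for convolutions *)

Section gronwall.
Variables (R : realType) (T : R) (q : R -> R).
Hypotheses (T0 : 0 <= T) (mq : measurable_fun (`[0, T] : set R) q).
Hypothesis q0 : forall s : R, 0 <= s <= T -> 0 <= q s.
Hypothesis qfin : (\int[lebesgue_measure]_(s in `[0%R, T]) (q s)%:E < +oo)%E.

Let intq : lebesgue_measure.-integrable (`[0, T] : set R) (EFin \o q).
Proof.
apply/integrableP; split; first exact/measurable_EFinP.
rewrite (_ : integral _ _ _ = \int[lebesgue_measure]_(s in `[0%R, T]) (q s)%:E)%E//.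
apply: eq_integral => s; rewrite inE/= in_itv/= => sT.
by rewrite ger0_norm// q0.
Qed.

(* The weight [expR (- n s)] makes the convolution with [q] a contraction by 1/2
   for the weighted supremum norm. *)
Lemma weighted_kernel_small : exists n : nat,
  (\int[lebesgue_measure]_(s in `[0%R, T]) (q s * expR (- (n%:R * s)))%:E <=
   (2^-1)%:E)%E.
Proof.
have m n : measurable_fun (`[0, T] : set R) (fun s => q s * expR (- (n%:R * s))).
  apply: measurable_funM => //; apply: measurable_funTS.
  apply: measurableT_comp => //; apply: measurable_funN; exact: measurable_funM.
have sub : (`]0, T] : set (measurableTypeR R)) `<=` `[0, T].
  by move=> s /=; rewrite !in_itv/= => /andP[/ltW -> ->].
(* Time 0 is left out because the weight stays equal to 1 there; on []0, T]] it decreases to 0 and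
   [q] dominates. *)
have cv : (\int[lebesgue_measure]_(s in `]0%R, T]) (q s * expR (- (n%:R * s)))%:E
    @[n --> \oo] --> \int[lebesgue_measure]_(s in `]0%R, T]) (cst 0 s))%E.
  apply: (@dominated_cvg _ (measurableTypeR R) R lebesgue_measure `]0, T]%classic _
    (fun n s => (q s * expR (- (n%:R * s)))%:E) (cst 0%E) (EFin \o q)) => //.
  - by move=> n; apply/measurable_EFinP; exact: measurable_funS sub (m n).
  - move=> s; rewrite /= in_itv/= => /andP[s0 _].
    apply/fine_cvgP; split; first exact: nearW.
    rewrite (_ : fine \o _ = fun n => q s * expR (- s) ^+ n); last first.
      by apply/funext => n /=; rewrite -expRM_natl mulrN.
    rewrite -[X in _ --> X](mulr0 (q s)); apply: cvgM; first exact: cvg_cst.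
    apply: cvg_expr.
    by rewrite ger0_norm ?expR_ge0// expR_lt1 oppr_lt0.
  - by apply: integrableS intq.
  - move=> n s; rewrite /= in_itv/= => /andP[s0 sT].
    have qs : 0 <= q s by rewrite q0// (ltW s0).
    rewrite lee_fin ger0_norm ?mulr_ge0 ?expR_ge0// ler_piMr//.
    by rewrite -expR0 ler_expR oppr_le0 mulr_ge0// ltW.
rewrite integral0 in cv.
have /fine_cvgP[finN cvN] := cv.
have h2 : 0 < (2^-1 : R) by rewrite invr_gt0.
move/cvgrPdist_le : cvN => /(_ _ h2) nearN.
have [n [fn]] := filter_ex (filterI finN nearN); rewrite /= sub0r normrN => hn.
exists n; rewrite -integral_itv_obnd_cbnd; last first.
  by apply/measurable_EFinP; exact: measurable_funS sub (m n).
rewrite -(fineK fn) lee_fin; exact: le_trans (ler_norm _) hn.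
Qed.

(** [C] is chosen before [f], [a] and [B]. The bound [B] makes the weighted supremum finite and does
    not enter [C], which is essential since in the application [B] depends on the approximate
    solution. *)
Lemma gronwall_convolution : exists2 C : R, 0 < C &
  forall (f a : R -> R) (B : R),
    measurable_fun (`[0, T] : set R) f ->
    (forall s : R, 0 <= s <= T -> 0 <= f s <= B) ->
    (forall s : R, 0 <= s <= T -> 0 <= a s) ->
    (forall s t : R, 0 <= s -> s <= t -> t <= T -> a s <= a t) ->
    (forall t : R, 0 <= t <= T -> ((f t)%:E <= (a t)%:E +
       \int[lebesgue_measure]_(s in `[0%R, t]) (q (t - s) * f s)%:E)%E) ->
    forall t : R, 0 <= t <= T -> f t <= C * a t.
Proof.
have [n hn] := weighted_kernel_small.
exists (2 * expR (n%:R * T)); first by rewrite mulr_gt0// expR_gt0.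
move=> f a B mf fB a0 a_nd fle t /andP[t0 tT].
(* The supremum is over [[0, t]] and not [[0, T]], so that monotonicity of [a] yields a bound by
   [a t]. *)
pose E := [set expR (- (n%:R * s)) * f s | s in `[0, t]].
have E0 : E !=set0 by exists (expR (- (n%:R * 0)) * f 0), 0 => //=; rewrite in_itv/= lexx.
have le1 (s : R) : 0 <= s -> expR (- (n%:R * s)) <= 1.
  by move=> s0; rewrite -expR0 ler_expR oppr_le0 mulr_ge0.
have inT s : s \in `[0, t] -> 0 <= s <= T.
  by rewrite in_itv/= => /andP[-> st]; exact: le_trans tT.
have Eub : has_ubound E.
  exists B => _ [s /inT sT <-]; have /andP[f0 fB'] := fB s sT.
  apply: le_trans fB'; rewrite ler_piMl//; apply: le1.
  by case/andP : sT.
set m := sup E.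
have mE s : s \in `[0, t] -> f s <= expR (n%:R * s) * m.
  move=> st; rewrite -ler_pdivrMl ?expR_gt0// -expRN.
  by apply: ub_le_sup => //; exists s.
have m0 : 0 <= m.
  have := mE 0; rewrite in_itv/= lexx t0 => /(_ isT); rewrite mulr0 expR0 mul1r.
  by apply: le_trans; have /andP[] : 0 <= f 0 <= B by rewrite fB ?lexx.
have step s : s \in `[0, t] -> expR (- (n%:R * s)) * f s <= a t + m / 2.
  move=> st; have sT := inT s st; have /andP[s0 sT'] := sT.
  have s_le_t : s <= t by move: st; rewrite in_itv/= => /andP[].
  have subs (u : R) : 0 <= u <= s -> 0 <= u <= T.
    by move=> /andP[-> us]; exact: le_trans us sT'.
  have sub : (`[0, s] : set (measurableTypeR R)) `<=` `[0, T].
    by move=> u /=; rewrite !in_itv/=; exact: subs.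
  have refl u : u \in `[0, s] -> 0 <= s - u <= T.
    rewrite in_itv/= => /andP[u0 us]; rewrite subr_ge0 us/=.
    by apply: le_trans sT'; rewrite lerBlDr lerDl.
  have mr : measurable_fun (`[0, s] : set R) (fun u => q (s - u)).
    apply: (measurable_comp (F := (`[0, T] : set R))) => //.
      move=> _ [u us <-]; rewrite /= in_itv/=; exact: refl.
    by apply: measurable_funTS; exact: measurable_funB.
  have mfs : measurable_fun (`[0, s] : set R) f by exact: measurable_funS sub mf.
  have mw : measurable_fun (`[0, T] : set R) (fun s => q s * expR (- (n%:R * s))).
    apply: measurable_funM => //; apply: measurable_funTS.
    apply: measurableT_comp => //; apply: measurable_funN; exact: measurable_funM.
  have mws : measurable_fun (`[0, s] : set R) (fun u => q u * expR (- (n%:R * u))).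
    exact: measurable_funS sub mw.
  have mwr : measurable_fun (`[0, s] : set R)
      (fun u => q (s - u) * expR (- (n%:R * (s - u)))).
    apply: measurable_funM => //; apply: measurable_funTS.
    apply: measurableT_comp => //; apply: measurable_funN; apply: measurable_funM => //.
    exact: measurable_funB.
  have bound : (\int[lebesgue_measure]_(u in `[0%R, s]) (q (s - u) * f u)%:E <=
      (m * expR (n%:R * s) / 2)%:E)%E.
    apply: (@le_trans _ _ (\int[lebesgue_measure]_(u in `[0%R, s])
      ((m * expR (n%:R * s))%:E * (q (s - u) * expR (- (n%:R * (s - u))))%:E))%E).
      apply: ge0_le_integral => //.
      - move=> u; rewrite /= => us; rewrite lee_fin mulr_ge0 ?q0 ?refl//.
        by have /andP[] := fB u (subs u us).
      - exact/measurable_EFinP/measurable_funM.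
      - by apply: measurable_funeM; exact/measurable_EFinP.
      move=> u us; rewrite -EFinM lee_fin.
      have ut : u \in `[0, t].
        move: us; rewrite /= !in_itv/= => /andP[-> us]; exact: le_trans us s_le_t.
      have := ler_wpM2l (q0 (refl u us)) (mE u ut).
      (* The factor at [s] cancels against the weight in [step]; the other one turns [q (s - u)]
         into the reflected weighted kernel, of mass at most 1/2. *)
      have -> : expR (n%:R * u) = expR (n%:R * s) * expR (- (n%:R * (s - u))).
        by rewrite -expRD; congr expR; ring.
      by rewrite !mulrA => /le_trans; apply; rewrite le_eqVlt; apply/orP; left; apply/eqP; ring.
    rewrite ge0_integralZl//; first last.
    - by rewrite lee_fin mulr_ge0// expR_ge0.
    - by move=> u us; rewrite lee_fin mulr_ge0 ?expR_ge0// q0// refl.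
    - exact/measurable_EFinP.
    rewrite (ge0_integral_reflect (f := fun u => (q u * expR (- (n%:R * u)))%:E)); first last.
    - by move=> u us; rewrite lee_fin mulr_ge0 ?expR_ge0// q0// subs.
    - exact/measurable_EFinP.
    rewrite [leRHS]EFinM lee_wpmul2l ?lee_fin ?mulr_ge0 ?expR_ge0//.
    apply: le_trans hn; apply: ge0_subset_integral => //.
    - exact/measurable_EFinP.
    - by move=> u uT; rewrite lee_fin mulr_ge0 ?expR_ge0// q0.
  have := le_trans (fle s sT) (leeD2l _ bound); rewrite -EFinD lee_fin => h.
  have := ler_wpM2l (expR_ge0 (- (n%:R * s))) h => /le_trans; apply.
  rewrite mulrDr; apply: lerD.
    apply: le_trans (a_nd s t s0 s_le_t tT); rewrite ler_piMl ?le1//.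
    exact: a0.
  rewrite mulrA mulrCA expRN mulrA mulrVK//; last by rewrite unitfE gt_eqF// expR_gt0.
(* [m] is a real number, so [m / 2] can be absorbed; this is the origin of the factor 2 in [C]. *)
have mle : m <= a t + m / 2 by apply: ge_sup => // _ [s st <-]; exact: step.
have mle2 : m <= 2 * a t by lra.
have tt : t \in `[0, t] by rewrite in_itv/= t0 lexx.
apply: le_trans (mE t tt) _; rewrite mulrAC mulrC.
by apply: ler_pM; rewrite ?expR_ge0// ler_expR ler_wpM2l.
Qed.

End gronwall.

(** * Stability of Volterra equations *)

Section volterra_coefficient.
Context (R : realType) (disp : measure_display) (Omega : measurableType disp).
Context (P : probability Omega R) (d n : nat) (T : R).
Variables (beta : 'cV[R]_d -> 'M[R]_(d, n)) (L : R).
Hypotheses (L0 : 0 <= L)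
  (Lbeta : forall x y, fnorm (beta x - beta y) <= L * fnorm (x - y)).
Local Notation mR := (measurableTypeR R).
Notation Q t := (`[0, t] `*` [set: Omega]).

Lemma mx_measurable_itvS (m p : nat) (f : R -> Omega -> 'M[R]_(m, p)) (t : R) :
  t <= T -> mx_measurable (Q T) (fun z : R * Omega => f z.1 z.2) ->
  mx_measurable (Q t) (fun z : R * Omega => f z.1 z.2).
Proof.
move=> tT mf i j; apply: measurable_funS (mf i j).
  by apply: measurableX => //; exact: measurable_itv.
move=> z [/= + _]; rewrite in_itv/= => /andP[z0 zt]; split => //=.
by rewrite in_itv/= z0; exact: le_trans tT.
Qed.

Lemma mx_measurable_lipschitz d' (S : measurableType d') (D : set S) (Z : S -> 'cV[R]_d) :
  mx_measurable D Z -> mx_measurable D (fun z => beta (Z z)).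
Proof.
move=> mZ i j; apply: (measurable_lipschitz_comp (f := fun x => beta x i j) L0) => //.
move=> x y; apply: le_trans (Lbeta x y); apply: le_trans (fnorm_entry _ i j).
by rewrite !mxE.
Qed.

Lemma mx_measurable_reflect (m p : nat) (G : R -> 'M[R]_(m, p)) (t : R) :
  t <= T -> mx_measurable (`[0, T] : set R) G ->
  mx_measurable (`[0, t] : set R) (fun s => G (t - s)).
Proof.
move=> tT mG i j; apply: (measurable_comp (F := (`[0, T] : set R))) (mG i j) _ => //.
  move=> _ [s + <-]; rewrite /= !in_itv/= => /andP[s0 st].
  by rewrite subr_ge0 st/= (le_trans _ tT)// lerBlDr lerDl.
by apply: measurable_funTS; exact: measurable_funB.
Qed.

Lemma mx_measurable_fst (m p : nat) (G : R -> 'M[R]_(m, p)) (t : R) :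
  mx_measurable (`[0, t] : set R) G ->
  mx_measurable (Q t) (fun z : R * Omega => G z.1).
Proof.
move=> mG i j; apply: (measurable_comp (F := (`[0, t] : set R))) (mG i j) _ => //.
  by move=> _ [z [zt _] <-].
exact: measurable_funTS.
Qed.

Lemma mx_measurable_integrand (G : R -> 'M[R]_d) (X : R -> Omega -> 'cV[R]_d) (t : R) :
  t <= T -> mx_measurable (`[0, T] : set R) G ->
  mx_measurable (Q T) (fun z : R * Omega => X z.1 z.2) ->
  mx_measurable (Q t) (fun z : R * Omega => G (t - z.1) *m beta (X z.1 z.2)).
Proof.
move=> tT mG mX; apply: mx_measurableM.
  apply: (mx_measurable_fst (G := fun s => G (t - s))).
  exact: mx_measurable_reflect.
by apply: mx_measurable_lipschitz; exact: mx_measurable_itvS.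
Qed.

Definition msd (X Y : R -> Omega -> 'cV[R]_d) (s : R) : \bar R :=
  (\int[P]_w (fnorm (X s w - Y s w) ^+ 2)%:E)%E.

Lemma msd_ge0 X Y s : (0 <= msd X Y s)%E.
Proof. by apply: integral_ge0 => w _; rewrite lee_fin sqr_ge0. Qed.

Lemma measurable_msd X Y (t : R) : t <= T ->
  mx_measurable (Q T) (fun z : R * Omega => X z.1 z.2) ->
  mx_measurable (Q T) (fun z : R * Omega => Y z.1 z.2) ->
  measurable_fun (`[0, t] : set (measurableTypeR R)) (msd X Y).
Proof.
move=> tT mX mY; apply: (measurable_tonelli1_on (T1 := measurableTypeR R) P
  (measurable_itv _) measurableT
  (f := fun z => (fnorm (X z.1 z.2 - Y z.1 z.2) ^+ 2)%:E)).
  by apply: measurable_fnorm_sqrB; exact: mx_measurable_itvS.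
by move=> z _; rewrite lee_fin sqr_ge0.
Qed.

(** The difference is [(G - H) *m beta X + H *m (beta X - beta Y)]: the kernel error multiplies
    [beta X] alone, so no moment bound on [Y] enters. The drift is the case [n = 1] and the
    diffusion the case [n = d]. *)
Lemma volterra_coefficient_estimate (X Y : R -> Omega -> 'cV[R]_d)
    (G H : R -> 'M[R]_d) (B t : R) : 0 <= t <= T ->
  mx_measurable (Q T) (fun z : R * Omega => X z.1 z.2) ->
  mx_measurable (Q T) (fun z : R * Omega => Y z.1 z.2) ->
  mx_measurable (`[0, T] : set R) G -> mx_measurable (`[0, T] : set R) H ->
  (forall s : R, 0 <= s <= T -> (\int[P]_w (fnorm (beta (X s w)) ^+ 2)%:E <= B%:E)%E) ->
  (L2dist P t (fun s w => G (t - s)%R *m beta (X s w))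
              (fun s w => H (t - s)%R *m beta (Y s w)) <=
   (2 * B)%:E * \int[lebesgue_measure]_(s in `[0%R, t]) (fnorm (G s - H s) ^+ 2)%:E +
   (2 * L ^+ 2)%:E * \int[lebesgue_measure]_(s in `[0%R, t])
      ((fnorm (H (t - s)%R) ^+ 2)%:E * msd X Y s))%E.
Proof.
move=> /andP[t0 tT] mX mY mG mH XB.
have mI : measurable (`[0, t] : set mR) by exact: measurable_itv.
have L20 : 0 <= 2 * L ^+ 2 := mulr_ge0 (ler0n _ 2) (sqr_ge0 L).
have B0 : 0 <= B.
  have := XB 0; rewrite lexx (le_trans t0 tT) => /(_ isT); rewrite -lee_fin.
  by apply: le_trans; apply: integral_ge0 => w _; rewrite lee_fin sqr_ge0.
have B20 : 0 <= 2 * B := mulr_ge0 (ler0n _ 2) B0.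
have mGX := mx_measurable_integrand tT mG mX.
have mHY := mx_measurable_integrand tT mH mY.
have mGXHY := measurable_fnorm_sqrB (f := fun s w => G (t - s) *m beta (X s w))
  (g := fun s w => H (t - s) *m beta (Y s w)) mGX mHY.
have inT (s : R) : `[0, t]%classic s -> 0 <= s <= T.
  by rewrite /= in_itv/= => /andP[-> st]; exact: le_trans tT.
(* Time is moved outside, because at fixed [s] the kernels are constants for the integral over
   [Omega]. *)
rewrite /L2dist -(tonelli_on (lebesgue_measure : {sigma_finite_measure set mR -> \bar R})
  P mI measurableT (f := fun z => (fnorm (G (t - z.1) *m beta (X z.1 z.2) -
     H (t - z.1) *m beta (Y z.1 z.2)) ^+ 2)%:E)); last 2 first.
- exact: mGXHY.
- by move=> z _; rewrite lee_fin sqr_ge0.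
have mGH : mx_measurable (`[0, T] : set R) (fun s => G s - H s) := mx_measurableB mG mH.
have mGHt : measurable_fun (`[0, t] : set mR) (fun s => (fnorm (G (t - s) - H (t - s)) ^+ 2)%:E).
  apply/measurable_EFinP; apply: measurable_fnorm_sqr.
  exact: (mx_measurable_reflect (G := fun s => G s - H s)).
have mHt : measurable_fun (`[0, t] : set mR) (fun s => (fnorm (H (t - s)) ^+ 2)%:E).
  by apply/measurable_EFinP; apply: measurable_fnorm_sqr; exact: mx_measurable_reflect.
have mmsd := measurable_msd tT mX mY.
have sec (Z : R -> Omega -> 'cV[R]_d) (s : R) : `[0, t]%classic s ->
    mx_measurable (Q T) (fun z : R * Omega => Z z.1 z.2) -> mx_measurable setT (Z s).
  move=> st mZ i j.
  apply: (measurable_fun_section2 (A := `[0, t]%classic : set R) (B := setT)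
    (f := fun z => Z z.1 z.2 i j)) => //.
  exact: mx_measurable_itvS mZ i j.
apply: (@le_trans _ _ (\int[lebesgue_measure]_(s in `[0%R, t])
   ((2 * B)%:E * (fnorm (G (t - s)%R - H (t - s)%R) ^+ 2)%:E +
    (2 * L ^+ 2)%:E * ((fnorm (H (t - s)%R) ^+ 2)%:E * msd X Y s)))%E).
  apply: ge0_le_integral => //.
  - by move=> s _; apply: integral_ge0 => w _; rewrite lee_fin sqr_ge0.
  - apply: (measurable_tonelli1_on (T1 := mR) P mI measurableT
      (f := fun z => (fnorm (G (t - z.1) *m beta (X z.1 z.2) -
       H (t - z.1) *m beta (Y z.1 z.2)) ^+ 2)%:E)).
      exact: mGXHY.
    by move=> z _; rewrite lee_fin sqr_ge0.
  - by apply: emeasurable_funD; apply: measurable_funeM => //; exact: emeasurable_funM.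
  move=> s st; have mXs := sec X s st mX; have mYs := sec Y s st mY.
  have mbX : measurable_fun setT (fun w => (fnorm (beta (X s w)) ^+ 2)%:E).
    apply/measurable_EFinP; apply: measurable_fnorm_sqr.
    exact: mx_measurable_lipschitz.
  have mXY : measurable_fun setT (fun w => (fnorm (X s w - Y s w) ^+ 2)%:E).
    by apply/measurable_EFinP; apply: measurable_fnorm_sqr; exact: mx_measurableB.
  set u := fnorm (G (t - s) - H (t - s)) ^+ 2; set v := fnorm (H (t - s)) ^+ 2.
  have u0 : 0 <= u by exact: sqr_ge0.
  have v0 : 0 <= v by exact: sqr_ge0.
  have k1 : 0 <= 2 * u := mulr_ge0 (ler0n _ 2) u0.
  have k2 : 0 <= 2 * L ^+ 2 * v := mulr_ge0 L20 v0.
  apply: (@le_trans _ _ (\int[P]_w ((2 * u)%:E * (fnorm (beta (X s w)) ^+ 2)%:E +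
     (2 * L ^+ 2 * v)%:E * (fnorm (X s w - Y s w) ^+ 2)%:E))%E).
    apply: ge0_le_integral => //.
    - by move=> w _; rewrite lee_fin sqr_ge0.
    - apply/measurable_EFinP; apply: measurable_fnorm_sqr; apply: mx_measurableB.
        apply: mx_measurableM; last exact: mx_measurable_lipschitz.
        by move=> i j /=; exact: measurable_cst.
      apply: mx_measurableM; last exact: mx_measurable_lipschitz.
      by move=> i j /=; exact: measurable_cst.
    - by apply: emeasurable_funD; exact: measurable_funeM.
    move=> w _; rewrite -!EFinM -EFinD lee_fin.
    rewrite (_ : G (t - s) *m beta (X s w) - H (t - s) *m beta (Y s w) =
      (G (t - s) - H (t - s)) *m beta (X s w) + H (t - s) *m (beta (X s w) - beta (Y s w))).
      apply: le_trans (fnorm_sqrD _ _) _.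
      have h1 := fnormM_sqr (G (t - s) - H (t - s)) (beta (X s w)).
      have h2 := fnormM_sqr (H (t - s)) (beta (X s w) - beta (Y s w)).
      have h3 : fnorm (beta (X s w) - beta (Y s w)) ^+ 2 <= L ^+ 2 * fnorm (X s w - Y s w) ^+ 2.
        by rewrite -exprMn lerXn2r// nnegrE ?mulr_ge0 ?fnorm_ge0.
      have := ler_wpM2l v0 h3; rewrite -/u -/v in h1 h2 *.
      by clearbody u v; lra.
    by rewrite mulmxBl mulmxBr subrKA.
  rewrite ge0_integralD//; first last.
  - exact: measurable_funeM.
  - by move=> w _; rewrite mule_ge0 ?lee_fin ?sqr_ge0.
  - exact: measurable_funeM.
  - by move=> w _; rewrite mule_ge0 ?lee_fin ?sqr_ge0.
  rewrite !ge0_integralZl//; try by move=> w _; rewrite lee_fin sqr_ge0.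
  apply: leeD; last by rewrite [(_ * v)%:E]EFinM muleA.
  rewrite [(2 * u)%:E]EFinM [(2 * B)%:E]EFinM -!muleA lee_pmul2l//.
  by rewrite [leRHS]muleC lee_wpmul2l ?lee_fin//; apply: XB; exact: inT.
rewrite ge0_integralD//; first last.
- by apply: measurable_funeM; exact: emeasurable_funM.
- move=> s _; rewrite mule_ge0 ?lee_fin//.
  by rewrite mule_ge0 ?lee_fin ?sqr_ge0// msd_ge0.
- exact: measurable_funeM.
- by move=> s _; rewrite mule_ge0 ?lee_fin ?sqr_ge0.
have GH0 s : `[0, t]%classic s -> (0 <= (fnorm (G (t - s)%R - H (t - s)%R) ^+ 2)%:E)%E.
  by move=> _; rewrite lee_fin sqr_ge0.
have Hm0 s : `[0, t]%classic s -> (0 <= (fnorm (H (t - s)%R) ^+ 2)%:E * msd X Y s)%E.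
  by move=> _; rewrite mule_ge0 ?lee_fin ?sqr_ge0// msd_ge0.
rewrite (ge0_integralZl _ mI mGHt GH0)//.
rewrite (ge0_integralZl _ mI (emeasurable_funM mHt mmsd) Hm0); last by rewrite lee_fin.
(* Reflection turns the kernel error at [t - s] into the error at [s]; the other term stays a
   convolution. *)
rewrite (ge0_integral_reflect (f := fun s => (fnorm (G s - H s) ^+ 2)%:E))//.
- apply/measurable_EFinP; apply: measurable_fnorm_sqr => i j.
  by apply: measurable_funS (mGH i j) => // s /inT; rewrite /= in_itv.
- by move=> s _; rewrite lee_fin sqr_ge0.
Qed.

End volterra_coefficient.

(** * Pathwise comparison of the drift terms *)

Section drift.
Context (R : realType) (d : nat) (t : R).
Hypothesis t0 : 0 <= t.
Implicit Types u v : R -> 'cV[R]_d.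
Notation mu := (@lebesgue_measure R).

(** On a bounded interval square integrability implies integrability, by [|x| <= 1 + x ^+ 2]. *)
Lemma integrable_fnorm_entry u i :
  mx_measurable (`[0, t] : set (measurableTypeR R)) u ->
  (\int[mu]_(s in `[0%R, t]) (fnorm (u s) ^+ 2)%:E < +oo)%E ->
  mu.-integrable (`[0, t] : set R) (EFin \o (fun s => u s i ord0)).
Proof.
move=> mu_ fin.
have i1 : mu.-integrable (`[0, t] : set R) (EFin \o cst 1).
  apply: measurable_bounded_integrable => //; last first.
    by exists 1; split => // M /ltW M1 x _; rewrite /= normr1.
  by rewrite /= lebesgue_measure_itv/=; case: ifP; rewrite -?EFinD ltry.
have i2 : mu.-integrable (`[0, t] : set R) (EFin \o (fun s => fnorm (u s) ^+ 2)).
  apply/integrableP; split; first exact/measurable_EFinP/measurable_fnorm_sqr.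
  by under eq_integral do rewrite /= ger0_norm ?sqr_ge0//.
apply: (le_integrable _ _ _ (integrableD _ i1 i2)) => //.
  by apply/measurable_EFinP; exact: mu_.
move=> s _; rewrite /= lee_fin [leRHS]ger0_norm ?addr_ge0 ?sqr_ge0//.
have := fnorm_entry (u s) i ord0; have := sqr_ge0 (fnorm (u s) - 1).
rewrite sqrrB; have := fnorm_ge0 (u s); nra.
Qed.

(** Cauchy-Schwarz in each coordinate. The finiteness conditions make the difference of the
    integrals the integral of the difference; a divergent integral would only have a default
    value. *)
Lemma drift_diff_sqr_le u v :
  mx_measurable (`[0, t] : set (measurableTypeR R)) u ->
  mx_measurable (`[0, t] : set (measurableTypeR R)) v ->
  (\int[mu]_(s in `[0%R, t]) (fnorm (u s) ^+ 2)%:E < +oo)%E ->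
  (\int[mu]_(s in `[0%R, t]) (fnorm (v s) ^+ 2)%:E < +oo)%E ->
  ((fnorm (\col_i \int[mu]_(s in `[0, t]) (u s) i ord0 -
           \col_i \int[mu]_(s in `[0, t]) (v s) i ord0) ^+ 2)%:E <=
   t%:E * \int[mu]_(s in `[0%R, t]) (fnorm (u s - v s) ^+ 2)%:E)%E.
Proof.
move=> mu_ mv fu fv.
have iu i := integrable_fnorm_entry i mu_ fu.
have iv i := integrable_fnorm_entry i mv fv.
rewrite (_ : integral _ _ _ = \sum_(i < d)
    \int[mu]_(s in `[0%R, t]) ((u s i ord0 - v s i ord0) ^+ 2)%:E)%E; last first.
  rewrite -ge0_integral_sum//.
  - apply: eq_integral => s _; rewrite fnorm_sqr -sumEFin.
    by apply: eq_bigr => i _; rewrite big_ord1 !mxE.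
  - by move=> i; apply/measurable_EFinP/measurable_funX/measurable_funB.
  - by move=> i s _; rewrite lee_fin sqr_ge0.
rewrite ge0_sume_distrr; last first.
  by move=> i _; apply: integral_ge0 => s _; rewrite lee_fin sqr_ge0.
rewrite fnorm_sqr -sumEFin; apply: lee_sum => i _.
rewrite big_ord1 !mxE -RintegralB//.
apply: sqr_Rintegral_le => //.
exact: (integrableB _ (iu i) (iv i)).
Qed.

End drift.

Section volterra_msd.
Context (R : realType) (disp : measure_display) (Omega : measurableType disp).
Context (P : probability Omega R) (F : R -> set (set Omega)).
Hypothesis hF : is_filtration F.
Context (d : nat) (W : R -> Omega -> 'cV[R]_d).
Hypothesis hW : is_brownian_motion P F W.
Variable c : R.
Hypothesis c0 : 0 <= c.
Hypothesis hc : forall s : R, 0 < s ->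
  (\int[normal_prob 0 s]_x (x ^+ 2)%:E = (c * s ^+ 2)%:E)%E.
Variables (T : R) (x0 : 'cV[R]_d) (b : 'cV[R]_d -> 'cV[R]_d)
  (sigma : 'cV[R]_d -> 'M[R]_d) (L : R).
Hypotheses (L0 : 0 <= L)
  (Lb : forall x y, fnorm (b x - b y) <= L * fnorm (x - y))
  (Ls : forall x y, fnorm (sigma x - sigma y) <= L * fnorm (x - y)).
Variables (G1 G2 H1 H2 : R -> 'M[R]_d) (X Y : R -> Omega -> 'cV[R]_d).
Hypotheses (mG1 : mx_measurable (`[0, T] : set R) G1)
  (mH1 : mx_measurable (`[0, T] : set R) H1).
Hypotheses (hX : is_volterra_solution P F W T x0 b sigma G1 G2 X)
  (hY : is_volterra_solution P F W T x0 b sigma H1 H2 Y).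

(** The factor 2 separates drift and noise, [t] is Cauchy-Schwarz in time, and [18 = 2 * 9] involves
    the constant of [ito_contraction]. *)
Lemma volterra_msd_le (t : R) : 0 <= t <= T ->
  (L2dist P t (fun s w => G1 (t - s)%R *m b (X s w)) (fun _ _ => 0%R) < +oo)%E ->
  (L2dist P t (fun s w => H1 (t - s)%R *m b (Y s w)) (fun _ _ => 0%R) < +oo)%E ->
  (msd P X Y t <=
   (2 * t)%:E * L2dist P t (fun s w => G1 (t - s)%R *m b (X s w))
                           (fun s w => H1 (t - s)%R *m b (Y s w)) +
   (18 * c)%:E * L2dist P t (fun s w => G2 (t - s)%R *m sigma (X s w))
                            (fun s w => H2 (t - s)%R *m sigma (Y s w)))%E.
Proof.
move=> tT finX finY; have /andP[t0 tT'] := tT.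
have [_ mX _ /(_ t tT)[I hI eqX]] := hX.
have [_ mY _ /(_ t tT)[J hJ eqY]] := hY.
have contr := ito_contraction hF hW c0 hc hI hJ.
have mI : mx_measurable setT I by case: hI.
have mJ : mx_measurable setT J by case: hJ.
pose u w s := G1 (t - s) *m b (X s w); pose v w s := H1 (t - s) *m b (Y s w).
have mu_ := mx_measurable_integrand L0 Lb tT' mG1 mX.
have mv := mx_measurable_integrand L0 Lb tT' mH1 mY.
have m0 : mx_measurable (`[0, t] `*` [set: Omega]) (fun z : R * Omega => 0 : 'cV[R]_d).
  by move=> i j /=; exact: measurable_cst.
have msec (f : R -> Omega -> 'cV[R]_d) w :
    mx_measurable (`[0, t] `*` [set: Omega]) (fun z : R * Omega => f z.1 z.2) ->
    mx_measurable (`[0, t] : set (measurableTypeR R)) (fun s => f s w).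
  move=> mf i j; apply: (measurable_fun_section1 (B := setT)
    (f := fun z : R * Omega => f z.1 z.2 i j)) => //; exact: mf.
(* A finite double integral has a finite inner integral for almost every [w], which
   [drift_diff_sqr_le] needs path by path. *)
have aefin (f : R -> Omega -> 'cV[R]_d) :
    mx_measurable (`[0, t] `*` [set: Omega]) (fun z : R * Omega => f z.1 z.2) ->
    (L2dist P t f (fun _ _ => 0%R) < +oo)%E ->
    {ae P, forall w, (\int[lebesgue_measure]_(s in `[0%R, t]) (fnorm (f s w) ^+ 2)%:E < +oo)%E}.
  move=> mf fin.
  pose phi w := (\int[lebesgue_measure]_(s in `[0%R, t]) (fnorm (f s w - 0) ^+ 2)%:E)%E.
  have phi0 w : (0 <= phi w)%E by apply: integral_ge0 => s _; rewrite lee_fin sqr_ge0.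
  have iphi : P.-integrable setT phi.
    apply/integrableP; split.
      exact: (measurable_L2dist_inner (f := f) (g := fun _ _ => 0%R) mf m0).
    by under eq_integral do rewrite gee0_abs//.
  apply: filterS (integrable_ae measurableT iphi) => w /(_ Logic.I).
  rewrite ge0_fin_numE// /phi; congr (_ < _)%E.
  by apply: eq_integral => s _; rewrite subr0.
have aeX := aefin _ mu_ finX; have aeY := aefin _ mv finY.
pose phi w := (\int[lebesgue_measure]_(s in `[0%R, t]) (fnorm (u w s - v w s) ^+ 2)%:E)%E.
have mphi : measurable_fun setT phi.
  exact: (measurable_L2dist_inner (f := fun s w => u w s) (g := fun s w => v w s) mu_ mv).
have phi0 w : (0 <= phi w)%E by apply: integral_ge0 => s _; rewrite lee_fin sqr_ge0.
have mIJ : measurable_fun setT (fun w => (fnorm (I w - J w) ^+ 2)%:E).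
  by apply/measurable_EFinP; apply: measurable_fnorm_sqr; exact: mx_measurableB.
have sec (Z : R -> Omega -> 'cV[R]_d) :
    mx_measurable (`[0, T] `*` [set: Omega]) (fun z : R * Omega => Z z.1 z.2) ->
    mx_measurable setT (Z t).
  move=> mZ i j.
  by apply: (measurable_fun_section2 (A := `[0, T]%classic : set R) (B := setT)
    (f := fun z => Z z.1 z.2 i j)) => //.
have t20 : 0 <= 2 * t := mulr_ge0 (ler0n _ 2) t0.
apply: (@le_trans _ _ (\int[P]_w ((2 * t)%:E * phi w + 2%:E * (fnorm (I w - J w) ^+ 2)%:E))%E).
  apply: ae_ge0_le_integral => //.
  - by move=> w _; rewrite lee_fin sqr_ge0.
  - apply/measurable_EFinP; apply: measurable_fnorm_sqr.
    by apply: mx_measurableB; exact: sec.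
  - by move=> w _; rewrite adde_ge0// mule_ge0// lee_fin sqr_ge0.
  - by apply: emeasurable_funD; exact: measurable_funeM.
  apply: filterS (filterI (filterI eqX eqY) (filterI aeX aeY)).
  move=> w [[/= eX eY] [/= fX fY]] _.
  have -> : X t w - Y t w =
      (\col_i \int[lebesgue_measure]_(s in `[0, t]) (u w s) i ord0 -
       \col_i \int[lebesgue_measure]_(s in `[0, t]) (v w s) i ord0) + (I w - J w).
    rewrite eX eY opprD addrACA; congr (_ + _).
    by rewrite opprD addrACA subrr add0r.
  have := drift_diff_sqr_le t0 (msec (fun s w => u w s) w mu_) (msec (fun s w => v w s) w mv) fX fY.
  rewrite -/(phi w); set D := (X in fnorm X) => hD.
  apply: (@le_trans _ _ (2%:E * (fnorm D ^+ 2)%:E + 2%:E * (fnorm (I w - J w) ^+ 2)%:E)%E).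
    by rewrite -!EFinM -EFinD lee_fin; exact: fnorm_sqrD.
  by apply: leeD => //; rewrite [(2 * t)%:E]EFinM -muleA lee_pmul2l.
rewrite ge0_integralD//; first last.
- exact: measurable_funeM.
- by move=> w _; rewrite mule_ge0// lee_fin sqr_ge0.
- exact: measurable_funeM.
- by move=> w _; rewrite mule_ge0.
have sq0 w : [set: Omega] w -> (0 <= (fnorm (I w - J w) ^+ 2)%:E)%E.
  by move=> _; rewrite lee_fin sqr_ge0.
rewrite (ge0_integralZl _ measurableT mphi (fun w _ => phi0 w))//.
rewrite (ge0_integralZl _ measurableT mIJ sq0)//.
apply: leeD; first exact: lexx.
rewrite (_ : 18 * c = 2 * (9 * c)); last by ring.
by rewrite [(2 * _)%:E]EFinM -muleA lee_pmul2l.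
Qed.

End volterra_msd.

Lemma lee_double_combination (R : realType) (p r u v w k1 k2 : R) (x y z : \bar R) :
  0 <= p -> 0 <= r -> 0 <= u -> 0 <= v -> 0 <= w ->
  (0 <= x)%E -> (0 <= y)%E -> (0 <= z)%E ->
  p * u <= k1 -> r * v <= k1 -> p * w + r * w <= k2 ->
  (p%:E * (u%:E * x + w%:E * z) + r%:E * (v%:E * y + w%:E * z) <=
   k1%:E * (x + y) + k2%:E * z)%E.
Proof.
move=> p0 r0 u0 v0 w0 x0 y0 z0 pu rv pw.
have m0 (s : R) (e : \bar R) : 0 <= s -> (0 <= e)%E -> (0 <= s%:E * e)%E.
  by move=> s0 e0; rewrite mule_ge0.
rewrite (ge0_muleDr _ (m0 u x u0 x0) (m0 w z w0 z0)).
rewrite (ge0_muleDr _ (m0 v y v0 y0) (m0 w z w0 z0)).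
rewrite !muleA -!EFinM addeACA (ge0_muleDr _ x0 y0).
have := @ge0_muleDl R z (p * w)%:E (r * w)%:E.
rewrite !lee_fin !mulr_ge0// => /(_ isT isT) <-.
by rewrite -EFinD !leeD// lee_wpmul2r// lee_fin.
Qed.

(** Linear growth: [beta (Z w)] is compared with [beta 0]. *)
Lemma lipschitz_second_moment (R : realType) (disp : measure_display)
    (Omega : measurableType disp) (P : probability Omega R) (d n : nat)
    (beta : 'cV[R]_d -> 'M[R]_(d, n)) (L c : R) (Z : Omega -> 'cV[R]_d) :
  0 <= L -> (forall x y, fnorm (beta x - beta y) <= L * fnorm (x - y)) ->
  mx_measurable setT Z -> (\int[P]_w (fnorm (Z w) ^+ 2)%:E <= c%:E)%E ->
  (\int[P]_w (fnorm (beta (Z w)) ^+ 2)%:E <=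
   (2 * fnorm (beta 0%R) ^+ 2 + 2 * L ^+ 2 * c)%:E)%E.
Proof.
move=> L0 Lbeta mZ Zc.
have L20 : 0 <= 2 * L ^+ 2 := mulr_ge0 (ler0n _ 2) (sqr_ge0 L).
have mZ2 : measurable_fun setT (fun w => (fnorm (Z w) ^+ 2)%:E).
  by apply/measurable_EFinP; exact: measurable_fnorm_sqr.
have b20 : 0 <= 2 * fnorm (beta 0) ^+ 2 := mulr_ge0 (ler0n _ 2) (sqr_ge0 _).
apply: (@le_trans _ _ (\int[P]_w ((2 * fnorm (beta 0%R) ^+ 2)%:E +
    (2 * L ^+ 2)%:E * (fnorm (Z w) ^+ 2)%:E))%E).
  apply: ge0_le_integral => //.
  - by move=> w _; rewrite lee_fin sqr_ge0.
  - apply/measurable_EFinP; apply: measurable_fnorm_sqr.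
    exact: (mx_measurable_lipschitz L0 Lbeta).
  - by apply: emeasurable_funD => //; exact: measurable_funeM.
  move=> w _; rewrite -EFinM -EFinD lee_fin.
  have := fnorm_sqrD (beta 0) (beta (Z w) - beta 0).
  rewrite [X in fnorm X ^+ 2 <= _]addrC subrK => /le_trans; apply.
  rewrite lerD2l// -mulrA ler_pM2l// -exprMn lerXn2r// ?nnegrE ?mulr_ge0 ?fnorm_ge0//.
  by have := Lbeta (Z w) 0; rewrite subr0.
rewrite ge0_integralD//; first last.
- exact: measurable_funeM.
- by move=> w _; rewrite mule_ge0 ?lee_fin ?sqr_ge0.
have -> : (\int[P]_w (2 * fnorm (beta 0%R) ^+ 2)%:E = (2 * fnorm (beta 0%R) ^+ 2)%:E)%E.
  by rewrite integral_cst//= [P _]probability_setT mule1.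
rewrite ge0_integralZl//; last first.
  by move=> w _; rewrite lee_fin sqr_ge0.
by rewrite [leRHS]EFinD [(_ * c)%:E]EFinM leeD2l// lee_wpmul2l.
Qed.

Section volterra_stability_constant.
Context (R : realType) (disp : measure_display) (Omega : measurableType disp).
Context (P : probability Omega R) (F : R -> set (set Omega)).
Hypothesis hF : is_filtration F.
Context (d : nat) (W : R -> Omega -> 'cV[R]_d).
Hypothesis hW : is_brownian_motion P F W.
Variables (T : R) (x0 : 'cV[R]_d) (b : 'cV[R]_d -> 'cV[R]_d)
  (sigma : 'cV[R]_d -> 'M[R]_d) (L : R).
Hypotheses (T0 : 0 <= T) (L0 : 0 <= L)
  (Lb : forall x y, fnorm (b x - b y) <= L * fnorm (x - y))
  (Ls : forall x y, fnorm (sigma x - sigma y) <= L * fnorm (x - y)).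
Variable g : R -> R.
Hypotheses (mg : measurable_fun (`[0, T] : set R) g)
  (g0 : forall s : R, 0 <= s <= T -> 0 <= g s)
  (gfin : (\int[lebesgue_measure]_(s in `[0%R, T]) (g s)%:E < +oo)%E).
Local Notation mR := (measurableTypeR R).
Local Notation Q t := (`[0, t] `*` [set: Omega]).

Let measurable_at_time (Z : R -> Omega -> 'cV[R]_d) (s : R) : 0 <= s <= T ->
  mx_measurable (Q T) (fun z : R * Omega => Z z.1 z.2) -> mx_measurable setT (Z s).
Proof.
move=> st mZ i j.
by apply: (measurable_fun_section2 (A := `[0, T]%classic : set R) (B := setT)
  (f := fun z => Z z.1 z.2 i j)).
Qed.

Let mx_measurableS (H : R -> 'M[R]_d) (t : R) : t <= T ->
  mx_measurable (`[0, T] : set R) H -> mx_measurable (`[0, t] : set R) H.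
Proof.
move=> tT mH i j; apply: measurable_funS (mH i j) => //.
by move=> s; rewrite /= !in_itv/= => /andP[-> st]; exact: le_trans tT.
Qed.

(** The factor [k] is 1 for a single kernel and 4 for a difference of two. *)
Lemma integral_fnorm_sqr_lt_pinfty (H : R -> 'M[R]_d) (k t : R) : t <= T -> 0 <= k ->
  mx_measurable (`[0, T] : set R) H ->
  (forall s : R, 0 < s <= T -> fnorm (H s) ^+ 2 <= k * g s) ->
  (\int[lebesgue_measure]_(s in `[0%R, t]) (fnorm (H s) ^+ 2)%:E < +oo)%E.
Proof.
move=> tT k0 mH Hg.
have mHT : measurable_fun (`[0, T] : set mR) (fun s => (fnorm (H s) ^+ 2)%:E).
  by apply/measurable_EFinP; exact: measurable_fnorm_sqr.
have mgE : measurable_fun (`[0, T] : set mR) (fun s => (g s)%:E) by exact/measurable_EFinP.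
apply: (@le_lt_trans _ _ (\int[lebesgue_measure]_(s in `[0%R, T]) (fnorm (H s) ^+ 2)%:E)%E).
  apply: ge0_subset_integral => //.
    by move=> s _; rewrite lee_fin sqr_ge0.
  by move=> s; rewrite /= !in_itv/= => /andP[-> st]; exact: le_trans tT.
apply: (@le_lt_trans _ _ (\int[lebesgue_measure]_(s in `[0%R, T]) (k%:E * (g s)%:E))%E).
  apply: le_integral_oc => //.
  - exact: measurable_funeM.
  - by move=> s _; rewrite lee_fin sqr_ge0.
rewrite ge0_integralZl//.
by apply: lte_mul_pinfty => //; rewrite ?lee_fin.
Qed.

Let moment_bound_ge0 (Z : R -> Omega -> 'cV[R]_d) (c : R) :
  (forall s : R, 0 <= s <= T -> (\int[P]_w (fnorm (Z s w) ^+ 2)%:E <= c%:E)%E) -> 0 <= c.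
Proof.
move=> /(_ 0); rewrite lexx T0 => /(_ isT); rewrite -lee_fin; apply: le_trans.
by apply: integral_ge0 => w _; rewrite lee_fin sqr_ge0.
Qed.

Let coefficient_bound_ge0 (n : nat) (u : 'M[R]_(d, n)) (c : R) : 0 <= c ->
  0 <= 2 * fnorm u ^+ 2 + 2 * L ^+ 2 * c.
Proof.
move=> c0; have := mulr_ge0 (sqr_ge0 L) c0; have := sqr_ge0 (fnorm u); lra.
Qed.

Let L2dist_drift_lt_pinfty (H : R -> 'M[R]_d) (Z : R -> Omega -> 'cV[R]_d) (c t : R) :
  0 <= t <= T -> mx_measurable (`[0, T] : set R) H ->
  (forall s : R, 0 < s <= T -> fnorm (H s) ^+ 2 <= g s) ->
  mx_measurable (Q T) (fun z : R * Omega => Z z.1 z.2) ->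
  (forall s : R, 0 <= s <= T -> (\int[P]_w (fnorm (Z s w) ^+ 2)%:E <= c%:E)%E) ->
  (L2dist P t (fun s w => H (t - s)%R *m b (Z s w)) (fun _ _ => 0%R) < +oo)%E.
Proof.
move=> tT mH Hg mZ Zc; have /andP[t0 tT'] := tT.
have m0 : mx_measurable (`[0, T] : set R) (fun _ => 0 : 'M[R]_d).
  by move=> i j; exact: measurable_cst.
(* Comparison with the zero kernel, the process being the same on both sides: the convolution term
   vanishes and a moment bound times the integral of [|H|^2] remains. *)
have := volterra_coefficient_estimate L0 Lb tT mZ mZ mH m0
  (fun s sT => lipschitz_second_moment L0 Lb (measurable_at_time sT mZ) (Zc s sT)).
rewrite (_ : (fun s w => 0 *m b (Z s w)) = fun _ _ => 0); last first.
  by apply/funext => s; apply/funext => w; rewrite mul0mx.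
move=> /le_lt_trans; apply.
rewrite [X in (_ + _ * X)%E](_ : _ = 0%E); last first.
  apply: integral0_eq => s _.
  rewrite fnorm_sqr big1 ?mul0e// => i _; rewrite big1// => j _.
  by rewrite !mxE expr0n.
rewrite mule0 adde0; apply: lte_mul_pinfty => //.
  by rewrite lee_fin mulr_ge0 ?coefficient_bound_ge0// (moment_bound_ge0 Zc).
apply: (integral_fnorm_sqr_lt_pinfty (H := fun s => H s - 0) (k := 1)) => //.
  exact: mx_measurableB.
by move=> s sT; rewrite subr0 mul1r Hg.
Qed.

Let E (G H : R -> 'M[R]_d) (t : R) :=
  (\int[lebesgue_measure]_(s in `[0%R, t]) (fnorm (G s - H s) ^+ 2)%:E)%E.

Let E_ge0 G H t : (0 <= E G H t)%E.
Proof. by apply: integral_ge0 => s _; rewrite lee_fin sqr_ge0. Qed.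

Let E_lt_pinfty (G H : R -> 'M[R]_d) (t : R) : t <= T ->
  mx_measurable (`[0, T] : set R) G -> mx_measurable (`[0, T] : set R) H ->
  (forall s : R, 0 < s <= T -> fnorm (G s) ^+ 2 <= g s) ->
  (forall s : R, 0 < s <= T -> fnorm (H s) ^+ 2 <= g s) -> (E G H t < +oo)%E.
Proof.
move=> tT mG mH Gg Hg.
apply: (integral_fnorm_sqr_lt_pinfty (H := fun s => G s - H s) (k := 4)) => //.
  exact: mx_measurableB.
move=> s sT; have := fnorm_sqrD (G s) (- H s); rewrite fnormN.
by have := Gg s sT; have := Hg s sT; lra.
Qed.

(** A crude bound that depends on [Y]; it supplies the finiteness and boundedness that the Gronwall
    inequality presupposes. *)
Let msd_le (X Y : R -> Omega -> 'cV[R]_d) (cX cY s : R) : 0 <= s <= T ->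
  mx_measurable (Q T) (fun z : R * Omega => X z.1 z.2) ->
  mx_measurable (Q T) (fun z : R * Omega => Y z.1 z.2) ->
  (\int[P]_w (fnorm (X s w) ^+ 2)%:E <= cX%:E)%E ->
  (\int[P]_w (fnorm (Y s w) ^+ 2)%:E <= cY%:E)%E ->
  (msd P X Y s <= (2 * cX + 2 * cY)%:E)%E.
Proof.
move=> sT mX mY Xc Yc.
have mXs := measurable_at_time sT mX; have mYs := measurable_at_time sT mY.
have m2 (Z : Omega -> 'cV[R]_d) : mx_measurable setT Z ->
    measurable_fun setT (fun w => (fnorm (Z w) ^+ 2)%:E).
  by move=> mZ; apply/measurable_EFinP; exact: measurable_fnorm_sqr.
have mX2 := m2 _ mXs; have mY2 := m2 _ mYs.
apply: (@le_trans _ _ (\int[P]_w (2%:E * (fnorm (X s w) ^+ 2)%:E +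
    2%:E * (fnorm (Y s w) ^+ 2)%:E))%E).
  apply: ge0_le_integral => //.
  - by move=> w _; rewrite lee_fin sqr_ge0.
  - by apply: m2; exact: mx_measurableB.
  - by apply: emeasurable_funD; exact: measurable_funeM.
  move=> w _; rewrite -!EFinM -EFinD lee_fin.
  by have := fnorm_sqrD (X s w) (- Y s w); rewrite fnormN.
rewrite ge0_integralD//; first last.
- exact: measurable_funeM.
- by move=> w _; rewrite mule_ge0 ?lee_fin ?sqr_ge0.
- exact: measurable_funeM.
- by move=> w _; rewrite mule_ge0 ?lee_fin ?sqr_ge0.
rewrite !ge0_integralZl//; try by move=> w _; rewrite lee_fin sqr_ge0.
by rewrite [leRHS]EFinD [(2 * cX)%:E]EFinM [(2 * cY)%:E]EFinM leeD// lee_pmul2l.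
Qed.

(** The order of the quantifiers is the point: [C] may depend on [X] and on the dominating function
    [g], but is fixed before [H1], [H2] and [Y], hence independent of K in the application. *)
Lemma volterra_stability (G1 G2 : R -> 'M[R]_d) (X : R -> Omega -> 'cV[R]_d) :
  mx_measurable (`[0, T] : set R) G1 -> mx_measurable (`[0, T] : set R) G2 ->
  (forall s : R, 0 < s <= T -> fnorm (G1 s) ^+ 2 <= g s) ->
  (forall s : R, 0 < s <= T -> fnorm (G2 s) ^+ 2 <= g s) ->
  is_volterra_solution P F W T x0 b sigma G1 G2 X ->
  exists2 C : R, 0 <= C & forall (H1 H2 : R -> 'M[R]_d) (Y : R -> Omega -> 'cV[R]_d),
    mx_measurable (`[0, T] : set R) H1 -> mx_measurable (`[0, T] : set R) H2 ->
    (forall s : R, 0 < s <= T -> fnorm (H1 s) ^+ 2 <= g s) ->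
    (forall s : R, 0 < s <= T -> fnorm (H2 s) ^+ 2 <= g s) ->
    is_volterra_solution P F W T x0 b sigma H1 H2 Y ->
    forall t : R, 0 <= t <= T ->
    (msd P X Y t <= C%:E *
      (\int[lebesgue_measure]_(s in `[0%R, t]) (fnorm (G1 s - H1 s) ^+ 2)%:E +
       \int[lebesgue_measure]_(s in `[0%R, t]) (fnorm (G2 s - H2 s) ^+ 2)%:E))%E.
Proof.
move=> mG1 mG2 G1g G2g hX.
have [c c0 hc] := normal_second_moment R.
have [_ mX [cX]] := hX; rewrite unlock => Xc _.
have cX0 : 0 <= cX := moment_bound_ge0 Xc.
pose B (n : nat) (beta : 'cV[R]_d -> 'M[R]_(d, n)) := 2 * fnorm (beta 0) ^+ 2 + 2 * L ^+ 2 * cX.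
have B0 n beta : 0 <= B n beta by exact: coefficient_bound_ge0.
have Bb := fun s sT => lipschitz_second_moment L0 Lb (measurable_at_time sT mX) (Xc s sT).
have Bs := fun s sT => lipschitz_second_moment L0 Ls (measurable_at_time sT mX) (Xc s sT).
rewrite -/(B _ b) in Bb; rewrite -/(B _ sigma) in Bs.
(* Products of the constants [2 * T] and [18 * c] of [volterra_msd_le] with [2 * B] for [k1], and
   with [2 * L ^+ 2] for [k2], from [volterra_coefficient_estimate]. *)
pose k1 := 4 * T * B _ b + 36 * c * B _ sigma.
pose k2 := 4 * T * L ^+ 2 + 36 * c * L ^+ 2.
have k10 : 0 <= k1 by rewrite addr_ge0// !mulr_ge0.
have k20 : 0 <= k2 by rewrite addr_ge0// !mulr_ge0// sqr_ge0.
pose q s := k2 * g s.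
have mq : measurable_fun (`[0, T] : set R) q by exact: measurable_funM.
have q0 (s : R) : 0 <= s <= T -> 0 <= q s by move=> sT; rewrite mulr_ge0// g0.
have qfin : (\int[lebesgue_measure]_(s in `[0%R, T]) (q s)%:E < +oo)%E.
  rewrite (_ : integral _ _ _ =
    \int[lebesgue_measure]_(s in `[0%R, T]) (k2%:E * (g s)%:E))%E; last first.
    by apply: eq_integral => s _; rewrite -EFinM.
  rewrite ge0_integralZl//; last exact/measurable_EFinP.
  by apply: lte_mul_pinfty => //; rewrite ?lee_fin.
have [C C0 gronwall] := gronwall_convolution T0 mq q0 qfin.
exists (C * k1); first by rewrite mulr_ge0// ltW.
move=> H1 H2 Y mH1 mH2 H1g H2g hY.
have [_ mY [cY]] := hY; rewrite unlock => Yc _.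
have msdB (s : R) (sT : 0 <= s <= T) := msd_le sT mX mY (Xc s sT) (Yc s sT).
pose f s := fine (msd P X Y s).
have fE (s : R) : 0 <= s <= T -> (f s)%:E = msd P X Y s.
  move=> sT; rewrite /f fineK// ge0_fin_numE ?msd_ge0//.
  exact: le_lt_trans (msdB s sT) (ltry _).
have E1fin t (tT : t <= T) := E_lt_pinfty tT mG1 mH1 G1g H1g.
have E2fin t (tT : t <= T) := E_lt_pinfty tT mG2 mH2 G2g H2g.
pose a t := k1 * (fine (E G1 H1 t) + fine (E G2 H2 t)).
have aE t : t <= T -> (a t)%:E = (k1%:E * (E G1 H1 t + E G2 H2 t))%E.
  move=> tT; rewrite EFinM; congr (_ * _)%E.
  have fin1 : E G1 H1 t \is a fin_num by rewrite ge0_fin_numE ?E_ge0// E1fin.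
  have fin2 : E G2 H2 t \is a fin_num by rewrite ge0_fin_numE ?E_ge0// E2fin.
  by rewrite EFinD (fineK fin1) (fineK fin2).
have Emono G H s t : s <= t -> mx_measurable (`[0, t] : set R) G ->
    mx_measurable (`[0, t] : set R) H -> (E G H s <= E G H t)%E.
  move=> st mG mH; apply: ge0_subset_integral => //.
  - by apply/measurable_EFinP; apply: measurable_fnorm_sqr; exact: mx_measurableB.
  - by move=> u _; rewrite lee_fin sqr_ge0.
  - by move=> u; rewrite /= !in_itv/= => /andP[-> us]; exact: le_trans st.
have gf : forall t : R, 0 <= t <= T -> f t <= C * a t; last first.
  move=> t tT; have /andP[t0 tT'] := tT.
  by rewrite -fE// EFinM -muleA -aE// -EFinM lee_fin gf.
apply: (gronwall f a (2 * cX + 2 * cY)).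
- apply: (measurableT_comp (f := @fine R)); first exact: fine_measurable.
  exact: (measurable_msd P (lexx T) mX mY).
- move=> s sT; rewrite fine_ge0 ?msd_ge0//=.
  by rewrite -lee_fin fE// msdB.
- move=> s _; rewrite mulr_ge0// addr_ge0// fine_ge0// E_ge0.
- move=> s t s0 st tT; rewrite -lee_fin !aE//; last exact: le_trans tT.
  rewrite lee_wpmul2l// leeD// Emono//; exact: mx_measurableS.
move=> t tT; have /andP[t0 tT'] := tT.
rewrite fE// aE//.
have finX := L2dist_drift_lt_pinfty tT mG1 G1g mX Xc.
have finY := L2dist_drift_lt_pinfty tT mH1 H1g mY Yc.
apply: le_trans (volterra_msd_le hF hW c0 hc L0 Lb mG1 mH1 hX hY tT finX finY) _.
have ge1 := volterra_coefficient_estimate L0 Lb tT mX mY mG1 mH1 Bb.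
have ge2 := volterra_coefficient_estimate L0 Ls tT mX mY mG2 mH2 Bs.
pose I := (\int[lebesgue_measure]_(s in `[0%R, t]) ((g (t - s)%R)%:E * msd P X Y s))%E.
have mgt : measurable_fun (`[0, t] : set mR) (fun s => (g (t - s))%:E).
  apply/measurable_EFinP.
  apply: (measurable_comp (F := (`[0, T] : set R))) mg _ => //.
    move=> _ [s + <-]; rewrite /= !in_itv/= => /andP[s0 st].
    by rewrite subr_ge0 st/= (le_trans _ tT')// lerBlDr lerDl.
  by apply: measurable_funTS; exact: measurable_funB.
have mmsd := measurable_msd P tT' mX mY.
have mI := emeasurable_funM mgt mmsd.
(* Drift and diffusion share the convolution [I] with [g]. Domination by [g] holds at positive
   times, so [s = t] is excluded. *)
have le_I H : mx_measurable (`[0, T] : set R) H ->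
    (forall s : R, 0 < s <= T -> fnorm (H s) ^+ 2 <= g s) ->
    (\int[lebesgue_measure]_(s in `[0%R, t]) ((fnorm (H (t - s)%R) ^+ 2)%:E * msd P X Y s) <= I)%E.
  move=> mH Hg; apply: le_integral_co => //.
  - apply: emeasurable_funM => //; apply/measurable_EFinP; apply: measurable_fnorm_sqr.
    exact: mx_measurable_reflect mH.
  - by move=> s _; rewrite mule_ge0 ?msd_ge0// lee_fin sqr_ge0.
  move=> s /andP[s0 st]; rewrite lee_wpmul2r ?msd_ge0// lee_fin Hg//.
  by rewrite subr_gt0 st/= (le_trans _ tT')// lerBlDr lerDl.
have I0 : (0 <= I)%E.
  apply: integral_ge0 => s; rewrite /= in_itv/= => /andP[s0 st].
  rewrite mule_ge0 ?msd_ge0// lee_fin g0// subr_ge0 st/= (le_trans _ tT')//.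
  by rewrite lerBlDr lerDl.
have <- : (k2%:E * I = \int[lebesgue_measure]_(s in `[0%R, t]) (q (t - s)%R * f s)%:E)%E.
  rewrite -ge0_integralZl//; last first.
    move=> s; rewrite /= in_itv/= => /andP[s0 st].
    rewrite mule_ge0 ?msd_ge0// lee_fin g0// subr_ge0 st/= (le_trans _ tT')//.
    by rewrite lerBlDr lerDl.
  apply: eq_integral => s; rewrite inE/= in_itv/= => /andP[s0 st].
  by rewrite !EFinM fE ?s0 ?(le_trans st)// muleA.
have L20 : 0 <= 2 * L ^+ 2 := mulr_ge0 (ler0n _ 2) (sqr_ge0 L).
apply: (@le_trans _ _ ((2 * T)%:E * ((2 * B _ b)%:E * E G1 H1 t + (2 * L ^+ 2)%:E * I) +
   (18 * c)%:E * ((2 * B _ sigma)%:E * E G2 H2 t + (2 * L ^+ 2)%:E * I))%E).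
  apply: leeD.
    apply: lee_pmul; [by rewrite lee_fin mulr_ge0| |by rewrite lee_fin ler_pM2l|].
      by apply: integral_ge0 => w _; apply: integral_ge0 => s _; rewrite lee_fin sqr_ge0.
    by apply: le_trans ge1 _; rewrite leeD// lee_wpmul2l// le_I.
  apply: lee_wpmul2l; first by rewrite lee_fin mulr_ge0.
  by apply: le_trans ge2 _; rewrite leeD// lee_wpmul2l// le_I.
apply: lee_double_combination; rewrite ?E_ge0 ?mulr_ge0//.
- by have := mulr_ge0 c0 (B0 _ sigma); rewrite /k1; lra.
- by have := mulr_ge0 T0 (B0 _ b); rewrite /k1; lra.
- by rewrite /k2; lra.
Qed.

End volterra_stability_constant.

(** * Assembly of the error bound *)

Lemma tail_r_ge0 (R : realType) (lam : {measure set (measurableTypeR R) -> \bar R}) (K : R) :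
  0 < K -> (0 <= tail_r lam K)%E.
Proof.
move=> K0; apply: integral_ge0 => x; rewrite /= in_itv/= andbT => Kx.
apply: integral_ge0 => y; rewrite /= in_itv/= andbT => Ky.
by rewrite lee_fin invr_ge0 addr_ge0// (le_trans (ltW K0)).
Qed.

Lemma lee_error_combination (R : realType) (C A1 A2 : R) (e1 e2 r i1 i2 : \bar R) :
  0 <= C -> 0 <= A1 -> 0 <= A2 -> (0 <= r)%E -> (0 <= i1)%E -> (0 <= i2)%E ->
  (e1 <= (2 * A1)%:E * r + 2%:E * i1)%E -> (e2 <= (2 * A2)%:E * r + 2%:E * i2)%E ->
  (C%:E * (e1 + e2) <= (C * (2 * (A1 + A2) + 2) + 1)%:E * (r + (i1 + i2)))%E.
Proof.
move=> C0 A10 A20 r0 i10 i20 h1 h2.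
have i0 : (0 <= i1 + i2)%E by exact: adde_ge0.
have k0 : 0 <= 2 * (A1 + A2) by rewrite mulr_ge0// addr_ge0.
apply: (@le_trans _ _ ((C * (2 * (A1 + A2) + 2))%:E * (r + (i1 + i2)))%E); last first.
  by apply: lee_wpmul2r; [exact: adde_ge0|rewrite lee_fin lerDl].
rewrite [(C * _)%:E]EFinM -muleA lee_wpmul2l// ?lee_fin//.
apply: le_trans (leeD h1 h2) _; rewrite addeACA.
rewrite -ge0_muleDl ?lee_fin ?mulr_ge0// -ge0_muleDr// -EFinD -mulrDr.
rewrite (ge0_muleDr _ r0 i0); apply: leeD; apply: lee_wpmul2r => //.
  by rewrite lee_fin lerDl.
by rewrite lee_fin lerDr.
Qed.

Theorem theorem3p2 (R : realType) (d : nat) (hd : (1 <= d)%N)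
  (disp : measure_display) (Omega : measurableType disp)
  (P : probability Omega R) (F : R -> set (set Omega)) (hF : is_filtration F)
  (W : R -> Omega -> 'cV[R]_d) (hW : is_brownian_motion P F W)
  (x0 : 'cV[R]_d) (b : 'cV[R]_d -> 'cV[R]_d) (sigma : 'cV[R]_d -> 'M[R]_d)
  (L : R) (hL : 0 < L)
  (hLip : forall x y : 'cV[R]_d,
     fnorm (b x - b y) + fnorm (sigma x - sigma y) <= L * fnorm (x - y))
  (lam : {measure set (measurableTypeR R) -> \bar R})
  (hGbar : forall t : R, 0 < t -> (Gbar lam t < +oo)%E)
  (hGbar2 : forall S : R, 0 < S ->
     (\int[lebesgue_measure]_(t in `[0%R, S]) (Gbar lam t ^+ 2) < +oo)%E)
  (M1 M2 : R -> 'M[R]_d)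
  (hM1 : mx_measurable (`[0, +oo[ : set R) M1)
  (hM2 : mx_measurable (`[0, +oo[ : set R) M2)
  (hM1b : exists c : R, forall rho : R, 0 <= rho -> fnorm (M1 rho) <= c)
  (hM2b : exists c : R, forall rho : R, 0 <= rho -> fnorm (M2 rho) <= c)
  (hr : forall K : R, 0 < K -> (tail_r lam K < +oo)%E)
  (T : R) (hT : 0 < T)
  (Ghat1 Ghat2 : R -> R -> 'M[R]_d)
  (hGhat1 : forall K : R, 0 < K -> mx_measurable (`[0, T] : set R) (Ghat1 K))
  (hGhat2 : forall K : R, 0 < K -> mx_measurable (`[0, T] : set R) (Ghat2 K))
  (hDelta : exists Dbar : R -> R,
     [/\ forall t : R, 0 <= t <= T -> 0 <= Dbar t,
         measurable_fun (`[0, T] : set R) Dbar,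
         (\int[lebesgue_measure]_(t in `[0%R, T]) (Dbar t ^+ 2)%:E < +oo)%E
       & forall K t : R, 0 < K -> 0 <= t <= T ->
           fnorm (Ghat1 K t - truncated_kernel lam M1 K t) <= Dbar t /\
           fnorm (Ghat2 K t - truncated_kernel lam M2 K t) <= Dbar t])
  (X : R -> Omega -> 'cV[R]_d) (Xhat : R -> R -> Omega -> 'cV[R]_d)
  (hX : is_volterra_solution P F W T x0 b sigma
          (kernel_of lam M1) (kernel_of lam M2) X)
  (hXhat : forall K : R, 0 < K ->
     is_volterra_solution P F W T x0 b sigma (Ghat1 K) (Ghat2 K) (Xhat K)) :
  exists2 C : R, 0 < C &
    forall K : R, 0 < K -> forall t : R, 0 <= t <= T ->
      ('E_P[fun w => (fnorm (X t w - Xhat K t w) ^+ 2)%R] <=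
       C%:E * (tail_r lam K +
               \int[lebesgue_measure]_(s in `[0%R, t])
                 (fnorm (Ghat1 K s - truncated_kernel lam M1 K s) ^+ 2 +
                  fnorm (Ghat2 K s - truncated_kernel lam M2 K s) ^+ 2)%:E))%E.
Proof.
have [c1 M1c] := hM1b; have [c2 M2c] := hM2b.
have [Dbar [D0 mD Dfin hD]] := hDelta.
have [lam0 lam0E] := sigma_finite_on_halfline (hGbar 1 ltr01).
(* All integrals against [lam] in the statement are over subsets of [[0, +oo[], where [lam] and
   [lam0] agree. *)
have integralE (D : set (measurableTypeR R)) (f : R -> \bar R) : measurable D ->
    D `<=` `[0, +oo[ -> (\int[lam]_(x in D) f x = \int[lam0]_(x in D) f x)%E.
  move=> mD' D'0; apply: eq_measure_integral => A mA AD.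
  by apply/esym/lam0E => // x /AD /D'0.
have subK (K : R) : 0 < K -> (`[K, +oo[ : set (measurableTypeR R)) `<=` `[0, +oo[.
  by move=> K0 x /=; rewrite !in_itv/= !andbT; apply: le_trans; exact: ltW.
have sub0K (K : R) : (`[0, K[ : set (measurableTypeR R)) `<=` `[0, +oo[.
  by move=> x /=; rewrite !in_itv/= => /andP[->].
have kernelE M : kernel_of lam M = mxlap lam0 M `[0, +oo[ :> (R -> 'M[R]_d).
  apply/funext => t; apply/matrixP => i j; rewrite !mxE /Rintegral; congr fine.
  by apply: integralE => //; exact: measurable_itv.
have truncE M K : truncated_kernel lam M K = mxlap lam0 M `[0, K[ :> (R -> 'M[R]_d).
  apply/funext => t; apply/matrixP => i j; rewrite !mxE /Rintegral; congr fine.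
  by apply: integralE => //; exact: measurable_itv.
have tailE (K : R) : 0 < K -> tail_r lam K = tail_r lam0 K.
  move=> K0; rewrite /tail_r integralE//; last exact: subK.
  apply: eq_integral => x _; apply: integralE; [exact: measurable_itv|exact: subK].
have GbarE t : Gbar lam t = laplace lam0 `[0%R, +oo[ t.
  by apply: integralE => //; exact: measurable_itv.
have lapfin (t : R) : 0 < t -> (laplace lam0 `[0%R, +oo[ t < +oo)%E.
  by move=> t0; rewrite -GbarE; exact: hGbar.
have L0 := ltW hL; have T0 := ltW hT.
have Lb x y : fnorm (b x - b y) <= L * fnorm (x - y).
  by apply: le_trans (hLip x y); rewrite lerDl fnorm_ge0.
have Ls x y : fnorm (sigma x - sigma y) <= L * fnorm (x - y).
  by apply: le_trans (hLip x y); rewrite lerDr fnorm_ge0.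
pose A1 := (d * d)%:R * c1 ^+ 2; pose A2 := (d * d)%:R * c2 ^+ 2.
have A10 : 0 <= A1 by rewrite mulr_ge0// sqr_ge0.
have A20 : 0 <= A2 by rewrite mulr_ge0// sqr_ge0.
pose lap s := fine (laplace lam0 `[0%R, +oo[ s).
(* The shape is that of [kernel_approximation_le], with [A1 + A2] covering both kernels. Where the
   transform is infinite, which can occur at 0, [fine] returns 0; the bounds by [g] are therefore
   stated for [0 < s]. *)
pose g s := 2 * (A1 + A2) * lap s ^+ 2 + 2 * Dbar s ^+ 2.
have mlap : measurable_fun (`[0, T] : set (measurableTypeR R)) (laplace lam0 `[0%R, +oo[).
  by apply: measurable_laplace; exact: measurable_itv.
have mg : measurable_fun (`[0, T] : set R) g.
  apply: measurable_funD; apply: measurable_funM => //; last exact: measurable_funX.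
  apply: measurable_funX; apply: (measurableT_comp (f := @fine R)) => //.
have g0 (s : R) : 0 <= s <= T -> 0 <= g s.
  by move=> _; rewrite addr_ge0// mulr_ge0 ?sqr_ge0// mulr_ge0// addr_ge0.
have gfin : (\int[lebesgue_measure]_(s in `[0%R, T]) (g s)%:E < +oo)%E.
  have mlap2 : measurable_fun (`[0, T] : set (measurableTypeR R))
      (fun s => (laplace lam0 `[0%R, +oo[ s * laplace lam0 `[0%R, +oo[ s)%E).
    exact: emeasurable_funM.
  have mD2 : measurable_fun (`[0, T] : set (measurableTypeR R)) (fun s => (Dbar s ^+ 2)%:E).
    by apply/measurable_EFinP; exact: measurable_funX.
  have A0 : 0 <= 2 * (A1 + A2) by rewrite mulr_ge0// addr_ge0.
  apply: (@le_lt_trans _ _ (\int[lebesgue_measure]_(s in `[0%R, T])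
      ((2 * (A1 + A2))%:E * (laplace lam0 `[0%R, +oo[ s * laplace lam0 `[0%R, +oo[ s) +
       2%:E * (Dbar s ^+ 2)%:E))%E).
    apply: le_integral_oc.
    - exact/measurable_EFinP.
    - by apply: emeasurable_funD; exact: measurable_funeM.
    - by move=> s /andP[/ltW s0 sT]; rewrite lee_fin g0// s0.
    move=> s /andP[s0 sT]; rewrite -(@fineK _ (laplace lam0 `[0%R, +oo[ s)) //.
    by rewrite ge0_fin_numE ?laplace_ge0// lapfin.
  rewrite ge0_integralD//; first last.
  - exact: measurable_funeM.
  - by move=> s _; rewrite mule_ge0// lee_fin sqr_ge0.
  - exact: measurable_funeM.
  - by move=> s _; rewrite mule_ge0 ?lee_fin// mule_ge0// laplace_ge0.
  rewrite !ge0_integralZl//; last 2 first.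
  - by move=> s _; rewrite lee_fin sqr_ge0.
  - by move=> s _; rewrite mule_ge0// laplace_ge0.
  apply: lte_add_pinfty; apply: lte_mul_pinfty => //.
  by under eq_integral do rewrite -GbarE; exact: hGbar2 hT.
have sub0 : (`[0, +oo[ : set (measurableTypeR R)) `<=` `[0, +oo[ by [].
have mG1 := measurable_mxlap lam0 hM1 (E := `[0, T]%classic) (measurable_itv _) sub0.
have mG2 := measurable_mxlap lam0 hM2 (E := `[0, T]%classic) (measurable_itv _) sub0.
have lap20 s : 0 <= lap s ^+ 2 := sqr_ge0 _.
have dbar20 s : 0 <= Dbar s ^+ 2 := sqr_ge0 _.
have G1g (s : R) : 0 < s <= T -> fnorm (mxlap lam0 M1 `[0, +oo[ s) ^+ 2 <= g s.
  move=> /andP[s0 _]; apply: le_trans (mxlap_le lapfin hM1 M1c s0) _.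
  have := mulr_ge0 A10 (lap20 s); have := mulr_ge0 A20 (lap20 s); have := dbar20 s.
  by rewrite /g -/A1 -/(lap s); lra.
have G2g (s : R) : 0 < s <= T -> fnorm (mxlap lam0 M2 `[0, +oo[ s) ^+ 2 <= g s.
  move=> /andP[s0 _]; apply: le_trans (mxlap_le lapfin hM2 M2c s0) _.
  have := mulr_ge0 A10 (lap20 s); have := mulr_ge0 A20 (lap20 s); have := dbar20 s.
  by rewrite /g -/A2 -/(lap s); lra.
rewrite !kernelE in hX.
have [C C0 stab] := volterra_stability hF hW T0 L0 Lb Ls mg g0 gfin mG1 mG2 G1g G2g hX.
have k0 : 0 <= 2 * (A1 + A2) + 2 by rewrite addr_ge0// mulr_ge0// addr_ge0.
(* [2 * (A1 + A2) + 2] dominates the coefficients of the tail and of the deviations in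
   [integral_kernel_error]; since [C] is only known to be nonnegative, the added 1 makes the
   constant positive. *)
exists (C * (2 * (A1 + A2) + 2) + 1); first by rewrite ltr_wpDl// mulr_ge0.
move=> K K0 t tT; have /andP[t0 tT'] := tT.
have H1g (s : R) : 0 < s <= T -> fnorm (Ghat1 K s) ^+ 2 <= g s.
  move=> /andP[s0 sT]; have s0T : 0 <= s <= T by rewrite (ltW s0).
  have [D1 _] := hD K s K0 s0T.
  rewrite truncE in D1; have := kernel_approximation_le lapfin hM1 M1c s0 D1.
  have := mulr_ge0 A20 (lap20 s).
  by rewrite /g -/A1 -/(lap s); lra.
have H2g (s : R) : 0 < s <= T -> fnorm (Ghat2 K s) ^+ 2 <= g s.
  move=> /andP[s0 sT]; have s0T : 0 <= s <= T by rewrite (ltW s0).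
  have [_ D2] := hD K s K0 s0T.
  rewrite truncE in D2; have := kernel_approximation_le lapfin hM2 M2c s0 D2.
  have := mulr_ge0 A10 (lap20 s).
  by rewrite /g -/A2 -/(lap s); lra.
rewrite unlock.
apply: le_trans (stab _ _ _ (hGhat1 K K0) (hGhat2 K K0) H1g H2g (hXhat K K0) t tT) _.
have mS H : mx_measurable (`[0, T] : set R) H -> mx_measurable (`[0, t] : set R) (H : R -> 'M[R]_d).
  move=> mH i j; apply: measurable_funS (mH i j) => //.
  by move=> s; rewrite /= !in_itv/= => /andP[-> st]; exact: le_trans tT'.
have mH1 := mS _ (hGhat1 K K0); have mH2 := mS _ (hGhat2 K K0).
have e1 := integral_kernel_error lapfin hM1 M1c K0 mH1.
have e2 := integral_kernel_error lapfin hM2 M2c K0 mH2.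
rewrite tailE// !truncE.
have r0 : (0 <= tail_r lam0 K)%E by rewrite -tailE//; exact: tail_r_ge0.
set r := tail_r lam0 K in e1 e2 r0 *.
pose D (H M : R -> 'M[R]_d) s : \bar R := (fnorm (H s - mxlap lam0 M `[0, K[ s) ^+ 2)%:E.
have D_ge0 H M s : (0 <= D H M s)%E by rewrite lee_fin sqr_ge0.
have mDD H M : mx_measurable (`[0, +oo[ : set R) M -> mx_measurable (`[0, t] : set R) H ->
    measurable_fun (`[0, t] : set (measurableTypeR R)) (D H M).
  move=> mM mH; apply/measurable_EFinP; apply: measurable_fnorm_sqr.
  apply: mx_measurableB => //; apply: measurable_mxlap => //; exact: measurable_itv.
have -> : (\int[lebesgue_measure]_(s in `[0%R, t])
    (fnorm (Ghat1 K s - mxlap lam0 M1 `[0%R, K[ s) ^+ 2 +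
     fnorm (Ghat2 K s - mxlap lam0 M2 `[0%R, K[ s) ^+ 2)%:E =
   \int[lebesgue_measure]_(s in `[0%R, t]) D (Ghat1 K) M1 s +
   \int[lebesgue_measure]_(s in `[0%R, t]) D (Ghat2 K) M2 s)%E.
  by rewrite -ge0_integralD//; exact: mDD.
have I10 : (0 <= \int[lebesgue_measure]_(s in `[0%R, t]) D (Ghat1 K) M1 s)%E.
  exact: integral_ge0.
have I20 : (0 <= \int[lebesgue_measure]_(s in `[0%R, t]) D (Ghat2 K) M2 s)%E.
  exact: integral_ge0.
exact: (lee_error_combination C0 A10 A20 r0 I10 I20 e1 e2).
Qed.
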